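(* Distances (for each pair $(s,t)$ of nodes of a directed graph with $n$ nodes, the length of a shortest path from $s$ to $t$ if one exists) can be defined by an $\mathrm{FO{+}Maj}(+,\times)$ query from auxiliary relations that can be maintained in $\mathrm{DynFO}(+,\times)$ under changes that affect $\mathcal{O}\!\left(\frac{\log n}{\log\log n}\right)$ nodes.
   Context: $\mathrm{FO{+}Maj}(+,\times)$ is first-order logic with majority quantifiers and built-in linear order, addition and multiplication. $\mathrm{DynFO}(+,\times)$: a dynamic program over a fixed domain of size $n$ (the nodes), with built-in linear order, addition and multiplication, stores auxiliary relations; initially the graph and auxiliary relations are empty; after each change (a set of edge insertions and deletions, the affected nodes being those occurring in changed edges) every auxiliary relation is redefined by a fixed first-order formula over the changed graph and current auxiliary relations. The claim is that there is such a dynamic program and an $\mathrm{FO{+}Maj}(+,\times)$ formula which, evaluated on the current graph and auxiliary relations after any sequence of such changes, defines the distances. *)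

(* Defs.v *)
From mathcomp Require Import all_boot.

Set Implicit Arguments.
Unset Strict Implicit.
Unset Printing Implicit Defensive.

Record schema := Schema { symbol :> finType; arity : symbol -> nat }.

(* Formulas over {E} + S and the built-in relations =, <=, + and *, with free
   variables among 0, ..., k-1.  Variables are de Bruijn indices: under a
   quantifier, 0 is the bound variable and i.+1 is the outer variable i. *)
Inductive formula (S : schema) (k : nat) : Type :=
| Feq of 'I_k & 'I_k
| Fle of 'I_k & 'I_k
| Fadd of 'I_k & 'I_k & 'I_k
| Fmul of 'I_k & 'I_k & 'I_k
| Fedge of 'I_k & 'I_k
| Faux (r : S) of (arity r).-tuple 'I_k
| Fnot of formula S k
| Fand of formula S k & formula S k
| For of formula S k & formula S k
| Fexists of formula S k.+1
| Fforall of formula S k.+1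
| Fmaj of formula S k.+1.

Fixpoint is_FO (S : schema) (k : nat) (phi : formula S k) : bool :=
  match phi with
  | Fnot p => is_FO p
  | Fand p q | For p q => is_FO p && is_FO q
  | Fexists p | Fforall p => is_FO p
  | Fmaj _ => false
  | _ => true
  end.

Definition digraph (n : nat) := {set 'I_n * 'I_n}.

Record state (S : schema) (n : nat) := State {
  graph : digraph n;
  aux : forall r : S, {set (arity r).-tuple 'I_n}
}.

(* The domain {0, ..., n-1} carries the order and the partial addition and
   multiplication of the natural numbers.  The majority quantifier means
   "for more than half of the elements of the domain". *)
Fixpoint sat (S : schema) (n : nat) (st : state S n) (k : nat)
    (phi : formula S k) (v : k.-tuple 'I_n) : bool :=
  match phi with
  | Feq x y => tnth v x == tnth v y
  | Fle x y => tnth v x <= tnth v y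
  | Fadd x y z => tnth v x + tnth v y == tnth v z
  | Fmul x y z => tnth v x * tnth v y == tnth v z
  | Fedge x y => (tnth v x, tnth v y) \in graph st
  | Faux r args => [tuple of map (tnth v) args] \in aux st r
  | Fnot p => ~~ sat st p v
  | Fand p q => sat st p v && sat st q v
  | For p q => sat st p v || sat st q v
  | Fexists p => [exists a : 'I_n, sat st p [tuple of a :: v]]
  | Fforall p => [forall a : 'I_n, sat st p [tuple of a :: v]]
  | Fmaj p => n < 2 * #|[set a : 'I_n | sat st p [tuple of a :: v]]|
  end.

Record change (n : nat) := Change {
  insertions : {set 'I_n * 'I_n};
  deletions : {set 'I_n * 'I_n}
}.

Definition changed_edges (n : nat) (c : change n) : {set 'I_n * 'I_n} :=
  insertions c :|: deletions c.

Definition affected (n : nat) (c : change n) : {set 'I_n} :=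
  [set e.1 | e in changed_edges c] :|: [set e.2 | e in changed_edges c].

(* An edge that is both deleted and inserted is present afterwards. *)
Definition apply_change (n : nat) (G : digraph n) (c : change n) : digraph n :=
  (G :\: deletions c) :|: insertions c.

Record dynprog := DynProg {
  aux_schema : schema;
  update : forall r : aux_schema, formula aux_schema (arity r);
  update_FO : forall r : aux_schema, is_FO (update r)
}.

Definition init_state (S : schema) (n : nat) : state S n :=
  State set0 (fun r => set0).

(* Update formulas see the changed graph, but the auxiliary relations from
   before the change. *)
Definition step (P : dynprog) (n : nat) (st : state (aux_schema P) n)
    (c : change n) : state (aux_schema P) n :=
  let G := apply_change (graph st) c in
  State G (fun r => [set t | sat (State G (aux st)) (update r) t]).

Definition run (P : dynprog) (n : nat) (cs : seq (change n)) :
    state (aux_schema P) n :=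
  foldl (@step P n) (init_state (aux_schema P) n) cs.

Definition path_from_to (n : nat) (G : digraph n) (s t : 'I_n)
    (p : seq 'I_n) : bool :=
  path (fun x y => (x, y) \in G) s p && (last s p == t).

(* The source s is not listed in p, so size p is the number of edges. *)
Definition is_distance (n : nat) (G : digraph n) (s t : 'I_n) (d : nat) : Prop :=
  (exists2 p, path_from_to G s t p & size p = d) /\
  (forall p, path_from_to G s t p -> d <= size p).

(* Main.v *)
(** Let A be the adjacency matrix of the current graph.  Coefficient d of the entry (s, t) of
    (1 - xA)^-1 counts the walks of length d from s to t, so the distance is the least index of a
    nonzero coefficient, and a nonzero coefficient is nonzero modulo some prime p in (n^4, n^8].
    For all such p and all 0 < a < p, the program maintains (1 - aA)^-1 modulo p.  A change on k
    nodes is a change of the matrix of rank at most k; by the Woodbury identity every entry of the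
    new inverse is a quotient of two determinants of size at most 2k+1.  These are first-order
    definable for k = O(log n / log log n): numbers below n^C code sequences of that length by
    their residues modulo consecutive small primes, and iterating this O(1) times gives walks and
    sums of polylogarithmic length.  A determinant modulo a small prime is the product along a
    walk of quotients of consecutive leading minors, each of which is certified by the solution of
    a linear system; determinants modulo p are lifted from these by interpolation and Chinese
    remaindering.

    The matrix 1 - aA may be singular modulo p.  Therefore the program also keeps the product E(a)
    of the determinants of all graphs since the last reset; as a polynomial in a it has constant
    term 1, and its degree is bounded because a second copy is rebuilt edge by edge from the empty
    graph and replaces the first copy every O(n^2) changes.  The query recovers the coefficients
    of the polynomial E(a)^2 (1 - aA)^-1 from its values by a sum over all a, which is where
    majority quantifiers are used.  Before the first copy is ready, only polylogarithmically many
    nodes have edges, and distances are defined directly. *)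

Require Import Defs.
From mathcomp Require Import all_boot all_order all_algebra all_fingroup all_field.
From mathcomp Require Import zify ring.
From Stdlib Require Import Classical_Prop.
Import GRing.Theory Num.Theory.

Set Implicit Arguments.
Unset Strict Implicit.
Unset Printing Implicit Defensive.

(** * Primes *)

(** The bound on k enters only as $(\log n)^{O(k)} \le n^{O(1)}$: a vector of length 2k+1 over a
    field of polylogarithmic size is a single number below n^C and can be quantified, whereas a
    vector modulo p, with p up to n^8, cannot. For this reason the bits of the entries become
    coefficients of polynomials: the determinant of these polynomials has coefficients small enough
    for polylogarithmic primes, and its value at 2 is the determinant wanted. Leading minors may
    vanish; adding z to the diagonal turns each of them into a nonzero polynomial in z.

    Many relations below are sound for all arguments but complete only for good ones (small moduli,
    nonvanishing minors). They are used as premises of universal conditions, where a missing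
    instance does no harm as long as enough good arguments remain.

    For an a at which some 1 - aA was singular, updates cannot restore the inverse; the factor
    E(a)^2 cancels these a. A copy lives for at most 2n^2+2 updates, each adding at most n to the
    degree of E, so the polynomial read by the query has degree about 4n^3, and p > n^4 allows
    interpolation. Walk counts are below 2^(n^2), and (n^4, n^8] contains at least n^4 primes. *)

Definition primes_upto (x : nat) : seq nat := [seq p <- iota 0 x.+1 | prime p].

Lemma mem_primes_upto x p : (p \in primes_upto x) = prime p && (p <= x).
Proof. by rewrite mem_filter mem_iota /= add0n ltnS. Qed.

(** In Legendre's formula the k-th term for 2m exceeds twice the term for m by at most 1, and only
    the terms with p^k <= 2m are nonzero. *)
Lemma logn_central_bin p m : prime p -> 0 < m -> p ^ logn p 'C(m.*2, m) <= m.*2.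
Proof.
move=> pr_p m_gt0.
have p1 : 1 < p := prime_gt1 pr_p.
have B : 'C(m.*2, m) * (m`! * m`!) = (m.*2)`!.
  by have := @bin_fact m.*2 m; rewrite -{3}addnn addnK; apply; lia.
have LB : logn p 'C(m.*2, m) = logn p (m.*2)`! - (logn p m`!).*2.
  rewrite -B !lognM ?muln_gt0 ?fact_gt0 ?bin_gt0 //; lia.
set T := trunc_log p m.*2.
have T1 : p ^ T <= m.*2 by apply: trunc_logP; lia.
have T2 : m.*2 < p ^ T.+1 by apply: trunc_log_ltn.
apply: leq_trans T1; rewrite leq_exp2l // LB.
have pf (x : nat) : x <= m.*2 -> logn p x`! = \sum_(1 <= k < T.+1) x %/ p ^ k.
  move=> xm; rewrite logn_fact //.
  have small k : T.+1 <= k -> x %/ p ^ k = 0.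
    move=> Tk; apply: divn_small; apply: leq_ltn_trans xm (leq_trans T2 _).
    by rewrite leq_exp2l.
  case: (leqP x T) => xT.
    rewrite [RHS](@big_cat_nat _ _ _ x.+1) //= [X in _ = _ + X]big_nat_cond.
    rewrite [X in _ = _ + X]big1 ?addn0 //.
    move=> k; rewrite andbT => /andP[xk _]; apply: divn_small.
    by apply: leq_trans (ltn_expl _ p1); lia.
  rewrite (@big_cat_nat _ _ _ T.+1) //=; last by lia.
  rewrite [X in _ + X = _]big_nat_cond.
  rewrite [X in _ + X = _]big1 ?addn0 //.
  by move=> k; rewrite andbT => /andP[Tk _]; apply: small.
rewrite pf // (pf m); last lia.
rewrite leq_subLR -[X in _ <= X + _]addnn -big_split /=.
apply: leq_trans (_ : \sum_(1 <= k < T.+1) ((m %/ p ^ k + m %/ p ^ k) + 1) <= _); last first.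
  by rewrite big_split /= sum_nat_const_nat muln1 subn1.
apply: leq_sum => k _.
have pk : 0 < p ^ k by rewrite expn_gt0; lia.
rewrite -ltnS ltn_divLR //.
by have := divn_eq m (p ^ k); have := ltn_pmod m pk; nia.
Qed.

Lemma central_bin_upper m : 0 < m ->
  'C(m.*2, m) <= m.*2 ^ size (primes_upto m.*2).
Proof.
move=> m_gt0.
have bg : 0 < 'C(m.*2, m) by rewrite bin_gt0; lia.
have -> : 'C(m.*2, m) = \prod_(p <- primes_upto m.*2) p ^ logn p 'C(m.*2, m).
  rewrite {1}(prod_prime_decomp bg) prime_decompE big_map /=.
  set s := primes _; rewrite [RHS](bigID (mem s)) /= [X in _ = _ * X]big1_seq ?muln1; last first.
    move=> p /andP[ps _]; move: ps; rewrite /s -logn_gt0 -leqNgt leqn0 => /eqP->.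
    by rewrite expn0.
  rewrite -[RHS]big_filter; apply: perm_big; apply: uniq_perm; rewrite ?primes_uniq ?filter_uniq ?iota_uniq //.
  move=> p; rewrite !mem_filter mem_iota /=; apply/idP/idP => [ps|/andP[]//].
  rewrite ps; move: ps; rewrite mem_primes => /and3P[pr_p _ pd]; rewrite pr_p /=.
  have := logn_central_bin pr_p m_gt0; apply: contraTT; rewrite -!ltnNge => h.
  have : 0 < logn p 'C(m.*2, m) by rewrite logn_gt0 mem_primes pr_p bg.
  move=> lg; apply: leq_trans (_ : p ^ 1 <= _); first by rewrite expn1; lia.
  by rewrite leq_exp2l // prime_gt1.
have -> : m.*2 ^ size (primes_upto m.*2) = \prod_(p <- primes_upto m.*2) m.*2.
  by rewrite big_const_seq count_predT iter_muln_1.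
rewrite big_seq_cond [X in _ <= X]big_seq_cond; apply: leq_prod => p; rewrite andbT mem_primes_upto => /andP[pr_p _].
exact: logn_central_bin.
Qed.

Lemma central_bin_lower m : 0 < m -> 4 ^ m <= 'C(m.*2, m) * m.*2.
Proof.
elim: m => // -[_ _|m IH _]; first by rewrite bin1.
have := IH isT; set a := 'C(m.+1.*2, m.+1) => IHm.
have : 'C(m.+2.*2, m.+2) * m.+2 = a * (m.+1.*2.+1).*2.
  have e1 : 'C(m.+2.*2, m.+2) * m.+2 = m.+2.*2 * 'C(m.+1.*2.+1, m.+1).
    by rewrite mulnC -mul_bin_diag.
  have e2 : m.+2 * 'C(m.+1.*2.+1, m.+1) = m.+1.*2.+1 * a.
    have := mul_bin_down m.+1.*2.+1 m.+1; rewrite -/a => e.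
    by move: e; have -> : m.+1.*2.+1 - m.+1 = m.+2 by lia.
  by rewrite e1; nia.
rewrite expnS; set b := 'C(m.+2.*2, m.+2) => e; nia.
Qed.

Lemma sqr_lt_exp2 j : 2 * j.+4.+4 ^ 2 < 2 ^ j.+4.+4.
Proof.
elim: j => // j IH; rewrite expnS.
have : 2 * j.+1.+4.+4 ^ 2 <= 2 * (2 * j.+4.+4 ^ 2) by nia.
by move=> h; apply: leq_ltn_trans h _; rewrite ltn_pmul2l.
Qed.

(** Chebyshev's argument: with m = floor(y^2 / 2), the bounds 4^m / 2m <= C(2m, m) <= (2m)^(number
    of primes up to 2m) leave no room for only 2y primes. *)
Lemma many_primes_upto y : 32 <= y -> y.*2 < size (primes_upto (y ^ 2)).
Proof.
move=> y32; set m := (y ^ 2)./2.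
have m2 : m.*2 <= y ^ 2 by rewrite /m; lia.
have m2' : y ^ 2 <= m.*2.+1 by rewrite /m; lia.
have m0 : 0 < m by move: m2' y32; rewrite -mulnn; clear; nia.
have sub : size (primes_upto m.*2) <= size (primes_upto (y ^ 2)).
  apply: uniq_leq_size; first by rewrite filter_uniq ?iota_uniq.
  by move=> p; rewrite !mem_primes_upto => /andP[-> /leq_trans->].
apply: leq_trans sub; rewrite ltnNge; apply/negP => sz.
have h : 4 ^ m <= m.*2 ^ y.*2.+1.
  apply: leq_trans (central_bin_lower m0) _.
  apply: (@leq_trans (m.*2 ^ y.*2 * m.*2)); last by rewrite expnSr.
  rewrite leq_mul2r; apply/orP; right; apply: leq_trans (central_bin_upper m0) _.
  by rewrite leq_pexp2l //; lia.
(* [t] is small enough that t(2y+1) stays below y^2 - 1 <= 2m, and large enough that 2m < 2^t.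
   Comparing 4^m with (2m)^(2y+1) then gives the contradiction. *)
set t := y./2.-1.
have ty : y <= t.*2 + 3 by rewrite /t; lia.
have t15 : 15 <= t by rewrite /t; lia.
have h2 : m.*2 < 2 ^ t.
  apply: leq_ltn_trans m2 _.
  have := @sqr_lt_exp2 (t - 10); have -> : (t - 10).+4.+4 = t - 2 by lia.
  have -> : 2 ^ t = 4 * 2 ^ (t - 2) by rewrite -[4]/(2 ^ 2) -expnD; congr (_ ^ _); lia.
  set e := 2 ^ (t - 2) => hh; move: ty t15 hh; rewrite -!mulnn; clear; nia.
have : 4 ^ m < 2 ^ (t * y.*2.+1).
  apply: leq_ltn_trans h _; rewrite expnM ltn_exp2r //.
rewrite (_ : 4 = 2 ^ 2) // -expnM ltn_exp2l // => h3.
have ty2 : t.*2 + 2 <= y by rewrite /t; lia.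
by move: m2' h3 ty2 y32; rewrite -mulnn; clear; nia.
Qed.

Definition primes_in (a b : nat) : seq nat := [seq p <- iota 0 b.+1 | prime p & a < p].

Lemma mem_primes_in a b p : (p \in primes_in a b) = [&& prime p, a < p & p <= b].
Proof. by rewrite mem_filter mem_iota /= add0n ltnS -andbA. Qed.

(** More than 2y primes are at most y^2, and at most y of them are at most y. *)
Lemma many_primes y : 32 <= y -> y <= size (primes_in y (y ^ 2)).
Proof.
move=> y32; have := many_primes_upto y32.
have <- : count [pred p | y < p] (primes_upto (y ^ 2)) = size (primes_in y (y ^ 2)).
  by rewrite /primes_in -size_filter -filter_predI; congr size; apply: eq_filter => p /=; rewrite andbC.
rewrite -(count_predC [pred p | y < p]) => h.
suff : count (predC [pred p | y < p]) (primes_upto (y ^ 2)) <= y by lia.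
rewrite -size_filter -[X in _ <= X](size_iota 1 y); apply: uniq_leq_size.
  by rewrite !filter_uniq ?iota_uniq.
move=> p; rewrite mem_filter /= mem_primes_upto mem_iota -leqNgt => /and3P[py pr_p _].
by rewrite prime_gt0 //= ; lia.
Qed.

Lemma primes_in_uniq a b : uniq (primes_in a b).
Proof. by rewrite filter_uniq ?iota_uniq. Qed.

Lemma primes_in_sorted a b : sorted ltn (primes_in a b).
Proof. by apply: sorted_filter; [exact: ltn_trans | exact: iota_ltn_sorted]. Qed.

Lemma prod_primes_dvd (s : seq nat) x :
  uniq s -> all prime s -> {in s, forall p, p %| x} -> \prod_(p <- s) p %| x.
Proof.
elim: s => [|p s IH]; first by rewrite big_nil dvd1n.
rewrite /= => /andP[ps us] /andP[pr_p ap] h; rewrite big_cons Gauss_dvd.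
  rewrite h ?mem_head //= IH // => q qs; apply: h; by rewrite inE qs orbT.
rewrite prime_coprime // Euclid_dvd_prod //; apply/negP; rewrite big_has => /hasP[q qs].
rewrite dvdn_prime2 //; first by move/eqP => e; rewrite e qs in ps.
by move/allP: ap; apply.
Qed.

Lemma prod_primes_ge (s : seq nat) : all prime s -> 2 ^ size s <= \prod_(p <- s) p.
Proof.
elim: s => [|p s IH] /=; first by rewrite big_nil.
by move=> /andP[pr_p /IH h]; rewrite big_cons expnS leq_mul // prime_gt1.
Qed.

Lemma exists_nondividing_prime (s : seq nat) x :
  uniq s -> all prime s -> 0 < x -> x < 2 ^ size s -> exists2 p, p \in s & ~~ (p %| x).
Proof.
move=> us ap x0 xs; case: (boolP (has (fun p => ~~ (p %| x)) s)) => [/hasP//|].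
rewrite -all_predC => /allP /= h.
have /(dvdn_leq x0) := prod_primes_dvd us ap (fun p ps => negbNE (h p ps)).
by move/(leq_trans (prod_primes_ge ap)); lia.
Qed.

Lemma eq_of_congruent_primes (s : seq nat) x y : uniq s -> all prime s ->
  x < 2 ^ size s -> y < 2 ^ size s -> {in s, forall p, x = y %[mod p]} -> x = y.
Proof.
move=> us ap; wlog xy : x y / x <= y.
  move=> W xs ys h; case: (leqP x y) => [xy|/ltnW yx]; first exact: W.
  by symmetry; apply: W => // p ps; rewrite h.
move=> xs ys h; apply/eqP; rewrite eqn_leq xy -subn_eq0 -leqn0 leqNgt; apply/negP => d0.
have [|p ps /negP[]] := exists_nondividing_prime us ap d0; first by lia.
by rewrite -eqn_mod_dvd // h.
Qed.

Lemma crt_primes (s : seq nat) (r : nat -> nat) : uniq s -> all prime s ->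
  exists2 W, W < \prod_(p <- s) p & {in s, forall p, W = r p %[mod p]}.
Proof.
elim: s => [|p s IH] /=; first by exists 0; rewrite ?big_nil.
move=> /andP[ps us] /andP[pr_p ap]; have [W Wl Wr] := IH us ap.
set P := \prod_(q <- s) q.
have co : coprime P p.
  rewrite coprime_sym prime_coprime // Euclid_dvd_prod // big_has; apply/negP => /hasP[q qs].
  rewrite dvdn_prime2 //; first by move/eqP => e; rewrite e qs in ps.
  by move/allP: ap; apply.
have P0 : 0 < P by rewrite (leq_trans _ (prod_primes_ge ap)) // expn_gt0.
exists (chinese P p W (r p) %% (P * p)).
  by rewrite big_cons mulnC ltn_pmod // muln_gt0 P0 prime_gt0.
move=> q; rewrite inE => /orP[/eqP->|qs].
  by rewrite modn_dvdm ?dvdn_mull // chinese_modr.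
have qP : q %| P by rewrite /P (big_rem q) //= dvdn_mulr.
rewrite modn_dvdm ?dvdn_mulr // -(@modn_dvdm P _ q) //.
by rewrite (chinese_modl co) modn_dvdm // Wr.
Qed.

Lemma leq_expl m n e : m <= n -> m ^ e <= n ^ e.
Proof. by case: e => // e; rewrite leq_exp2r. Qed.

Lemma pow_le_exp2 D : exists Y, forall y, Y <= y -> y ^ D <= 2 ^ y.
Proof.
exists (2 ^ (D + 8)) => y Yy.
have y0 : 0 < y by apply: leq_trans Yy; rewrite expn_gt0.
have z1 : 2 ^ trunc_log 2 y <= y by apply: trunc_logP.
have z2 : y < 2 ^ (trunc_log 2 y).+1 by apply: trunc_log_ltn.
have zD : D + 8 <= trunc_log 2 y by rewrite trunc_log_max.
set z := trunc_log 2 y in z1 z2 zD.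
apply: leq_trans (_ : (2 ^ z.+1) ^ D <= _); first by rewrite leq_expl // ltnW.
rewrite -expnM leq_exp2l //; apply: leq_trans z1.
have := sqr_lt_exp2 (z - 8); have -> : (z - 8).+4.+4 = z by lia.
by move: zD; rewrite -mulnn; clear; set e := 2 ^ z; nia.
Qed.

Lemma fourth_root n : 0 < n -> exists2 y, y ^ 4 < n & n <= y.+1 ^ 4.
Proof.
elim: n => // -[_ _|n IH _]; first by exists 0.
have [y y1 y2] := IH isT; case: (leqP n.+2 (y.+1 ^ 4)) => h; first by exists y => //; lia.
exists y.+1 => //; apply: leq_trans (_ : (y.+1 ^ 4).+1 <= _); first by lia.
by rewrite ltn_exp2r.
Qed.

(** Let z be about the fourth root of n. The primes in (z, z^2] have squares below n, and there are
    at least z of them, so their product is at least 2^z, which exceeds n^D for large n.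
    Polynomially bounded numbers can therefore be compared through residues that the built-in
    arithmetic handles. *)
Lemma eq_of_small_congruences D : exists N0, forall n x y, N0 <= n ->
  x < n ^ D -> y < n ^ D ->
  (forall m, 0 < m -> m * m < n -> x = y %[mod m]) -> x = y.
Proof.
have [Y hY] := pow_le_exp2 (8 * D); exists ((Y + 40) ^ 4).+1 => n x y Nn xn yn h.
have [|z z1 z2] := @fourth_root n; first by lia.
have zY : Y + 40 <= z.
  by rewrite -ltnS -(@ltn_exp2r _ _ 4) //; apply: leq_trans Nn z2.
have bnd : n ^ D <= 2 ^ size (primes_in z (z ^ 2)).
  apply: leq_trans (_ : 2 ^ z <= _); last by rewrite leq_exp2l ?many_primes //; lia.
  apply: leq_trans (hY z _); last by lia.
  rewrite expnM; apply: leq_expl; apply: leq_trans z2 _.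
  have -> : z ^ 8 = (z ^ 2) ^ 4 by rewrite -expnM.
  apply: leq_expl.
  by rewrite -mulnn; move: zY; clear; nia.
apply: (@eq_of_congruent_primes (primes_in z (z ^ 2))) => //.
- exact: primes_in_uniq.
- by apply/allP => p; rewrite mem_primes_in => /and3P[].
- exact: leq_trans xn bnd.
- exact: leq_trans yn bnd.
move=> p; rewrite mem_primes_in => /and3P[pr_p _ pz]; apply: h; first exact: prime_gt0.
apply: leq_ltn_trans z1; have -> : z ^ 4 = z ^ 2 * z ^ 2 by rewrite -expnD.
exact: leq_mul.
Qed.

(** * Definable predicates on the domain *)

(** One relation symbol is enough: all auxiliary data are packed into one relation whose first
    component is a tag. *)
Definition one_schema (A : nat) : schema := @Schema unit (fun _ => A).

Record structure (A : nat) := Structure { dom : nat; dom_state : state (one_schema A) dom }.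

Definition lift_var k k' (s : 'I_k -> 'I_k') (i : 'I_k.+1) : 'I_k'.+1 :=
  if unlift ord0 i is Some j then lift ord0 (s j) else ord0.

Fixpoint frename (S : schema) k (phi : formula S k) : forall k', ('I_k -> 'I_k') -> formula S k' :=
  match phi in formula _ _ return forall k', ('I_k -> 'I_k') -> formula S k' with
  | Feq x y => fun k' s => Feq S (s x) (s y)
  | Fle x y => fun k' s => Fle S (s x) (s y)
  | Fadd x y z => fun k' s => Fadd S (s x) (s y) (s z)
  | Fmul x y z => fun k' s => Fmul S (s x) (s y) (s z)
  | Fedge x y => fun k' s => Fedge S (s x) (s y)
  | Faux r a => fun k' s => Faux (r := r) [tuple of map s a]
  | Fnot p => fun k' s => Fnot (frename p s)
  | Fand p q => fun k' s => Fand (frename p s) (frename q s)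
  | For p q => fun k' s => For (frename p s) (frename q s)
  | Fexists p => fun k' s => Fexists (frename p (lift_var s))
  | Fforall p => fun k' s => Fforall (frename p (lift_var s))
  | Fmaj p => fun k' s => Fmaj (frename p (lift_var s))
  end.

Lemma frename_FO S k (phi : formula S k) k' (s : 'I_k -> 'I_k') :
  is_FO (frename phi s) = is_FO phi.
Proof.
elim: phi k' s => //= {k} k.
- by move=> p IHp q IHq k' s; rewrite IHp IHq.
- by move=> p IHp q IHq k' s; rewrite IHp IHq.
Qed.

Lemma lift_var_tuple n k k' (s : 'I_k -> 'I_k') (a : 'I_n) (v : k'.-tuple 'I_n) :
  [tuple tnth [tuple of a :: v] (lift_var s i) | i < k.+1] =
  [tuple of a :: [tuple tnth v (s i) | i < k]].
Proof.
apply: eq_from_tnth => i; rewrite tnth_mktuple /lift_var; case: unliftP => [j ->|->].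
  by rewrite !tnthS tnth_mktuple.
by rewrite !tnth0.
Qed.

Lemma sat_frename S n (st : state S n) k (phi : formula S k) k' (s : 'I_k -> 'I_k') (v : k'.-tuple 'I_n) :
  sat st (frename phi s) v = sat st phi [tuple tnth v (s i) | i < k].
Proof.
elim: phi k' s v => /= {k} k.
- by move=> x y k' s v; rewrite !tnth_mktuple.
- by move=> x y k' s v; rewrite !tnth_mktuple.
- by move=> x y z k' s v; rewrite !tnth_mktuple.
- by move=> x y z k' s v; rewrite !tnth_mktuple.
- by move=> x y k' s v; rewrite !tnth_mktuple.
- move=> r a k' s v.
  set u := [tuple of _]; set w := [tuple of _]; suff -> : u = w by [].
  by apply: val_inj; rewrite /= -map_comp; apply: eq_map => i /=; rewrite tnth_mktuple.
- by move=> p IHp k' s v; rewrite IHp.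
- by move=> p IHp q IHq k' s v; rewrite IHp IHq.
- by move=> p IHp q IHq k' s v; rewrite IHp IHq.
- by move=> p IHp k' s v; apply: eq_existsb => a; rewrite IHp lift_var_tuple.
- by move=> p IHp k' s v; apply: eq_forallb => a; rewrite IHp lift_var_tuple.
- by move=> p IHp k' s v; congr (_ < 2 * _); apply: eq_card => a; rewrite !inE IHp lift_var_tuple.
Qed.

Lemma nth_map_val n k (v : k.-tuple 'I_n) i (ik : i < k) :
  nth 0 (map val v) i = tnth v (Ordinal ik).
Proof.
have x0 := tnth v (Ordinal ik).
by rewrite (nth_map x0) ?size_tuple // (tnth_nth x0).
Qed.

(* The list s makes sense of the cardinality although P is not decidable. *)
Definition majority (n : nat) (P : nat -> Prop) : Prop :=
  exists s : seq nat, [/\ uniq s, forall x, x \in s <-> x < n /\ P x & n < 2 * size s].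

Section Definability.
Variable A : nat.
Implicit Types (M : structure A) (e : seq nat).

Definition auxrel M (xs : seq nat) : Prop :=
  exists2 t, t \in aux (dom_state M) tt & map val t = xs.

Definition edge M (x y : nat) : Prop :=
  exists a b : 'I_(dom M), [/\ val a = x, val b = y & (a, b) \in graph (dom_state M)].

(* The threshold N0 is harmless: bounded domains are treated by explicit formulas. *)
Definition bdef (mj : bool) (k : nat) (F : structure A -> seq nat -> Prop) : Prop :=
  exists (phi : formula (one_schema A) k) (N0 : nat), (mj || is_FO phi) /\
    forall M (v : k.-tuple 'I_(dom M)), N0 <= dom M ->
      (sat (dom_state M) phi v <-> F M (map val v)).

Lemma bdef_ext mj k F G N1 :
  (forall M e, N1 <= dom M -> size e = k -> all (gtn (dom M)) e -> (F M e <-> G M e)) ->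
  bdef mj k F -> bdef mj k G.
Proof.
move=> FG [phi [N0 [fo h]]]; exists phi, (maxn N0 N1); split=> // M v hM.
rewrite h; last by lia.
apply: FG; first by lia.
  by rewrite size_map size_tuple.
by apply/allP => x /mapP[i _ ->] /=.
Qed.

Lemma bdef_weaken mj k F : bdef false k F -> bdef mj k F.
Proof. by move=> [phi [N0 [fo h]]]; exists phi, N0; rewrite (fo : is_FO phi) orbT. Qed.

Lemma bdef_and mj k F G : bdef mj k F -> bdef mj k G ->
  bdef mj k (fun M e => F M e /\ G M e).
Proof.
move=> [p [a [fp hp]]] [q [b [fq hq]]]; exists (Fand p q), (maxn a b); split.
  by case: mj fp fq => //= -> ->.
move=> M v hM /=; rewrite -hp -?hq; [|lia|lia].
by split=> [/andP|[-> ->]].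
Qed.

Lemma bdef_or mj k F G : bdef mj k F -> bdef mj k G ->
  bdef mj k (fun M e => F M e \/ G M e).
Proof.
move=> [p [a [fp hp]]] [q [b [fq hq]]]; exists (For p q), (maxn a b); split.
  by case: mj fp fq => //= -> ->.
move=> M v hM /=; rewrite -hp -?hq; [|lia|lia].
by split=> [/orP|/orP].
Qed.

Lemma bdef_not mj k F : bdef mj k F -> bdef mj k (fun M e => ~ F M e).
Proof.
move=> [p [a [fp hp]]]; exists (Fnot p), a; split=> // M v hM /=.
by rewrite -hp //; split=> /negP.
Qed.

Lemma bdef_imp mj k F G : bdef mj k F -> bdef mj k G ->
  bdef mj k (fun M e => F M e -> G M e).
Proof.
move=> [p [a [fp hp]]] [q [b [fq hq]]]; exists (For (Fnot p) q), (maxn a b); split.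
  by case: mj fp fq => //= -> ->.
move=> M v hM /=; rewrite -hp -?hq; [|lia|lia].
by split=> [/orP[/negP//|//]|]; case: (sat _ p _) => //= ->.
Qed.

Lemma bdef_iff mj k F G : bdef mj k F -> bdef mj k G ->
  bdef mj k (fun M e => F M e <-> G M e).
Proof. by move=> hF hG; apply: bdef_and; apply: bdef_imp. Qed.

Lemma bdef_ex mj k (F : structure A -> seq nat -> nat -> Prop) :
  bdef mj k.+1 (fun M e => F M (behead e) (nth 0 e 0)) ->
  bdef mj k (fun M e => exists2 x, x < dom M & F M e x).
Proof.
move=> [p [a [fp hp]]]; exists (Fexists p), a; split=> // M v hM /=; split.
  by move=> /existsP[x]; rewrite hp // => h; exists (val x); [exact: ltn_ord | exact: h].
by move=> [x xM h]; apply/existsP; exists (Ordinal xM); rewrite hp.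
Qed.

Lemma bdef_all mj k (F : structure A -> seq nat -> nat -> Prop) :
  bdef mj k.+1 (fun M e => F M (behead e) (nth 0 e 0)) ->
  bdef mj k (fun M e => forall x, x < dom M -> F M e x).
Proof.
move=> [p [a [fp hp]]]; exists (Fforall p), a; split=> // M v hM /=; split.
  by move=> /forallP h x xM; have := h (Ordinal xM); rewrite hp.
by move=> h; apply/forallP => x; rewrite hp //=; apply: h.
Qed.

Lemma bdef_maj k (F : structure A -> seq nat -> nat -> Prop) :
  bdef true k.+1 (fun M e => F M (behead e) (nth 0 e 0)) ->
  bdef true k (fun M e => majority (dom M) (F M e)).
Proof.
move=> [p [a [fp hp]]]; exists (Fmaj p), a; split=> // M v hM /=.
set X := [set a | _].
have XP x (xM : x < dom M) : F M (map val v) x <-> Ordinal xM \in X.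
  by rewrite inE hp.
split=> [h|[s [us hs hn]]].
  exists (map val (enum X)); split; last by rewrite size_map -cardE.
    by rewrite map_inj_uniq ?enum_uniq //; exact: val_inj.
  move=> x; split=> [/mapP[y]|[xM /(XP x xM) h']].
    rewrite mem_enum => yX ->; split; [exact: ltn_ord | apply: (XP _ (ltn_ord y)).2].
    by have -> : Ordinal (ltn_ord y) = y by apply: val_inj.
  by apply/mapP; exists (Ordinal xM); rewrite ?mem_enum.
suff -> : #|X| = size s by [].
rewrite cardE -(size_map val); apply: perm_size; apply: uniq_perm => //.
  by rewrite map_inj_uniq ?enum_uniq //; exact: val_inj.
move=> x; apply/mapP/idP => [[y]|/hs[xM /(XP x xM) h']].
  rewrite mem_enum => yX ->; apply/hs; split; [exact: ltn_ord | apply: (XP _ (ltn_ord y)).2].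
  by have -> : Ordinal (ltn_ord y) = y by apply: val_inj.
by exists (Ordinal xM); rewrite ?mem_enum.
Qed.

(** Variables are functions of the environment. Under a quantifier [e] turns into [behead e];
    recording that the function is still a projection lets tactics find the index by unification. *)
Definition bvar k (t : seq nat -> nat) : Prop := exists2 i, (forall e, t e = nth 0 e i) & i < k.

Lemma bdef_eq mj k s t : bvar k s -> bvar k t -> bdef mj k (fun M e => s e = t e).
Proof.
move=> [i si ik] [j tj jk]; exists (Feq _ (Ordinal ik) (Ordinal jk)), 0; split.
  by rewrite orbT.
move=> M v _ /=; rewrite si tj !nth_map_val; split=> [/eqP->//|/val_inj->//].
Qed.

Lemma bdef_le mj k s t : bvar k s -> bvar k t -> bdef mj k (fun M e => s e <= t e).
Proof.
move=> [i si ik] [j tj jk]; exists (Fle _ (Ordinal ik) (Ordinal jk)), 0; split.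
  by rewrite orbT.
by move=> M v _ /=; rewrite si tj !nth_map_val.
Qed.

Lemma bdef_lt mj k s t : bvar k s -> bvar k t -> bdef mj k (fun M e => s e < t e).
Proof.
move=> hs ht; apply: (bdef_ext (N1 := 0)) (bdef_not (bdef_le mj ht hs)).
by move=> M e _ _ _ /=; rewrite ltnNge; split=> /negP.
Qed.

Lemma bdef_add mj k r s t : bvar k r -> bvar k s -> bvar k t ->
  bdef mj k (fun M e => r e + s e = t e).
Proof.
move=> [h rh hk] [i si ik] [j tj jk].
exists (Fadd _ (Ordinal hk) (Ordinal ik) (Ordinal jk)), 0; split; first by rewrite orbT.
by move=> M v _ /=; rewrite rh si tj !nth_map_val; split=> /eqP.
Qed.

Lemma bdef_mul mj k r s t : bvar k r -> bvar k s -> bvar k t ->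
  bdef mj k (fun M e => r e * s e = t e).
Proof.
move=> [h rh hk] [i si ik] [j tj jk].
exists (Fmul _ (Ordinal hk) (Ordinal ik) (Ordinal jk)), 0; split; first by rewrite orbT.
by move=> M v _ /=; rewrite rh si tj !nth_map_val; split=> /eqP.
Qed.

Lemma bdef_edge mj k s t : bvar k s -> bvar k t -> bdef mj k (fun M e => edge M (s e) (t e)).
Proof.
move=> [i si ik] [j tj jk].
exists (Fedge _ (Ordinal ik) (Ordinal jk)), 0; split; first by rewrite orbT.
move=> M v _ /=; rewrite si tj !nth_map_val; split=> [h|[a [b [/val_inj-> /val_inj-> //]]]].
by exists (tnth v (Ordinal ik)), (tnth v (Ordinal jk)).
Qed.

Lemma bdef_aux mj k (idx : seq nat) : size idx = A -> all (gtn k) idx ->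
  bdef mj k (fun M e => auxrel M [seq nth 0 e i | i <- idx]).
Proof.
move=> sz al.
(* [inord] needs an inhabited ordinal type. Without free variables, [idx] is empty and the arity is
   0. *)
case: k al => [|k] al.
  case: idx sz al => [|//] A0 _.
  have t0 : A.-tuple 'I_0 by rewrite -A0; exact: [tuple].
  exists (@Faux (one_schema A) 0 tt t0), 0; split; first by rewrite orbT.
  move=> M v _ /=.
  have e0 : size (map (tnth v) t0) = 0 by rewrite size_map size_tuple.
  split=> [h|[u ua uv]]; first by exists [tuple of map (tnth v) t0] => //=; rewrite (size0nil e0).
  have -> : [tuple of map (tnth v) t0] = u; last by [].
  by apply: val_inj => /=; rewrite (size0nil e0); case: (tval u) uv.
have szt : size (map (@inord k) idx) == A by rewrite size_map sz.
exists (@Faux (one_schema A) k.+1 tt (Tuple szt)), 0; split; first by rewrite orbT.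
move=> M v _ /=.
have e : [seq nth 0 (map val v) i | i <- idx] = map val (map (tnth v) (map (@inord k) idx)).
  rewrite -!map_comp; apply/eq_in_map => i /(allP al) /= ik.
  by rewrite (nth_map_val v ik); congr (val (tnth _ _)); apply: val_inj; rewrite /= inordK.
rewrite e; split=> [h|[u ua /(inj_map val_inj) uv]]; first by eexists; [exact: h|].
by have -> : [tuple of map (tnth v) (Tuple szt)] = u by apply: val_inj.
Qed.

Lemma bdef_subst mj k k' F (idx : seq nat) : size idx = k -> all (gtn k') idx ->
  bdef mj k F -> bdef mj k' (fun M e => F M [seq nth 0 e i | i <- idx]).
Proof.
move=> sz al [p [a [fp hp]]].
have ltk (i : 'I_k) : nth 0 idx i < k' by apply: (allP al); rewrite mem_nth // sz.
exists (frename p (fun i => Ordinal (ltk i))), a; split; first by rewrite frename_FO.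
move=> M v hM; rewrite sat_frename hp //.
suff -> : map val [tuple tnth v (Ordinal (ltk i)) | i < k] = [seq nth 0 (map val v) i | i <- idx] by [].
apply: (@eq_from_nth _ 0); first by rewrite !size_map -enumT size_enum_ord sz.
move=> i; rewrite !size_map -enumT size_enum_ord => ik.
rewrite (nth_map_val _ ik) tnth_mktuple (nth_map 0) ?sz //.
by rewrite (nth_map_val v (ltk (Ordinal ik))).
Qed.

Definition digits_ok (n j : nat) (d : seq nat) : Prop := size d = j /\ all (gtn n) d.

Lemma bdef_exs mj j k F : bdef mj (j + k) F ->
  bdef mj k (fun M e => exists2 d, digits_ok (dom M) j d & F M (d ++ e)).
Proof.
elim: j F => [|j IH] F hF.
  apply: (bdef_ext (N1 := 0)) hF => M e _ _ _; split=> [h|[d [/size0nil-> _]]//].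
  by exists [::].
have : bdef mj (j + k) (fun M e => exists2 x, x < dom M & F M (x :: e)).
  apply: bdef_ex; apply: (bdef_ext (N1 := 0)) hF => M e _ se _.
  by case: e se.
move/IH; apply: (bdef_ext (N1 := 0)) => M e _ _ _; split.
  move=> [d [sd ad] [x xM h]]; exists (x :: d) => //; split; rewrite /= ?sd //.
  by rewrite xM.
move=> [[|x d] [//= [sd] /andP[xM ad]] h]; exists d => //; exists x => //.
Qed.

Lemma bdef_alls mj j k F : bdef mj (j + k) F ->
  bdef mj k (fun M e => forall d, digits_ok (dom M) j d -> F M (d ++ e)).
Proof.
elim: j F => [|j IH] F hF.
  apply: (bdef_ext (N1 := 0)) hF => M e _ _ _; split=> [h d [/size0nil-> _]//|].
  by move/(_ [::]); apply.
have : bdef mj (j + k) (fun M e => forall x, x < dom M -> F M (x :: e)).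
  apply: bdef_all; apply: (bdef_ext (N1 := 0)) hF => M e _ se _.
  by case: e se.
move/IH; apply: (bdef_ext (N1 := 0)) => M e _ _ _; split.
  move=> h [|x d] [//= [sd] /andP[xM ad]]; exact: h.
move=> h d [sd ad] x xM; apply: (h (x :: d)); split; rewrite /= ?sd //.
by rewrite xM.
Qed.

End Definability.

Ltac solve_bvar := lazymatch goal with |- bvar _ _ =>
  eexists; [let e := fresh in intro e; rewrite ?nth_behead; reflexivity | by [] || lia] end.

(** * Definable predicates on numbers below [n ^ C] *)

Fixpoint digits_val (n : nat) (d : seq nat) : nat :=
  if d is x :: d' then x + n * digits_val n d' else 0.

Fixpoint digits (n C x : nat) : seq nat :=
  if C is C'.+1 then x %% n :: digits n C' (x %/ n) else [::].

Lemma digits_val_lt n d : all (gtn n) d -> digits_val n d < n ^ size d.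
Proof.
elim: d => //= x d IH /andP[xn /IH h]; rewrite expnS.
have : n * (digits_val n d).+1 <= n * n ^ size d by rewrite leq_mul2l h orbT.
by lia.
Qed.

Lemma size_digits n C x : size (digits n C x) = C.
Proof. by elim: C x => //= C IH x; rewrite IH. Qed.

Lemma digits_lt n C x : 0 < n -> all (gtn n) (digits n C x).
Proof. by move=> n0; elim: C x => //= C IH x; rewrite ltn_pmod ?IH. Qed.

Lemma digitsK n C x : x < n ^ C -> digits_val n (digits n C x) = x.
Proof.
elim: C x => [|C IH] x /=; first by rewrite expn0; case: x.
case: (posnP n) => [->|n0]; first by rewrite exp0n.
rewrite expnS => h; rewrite IH; last by rewrite ltn_divLR // mulnC.
by rewrite addnC mulnC -divn_eq.
Qed.

Lemma digits_valK n d : all (gtn n) d -> digits n (size d) (digits_val n d) = d.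
Proof.
elim: d => //= x d IH /andP[xn /IH h].
have n0 : 0 < n by lia.
by rewrite addnC mulnC modnMDl divnMDl // modn_small // divn_small // addn0 h.
Qed.

(** A variable for a number below n^C is a block of C consecutive variables for domain elements,
    least significant digit first. *)
Fixpoint decode (n C k : nat) (e : seq nat) : seq nat :=
  if k is k'.+1 then digits_val n (take C e) :: decode n C k' (drop C e) else [::].

Lemma size_decode n C k e : size (decode n C k e) = k.
Proof. by elim: k e => //= k IH e; rewrite IH. Qed.

Lemma decode_cat n C k d e : size d = C -> decode n C k.+1 (d ++ e) = digits_val n d :: decode n C k e.
Proof. by move=> <- /=; rewrite take_size_cat // drop_size_cat. Qed.

Lemma decode_lt n C k e : size e = k * C -> all (gtn n) e -> all (gtn (n ^ C)) (decode n C k e).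
Proof.
elim: k e => //= k IH e se ae; apply/andP; split.
  have st : size (take C e) = C by rewrite size_takel // se; nia.
  rewrite -{2}st; apply: digits_val_lt; apply/allP => x /mem_take; exact: (allP ae).
by apply: IH; [rewrite size_drop se; nia | apply/allP => x /mem_drop; exact: (allP ae)].
Qed.

Lemma map_nth_iota_take (e : seq nat) i C : i + C <= size e ->
  [seq nth 0 e j | j <- iota i C] = take C (drop i e).
Proof. by move=> h; rewrite map_nth_iota //; lia. Qed.

Lemma nth_decode n C k e i : i < k -> size e = k * C ->
  nth 0 (decode n C k e) i = digits_val n [seq nth 0 e j | j <- iota (i * C) C].
Proof.
move=> ik se; rewrite map_nth_iota_take; last by rewrite se -mulSnr leq_mul2r ik orbT.
elim: k e i ik se => // k IH e [|i] ik se /=; first by rewrite mul0n drop0.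
by rewrite IH //; [rewrite drop_drop mulSn addnC | rewrite size_drop se; nia].
Qed.

Lemma drop_beheadE (j : nat) (e : seq nat) : drop j (behead e) = drop j.+1 e.
Proof. by case: e. Qed.

Section BaseArithmetic.
Variable A : nat.
Implicit Types (M : structure A) (e : seq nat).

Lemma bvarS k t : bvar k t -> bvar k.+1 (fun e => t (behead e)).
Proof. by move=> [i ti ik]; exists i.+1 => // e; rewrite ti nth_behead. Qed.


Ltac bd := lazymatch goal with
 | |- bdef _ _ (fun M e => _ <-> _) => apply: bdef_iff; bd
 | |- bdef _ _ (fun M e => _ /\ _) => apply: bdef_and; bd
 | |- bdef _ _ (fun M e => _ \/ _) => apply: bdef_or; bd
 | |- bdef _ _ (fun M e => ~ _) => apply: bdef_not; bd
 | |- bdef _ _ (fun M e => exists2 x, _ & _) => apply: bdef_ex; bd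
 | |- bdef _ _ (fun M e => forall x, is_true (_ < _) -> _) => apply: bdef_all; bd
 | |- bdef _ _ (fun M e => _ -> _) => apply: bdef_imp; bd
 | |- bdef _ _ (fun M e => is_true (leq (S _) _)) => apply: bdef_lt; bd
 | |- bdef _ _ (fun M e => is_true (leq _ _)) => apply: bdef_le; bd
 | |- bdef _ _ (fun M e => addn _ _ = _) => apply: bdef_add; bd
 | |- bdef _ _ (fun M e => muln _ _ = _) => apply: bdef_mul; bd
 | |- bdef _ _ (fun M e => _ = _) => apply: bdef_eq; bd
 | |- bvar _ _ => first [assumption | solve_bvar | (match goal with H : bvar _ _ |- _ =>
      first [exact: (bvarS H) | exact: (bvarS (bvarS H)) | exact: (bvarS (bvarS (bvarS H)))
            | exact: (bvarS (bvarS (bvarS (bvarS H))))] end) | idtac]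
 | _ => idtac end.

(** The element c+1 is defined as the successor of c, starting from the minimum. The formula is
    correct only on domains that contain the constant, one origin of the thresholds in [bdef]. *)
Lemma bdef_const (mj : bool) k t c : bvar k t -> @bdef A mj k (fun M e => t e = c).
Proof.
elim: c k t => [|c IH] k t ht.
  have h : @bdef A mj k (fun M e => forall y, y < dom M -> t e <= y) by bd.
  apply: (bdef_ext (N1 := 1)) h => M e M1 se ae; split=> [/(_ 0 M1)|-> y _]; lia.
have h : @bdef A mj k (fun M e => exists2 y, y < dom M &
     (y = c /\ y < t e) /\ forall z, z < dom M -> z < t e -> z <= y).
  apply: bdef_ex; apply: bdef_and; [apply: bdef_and; [apply: IH|]|]; bd.
apply: (bdef_ext (N1 := c.+2)) h => M e M1 se ae; split.
  move=> [y yM [[-> h1] /(_ c.+1 M1)]]; lia.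
move=> ->; exists c; [lia|split; [by []|lia]].
Qed.

Lemma bdef_mod mj k x m r : bvar k x -> bvar k m -> bvar k r ->
  @bdef A mj k (fun M e => 0 < m e /\ x e %% m e = r e).
Proof.
move=> hx hm hr.
have h : @bdef A mj k (fun M e => exists2 q, q < dom M & exists2 p, p < dom M &
    (q * m e = p /\ p + r e = x e) /\ r e < m e) by bd.
apply: (bdef_ext (N1 := 0)) h => M e _ se ae; split.
  move=> [q _ [p _ [[<- <-] h]]]; split; first by lia.
  by rewrite modnMDl modn_small.
have xM : x e < dom M.
  case: hx => i -> ik; apply: (allP ae); rewrite mem_nth // se //.
move=> [m0 h]; have xe := divn_eq (x e) (m e); exists (x e %/ m e).
  by apply: leq_ltn_trans xM; exact: leq_div.
exists (x e %/ m e * m e); first by apply: leq_ltn_trans xM; rewrite leq_trunc_div.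
by rewrite -h -xe ltn_pmod.
Qed.

(** The bound keeps products of two residues inside the domain, where the partial built-in
    multiplication is defined. *)
Definition small_modulus M m := 0 < m /\ m * m < dom M.

Lemma bdef_small_modulus mj k m : bvar k m -> @bdef A mj k (fun M e => small_modulus M (m e)).
Proof.
move=> hm; apply: bdef_and.
  have h : @bdef A mj k (fun M e => ~ m e = 0) by apply: bdef_not; apply: bdef_const.
  by apply: (bdef_ext (N1 := 0)) h => M e _ _ _; split; lia.
have h : @bdef A mj k (fun M e => exists2 p, p < dom M & m e * m e = p) by bd.
by apply: (bdef_ext (N1 := 0)) h => M e _ _ _; split=> [[p pM ->]//|h]; exists (m e * m e).
Qed.

(** The size n is not an element of the domain; its residue is computed from the maximal element n-1
    by adding 1. *)
Lemma bdef_dom_mod mj k m v : bvar k m -> bvar k v ->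
  @bdef A mj k (fun M e => small_modulus M (m e) /\ dom M %% m e = v e).
Proof.
move=> hm hv.
have h : @bdef A mj k (fun M e => small_modulus M (m e) /\ exists2 w, w < dom M &
   (forall y, y < dom M -> y <= w) /\ exists2 w1, w1 < dom M & (0 < m e /\ w %% m e = w1) /\
   exists2 o, o < dom M & o = 1 /\ exists2 w2, w2 < dom M & w1 + o = w2 /\ (0 < m e /\ w2 %% m e = v e)).
  apply: bdef_and; first exact: bdef_small_modulus.
  apply: bdef_ex; apply: bdef_and; first by bd.
  apply: bdef_ex; apply: bdef_and; first by apply: bdef_mod; bd.
  apply: bdef_ex; apply: bdef_and; first by apply: bdef_const; bd.
  apply: bdef_ex; apply: bdef_and; first by bd.
  by apply: bdef_mod; bd; exact: bvarS (bvarS (bvarS (bvarS _))).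
apply: (bdef_ext (N1 := 2)) h => M e M2 _ _; split=> [|[[m0 mm] h]].
  move=> [sm [w wM [/(_ (dom M).-1) wmax [w1 _ [[_ <-] [o _ [-> [w2 _ [<- [_ <-]]]]]]]]]].
  split=> //; rewrite modnDml addn1; congr (_ %% _); lia.
have m2 : m e < dom M by case: (m e) m0 mm => // -[|]; nia.
split=> //; exists (dom M).-1; first lia.
split; first by move=> y; lia.
exists ((dom M).-1 %% m e); first by apply: leq_ltn_trans (leq_mod _ _) _; lia.
split=> //; exists 1 => //; split=> //.
exists ((dom M).-1 %% m e + 1).
  by have := ltn_pmod (dom M).-1 m0; lia.
split=> //; split=> //; rewrite modnDml -h; congr (_ %% _); lia.
Qed.

Lemma modn_affine m x n d : x %% m + n %% m * (d %% m) = x + n * d %[mod m].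
Proof. by rewrite modnDml -modnDmr modnMml modnMmr modnDmr. Qed.

(** Horner's rule modulo m. The number of digits is fixed, so one block of quantifiers per digit
    still gives a formula. *)
Lemma bdef_res_digits L : @bdef A false L.+2 (fun M e =>
  small_modulus M (nth 0 e 0) /\ digits_val (dom M) (behead (behead e)) %% nth 0 e 0 = nth 0 e 1).
Proof.
elim: L => [|L IH].
  have h : @bdef A false 2 (fun M e => small_modulus M (nth 0 e 0) /\ nth 0 e 1 = 0).
    apply: bdef_and; first by apply: bdef_small_modulus; bd.
    by apply: bdef_const; bd.
  apply: (bdef_ext (N1 := 0)) h => M [|m [|r [|//]]] //= _ _ _.
  by rewrite mod0n; split=> -[? ->].
have h : @bdef A false L.+3 (fun M e => exists2 r', r' < dom M & exists2 v, v < dom M &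
   exists2 p, p < dom M & exists2 x1, x1 < dom M & exists2 s, s < dom M &
   (small_modulus M (nth 0 e 0) /\ digits_val (dom M) (drop 3 e) %% nth 0 e 0 = r') /\
   (small_modulus M (nth 0 e 0) /\ dom M %% nth 0 e 0 = v) /\
   v * r' = p /\ (0 < nth 0 e 0 /\ nth 0 e 2 %% nth 0 e 0 = x1) /\ x1 + p = s /\
   (0 < nth 0 e 0 /\ s %% nth 0 e 0 = nth 0 e 1)).
  do 5!apply: bdef_ex; apply: bdef_and.
    have := @bdef_subst A false L.+2 L.+3.+4.+1 _ [:: 5, 4 & iota 8 L] _ _ IH.
    rewrite /= size_iota => /(_ erefl) h.
    apply: (bdef_ext (N1 := 0)) (h _); last by apply/allP => i; rewrite mem_iota /=; lia.
    move=> M e _ se _ /=; rewrite !nth_behead map_nth_iota_take; last by rewrite se; lia.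
    rewrite !drop_beheadE take_oversize // size_drop se; lia.
  apply: bdef_and; first by apply: bdef_dom_mod; bd.
  apply: bdef_and; first by bd.
  apply: bdef_and; first by apply: bdef_mod; bd.
  apply: bdef_and; first by bd.
  by apply: bdef_mod; bd.
apply: (bdef_ext (N1 := 0)) h => M [|m [|r [|x e]]] //= _ _ _; rewrite drop0; split.
  move=> [r' _ [v _ [p _ [x1 _ [s _]]]]].
  move=> [[sm <-] [[_ <-] [<- [[_ <-] [<- [_ <-]]]]]]; split=> //.
  by rewrite modn_affine.
move=> [[m0 mm] <-].
have lt (y : nat) : y %% m < m by rewrite ltn_pmod.
have ltM (y : nat) : y < m -> y < dom M by nia.
have a1 := lt (digits_val (dom M) e); have a2 := lt (dom M); have a3 := lt x.
exists (digits_val (dom M) e %% m); first exact: ltM.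
exists (dom M %% m); first exact: ltM.
exists (dom M %% m * (digits_val (dom M) e %% m)); first by nia.
exists (x %% m); first exact: ltM.
exists (x %% m + dom M %% m * (digits_val (dom M) e %% m)); first by nia.
split=> //; split=> //; split=> //; split=> //; split=> //; split=> //.
exact: modn_affine.
Qed.
End BaseArithmetic.

Ltac bd := lazymatch goal with
 | |- bdef _ _ (fun M e => _ <-> _) => apply: bdef_iff; bd
 | |- bdef _ _ (fun M e => _ /\ _) => apply: bdef_and; bd
 | |- bdef _ _ (fun M e => exists2 x, _ & _) => apply: bdef_ex; bd
 | |- bdef _ _ (fun M e => addn _ _ = _) => apply: bdef_add; bd
 | |- bdef _ _ (fun M e => muln _ _ = _) => apply: bdef_mul; bd
 | |- bvar _ _ => first [assumption | solve_bvar | (match goal with H : bvar _ _ |- _ =>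
      first [exact: (bvarS H) | exact: (bvarS (bvarS H)) | exact: (bvarS (bvarS (bvarS H)))
            | exact: (bvarS (bvarS (bvarS (bvarS H))))] end) | idtac]
 | _ => idtac end.

Section Numbers.
Variables C A : nat.
Implicit Types (M : structure A) (e : seq nat).

Definition num M := dom M ^ C.

Definition dfn mj k (F : structure A -> seq nat -> Prop) : Prop :=
  bdef mj (k * C) (fun M e => F M (decode (dom M) C k e)).

Lemma dfn_ext mj k F G :
  (forall M e, size e = k -> all (gtn (num M)) e -> (F M e <-> G M e)) ->
  dfn mj k F -> dfn mj k G.
Proof.
move=> h; apply: (bdef_ext (N1 := 0)) => M e _ se ae; apply: h; first exact: size_decode.
exact: decode_lt.
Qed.

Lemma dfn_and mj k F G : dfn mj k F -> dfn mj k G -> dfn mj k (fun M e => F M e /\ G M e).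
Proof. exact: bdef_and. Qed.

Lemma dfn_or mj k F G : dfn mj k F -> dfn mj k G -> dfn mj k (fun M e => F M e \/ G M e).
Proof. exact: bdef_or. Qed.

Lemma dfn_imp mj k F G : dfn mj k F -> dfn mj k G -> dfn mj k (fun M e => F M e -> G M e).
Proof. exact: bdef_imp. Qed.

Lemma dfn_iff mj k F G : dfn mj k F -> dfn mj k G -> dfn mj k (fun M e => F M e <-> G M e).
Proof. exact: bdef_iff. Qed.

Lemma dfn_not mj k F : dfn mj k F -> dfn mj k (fun M e => ~ F M e).
Proof. exact: bdef_not. Qed.

Lemma dfn_ex mj k (F : structure A -> seq nat -> nat -> Prop) :
  dfn mj k.+1 (fun M e => F M (behead e) (nth 0 e 0)) ->
  dfn mj k (fun M e => exists2 z, z < num M & F M e z).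
Proof.
rewrite /dfn mulSn => /bdef_exs; apply: (bdef_ext (N1 := 1)) => M e M1 se ae; split.
  move=> [d [sd ad]]; rewrite decode_cat //= => h; exists (digits_val (dom M) d) => //.
  by rewrite /num -sd digits_val_lt.
move=> [z zM h]; exists (digits (dom M) C z); first by split; [exact: size_digits | exact: digits_lt].
by rewrite decode_cat ?size_digits //= digitsK.
Qed.

Lemma dfn_all mj k (F : structure A -> seq nat -> nat -> Prop) :
  dfn mj k.+1 (fun M e => F M (behead e) (nth 0 e 0)) ->
  dfn mj k (fun M e => forall z, z < num M -> F M e z).
Proof.
rewrite /dfn mulSn => /bdef_alls; apply: (bdef_ext (N1 := 1)) => M e M1 se ae; split.
  move=> h z zM; have := h (digits (dom M) C z); rewrite decode_cat ?size_digits //= digitsK //.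
  by apply; split; [exact: size_digits | exact: digits_lt].
move=> h d [sd ad]; rewrite decode_cat //=; apply: h.
by rewrite /num -sd digits_val_lt.
Qed.

Definition residue (t : structure A -> seq nat -> nat) k M (m r : nat) (ds : seq nat) : Prop :=
  small_modulus M m /\ t M (decode (dom M) C k ds) %% m = r.

(* The residues modulo all m with m^2 < dom M determine a polynomially bounded value. *)
Definition term k (t : structure A -> seq nat -> nat) : Prop :=
  (exists D, forall M e, 1 < dom M -> size e = k -> all (gtn (num M)) e -> t M e < dom M ^ D) /\
  forall K j tm tr pr, K = j + k * C -> bvar K tm -> bvar K tr ->
    (forall e, pr e = drop j e) ->
    @bdef A false K (fun M e => residue t k M (tm e) (tr e) (pr e)).

(** The exponent (a+b)+1 serves both operations: a sum of numbers below n^a and n^b may need the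
    additional factor 2 <= n. *)
Lemma term_bin k (s t : structure A -> seq nat -> nat) (op : nat -> nat -> nat) :
  (forall K r1 r2 s, bvar K r1 -> bvar K r2 -> bvar K s -> @bdef A false K (fun M e => op (r1 e) (r2 e) = s e)) ->
  (forall m r1 r2, r1 < m -> r2 < m -> op r1 r2 < m * m) ->
  (forall m x y, op (x %% m) (y %% m) = op x y %[mod m]) ->
  (forall n a b x y, 1 < n -> x < n ^ a -> y < n ^ b -> op x y < n ^ (a + b).+1) ->
  term k s -> term k t -> term k (fun M e => op (s M e) (t M e)).
Proof.
move=> op1 op2 op3 op4 [[D sD] hs] [[D' tD] ht]; split.
  exists (D + D').+1 => M e M1 se ae; apply: op4 => //; [exact: sD | exact: tD].
move=> K j tm tr pr KE hm hr prE.
have h : @bdef A false K (fun M e => exists2 r1, r1 < dom M & exists2 r2, r2 < dom M &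
    exists2 u, u < dom M & residue s k M (tm e) r1 (pr e) /\ residue t k M (tm e) r2 (pr e) /\
    op r1 r2 = u /\ (0 < tm e /\ u %% tm e = tr e)).
  do 3!apply: bdef_ex; apply: bdef_and.
    apply: (hs _ j.+3); [lia|bd|bd|by move=> e; rewrite prE !drop_beheadE].
  apply: bdef_and.
    apply: (ht _ j.+3); [lia|bd|bd|by move=> e; rewrite prE !drop_beheadE].
  apply: bdef_and; first by apply: op1; bd.
  by apply: bdef_mod; bd.
apply: (bdef_ext (N1 := 0)) h => M e _ _ _; rewrite /residue; split.
  move=> [r1 _ [r2 _ [u _ [[sm <-] [[_ <-] [<- [_ <-]]]]]]]; split=> //.
move=> [[m0 mm] <-]; set x := s M _; set y := t M _.
have ltM (z : nat) : z %% tm e < dom M by have := ltn_pmod z m0; nia.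
exists (x %% tm e) => //; exists (y %% tm e) => //.
exists (op (x %% tm e) (y %% tm e)).
  by apply: ltn_trans mm; apply: op2; rewrite ltn_pmod.
split=> //; split=> //; split=> //; split=> //; exact: op3.
Qed.

Lemma term_add k s t : term k s -> term k t -> term k (fun M e => s M e + t M e).
Proof.
apply: term_bin => [K r1 r2 u h1 h2 h3|m r1 r2|m x y|n a b x y n1 xa yb]; first by bd.
- by nia.
- by rewrite modnDml modnDmr.
have : n ^ a <= n ^ (a + b) by rewrite leq_exp2l // leq_addr.
have : n ^ b <= n ^ (a + b) by rewrite leq_exp2l // leq_addl.
by rewrite expnS; nia.
Qed.

Lemma term_mul k s t : term k s -> term k t -> term k (fun M e => s M e * t M e).
Proof.
apply: term_bin => [K r1 r2 u h1 h2 h3|m r1 r2|m x y|n a b x y n1 xa yb]; first by bd.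
- by nia.
- by rewrite modnMml modnMmr.
rewrite expnS expnD; move: xa yb n1; move: (n ^ a) (n ^ b) => u v xu yv n1.
have : x * y < u * v by case: y yv => [|y] yv; rewrite ?muln0; nia.
by nia.
Qed.

Lemma term_const k c : term k (fun M e => c).
Proof.
split; first by exists c => M e M1 _ _; exact: ltn_expl.
move=> K j tm tr pr KE hm hr prE.
have h : @bdef A false K (fun M e => small_modulus M (tm e) /\ exists2 x, x < dom M & x = c /\
   (0 < tm e /\ x %% tm e = tr e)).
  apply: bdef_and; first exact: bdef_small_modulus.
  apply: bdef_ex; apply: bdef_and; first by apply: bdef_const; bd.
  by apply: bdef_mod; bd.
apply: (bdef_ext (N1 := c.+1)) h => M e M1 _ _; rewrite /residue; split.
  by move=> [sm [x _ [-> [_ ->]]]].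
move=> [[m0 mm] h]; split=> //; exists c => //; lia.
Qed.

Lemma term_dom k : term k (fun M e => dom M).
Proof.
split; first by exists 2 => M e M1 _ _; rewrite -[X in X < _]expn1 ltn_exp2l.
by move=> K j tm tr pr KE hm hr prE; apply: bdef_dom_mod.
Qed.

Lemma term_var k t i : (forall e, t e = nth 0 e i) -> i < k -> term k (fun M e => t e).
Proof.
move=> ti ik; split.
  exists C => M e M1 se ae; rewrite ti; apply: (allP ae); rewrite mem_nth // se //.
move=> K j tm tr pr KE [im mE mK] [ir rE rK] prE.
have al : all (gtn K) [:: im, ir & iota (j + i * C) C].
  rewrite /= mK rK; apply/allP => x; rewrite mem_iota /= => /andP[_ h].
  by apply: leq_trans h _; rewrite KE -addnA leq_add2l -mulSnr leq_mul2r ik orbT.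
have := @bdef_subst A false C.+2 K _ [:: im, ir & iota (j + i * C) C] _ al (@bdef_res_digits A C).
rewrite /= size_iota => /(_ erefl); apply: (bdef_ext (N1 := 0)) => M e _ se _.
rewrite /= -mE -rE /residue ti prE nth_decode ?size_drop ?se //; last by rewrite KE; lia.
suff -> : [seq nth 0 e i0 | i0 <- iota (j + i * C) C] = [seq nth 0 (drop j e) j0 | j0 <- iota (i * C) C] by [].
by rewrite iotaDl -map_comp; apply: eq_map => x /=; rewrite nth_drop.
Qed.

Lemma term_up k t : term k t -> term k.+1 (fun M e => t M (behead e)).
Proof.
move=> [[D tD] ht]; split.
  exists D => M [|x e] //= M1 [se] /andP[_ ae]; exact: tD.
move=> K j tm tr pr KE hm hr prE.
have h := ht K (j + C) tm tr (fun e => drop (j + C) e).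
apply: (bdef_ext (N1 := 0)) (h _ _ _ _) => //; last by rewrite KE; lia.
by move=> M e _ _ _; rewrite /residue /= prE drop_drop addnC.
Qed.

Lemma term_ext k s t : (forall M e, s M e = t M e) -> term k s -> term k t.
Proof.
move=> st [[D hD] hs]; split; first by exists D => M e M1 se ae; rewrite -st; exact: hD.
move=> K j tm tr pr KE hm hr prE; apply: (bdef_ext (N1 := 0)) (hs K j tm tr pr KE hm hr prE).
by move=> M e _ _ _; rewrite /residue st.
Qed.

Lemma term_exp k t c : term k t -> term k (fun M e => t M e ^ c).
Proof.
move=> ht; elim: c => [|c IH]; first exact: term_const.
by apply: term_ext (term_mul ht IH) => M e; rewrite expnS.
Qed.

Lemma term_num k : term k (fun M e => num M).
Proof. exact: term_exp (term_dom k). Qed.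

(** Both values are polynomially bounded, so equality on large domains follows from congruence
    modulo all m with m^2 < n. Carries of the digit representation are never computed. *)
Lemma dfn_eq mj k s t : term k s -> term k t -> dfn mj k (fun M e => s M e = t M e).
Proof.
move=> [[D sD] hs] [[D' tD] ht]; apply: bdef_weaken.
have h : @bdef A false (k * C) (fun M e => forall m, m < dom M -> forall r, r < dom M ->
    residue s k M m r e -> residue t k M m r e).
  do 2!apply: bdef_all; apply: bdef_imp.
    by apply: (hs _ 2); [lia|solve_bvar|solve_bvar|move=> e; rewrite -!drop1 drop_drop].
  by apply: (ht _ 2); [lia|solve_bvar|solve_bvar|move=> e; rewrite -!drop1 drop_drop].
have [N0 N0P] := eq_of_small_congruences (D + D').
apply: (bdef_ext (N1 := N0 + 2)) h => M e M1 se ae; split.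
  move=> h; apply: (N0P (dom M)); first by lia.
  - apply: leq_trans (sD M _ _ _ _) _; [lia|exact: size_decode|exact: decode_lt|].
    by rewrite leq_exp2l ?leq_addr //; lia.
  - apply: leq_trans (tD M _ _ _ _) _; [lia|exact: size_decode|exact: decode_lt|].
    by rewrite leq_exp2l ?leq_addl //; lia.
  move=> m m0 mm; have mM : m < dom M by nia.
  have rM : s M (decode (dom M) C k e) %% m < dom M by apply: ltn_trans mM; rewrite ltn_pmod.
  by have [] := h m mM _ rM (conj (conj m0 mm) erefl).
by move=> st m _ r _ [sm <-]; split=> //; rewrite st.
Qed.

(** Quantified numbers stay below N = [num M], but quotients and differences of terms can be larger.
    Writing z in base N peels off one quantifiable digit at a time: a + cz = (a + c z0) + (cN) z'.
    Order, division and congruence of terms all reduce to this equation. *)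
Lemma dfn_linear mj D k a c b : term k a -> term k c -> term k b ->
  dfn mj k (fun M e => exists2 z, z < num M ^ D & a M e + c M e * z = b M e).
Proof.
elim: D k a c b => [|D IH] k a c b ha hc hb.
  apply: dfn_ext (dfn_eq mj ha hb) => M e _ _; split=> [->|[z]].
    by exists 0; rewrite ?expn0 // muln0 addn0.
  by rewrite expn0; case: z => //; rewrite muln0 addn0.
have h : dfn mj k (fun M e => exists2 z0, z0 < num M & exists2 z, z < num M ^ D &
    (a M e + c M e * z0) + (c M e * num M) * z = b M e).
  apply: dfn_ex; apply: IH.
  - apply: term_add; first exact: term_up.
    by apply: term_mul; [exact: term_up | apply: (@term_var _ _ 0)].
  - by apply: term_mul; [exact: term_up | exact: term_num].
  - exact: term_up.
apply: dfn_ext h => M e _ _; split.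
  move=> [z0 z0M [z zM h]]; exists (z0 + num M * z); last by rewrite -h; lia.
  rewrite expnS; have : num M * z.+1 <= num M * num M ^ D by rewrite leq_mul2l zM orbT.
  by lia.
case: (posnP (num M)) => [->|M0]; first by rewrite exp0n // => -[].
move=> [z]; rewrite expnS => zM h; exists (z %% num M); first by rewrite ltn_pmod.
exists (z %/ num M); first by rewrite ltn_divLR // mulnC.
by rewrite -h {3}(divn_eq z (num M)); lia.
Qed.

Lemma term_bound k t : term k t -> 0 < C ->
  exists D, forall M e, 1 < dom M -> size e = k -> all (gtn (num M)) e -> t M e < num M ^ D.
Proof.
move=> [[D hD] _] C0; exists D => M e M1 se ae; apply: leq_trans (hD M e M1 se ae) _.
by rewrite /num -expnM leq_exp2l // leq_pmull.
Qed.

Hypothesis C0 : 0 < C.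

Lemma dfn_ext2 mj k F G :
  (forall M e, 1 < dom M -> size e = k -> all (gtn (num M)) e -> (F M e <-> G M e)) ->
  dfn mj k F -> dfn mj k G.
Proof.
move=> h; apply: (bdef_ext (N1 := 2)) => M e M1 se ae; apply: h => //; first exact: size_decode.
exact: decode_lt.
Qed.

Lemma dfn_le mj k s t : term k s -> term k t -> dfn mj k (fun M e => s M e <= t M e).
Proof.
move=> hs ht; have [D hD] := term_bound ht C0.
apply: dfn_ext2 (@dfn_linear mj D k s _ t hs (term_const k 1) ht) => M e M1 se ae; split.
  by move=> [z _ <-]; lia.
move=> h; exists (t M e - s M e); last by lia.
by apply: leq_ltn_trans (hD M e M1 se ae); lia.
Qed.

Lemma dfn_lt mj k s t : term k s -> term k t -> dfn mj k (fun M e => s M e < t M e).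
Proof.
move=> hs ht; apply: dfn_ext (dfn_le mj (term_add hs (term_const k 1)) ht) => M e _ _.
by rewrite addn1.
Qed.

Lemma dfn_modn mj k x q r : term k x -> term k q -> term k r ->
  dfn mj k (fun M e => x M e %% q M e = r M e).
Proof.
move=> hx hq hr; have [D hD] := term_bound hx C0.
have h : dfn mj k (fun M e => (q M e = 0 /\ x M e = r M e) \/
  (r M e < q M e /\ exists2 z, z < num M ^ D & r M e + q M e * z = x M e)).
  apply: dfn_or; apply: dfn_and; [apply: dfn_eq => //; exact: term_const|exact: dfn_eq|exact: dfn_lt|].
  exact: dfn_linear.
apply: dfn_ext2 h => M e M1 se ae; split.
  move=> [[-> ->]|[rq [z _ <-]]]; first by rewrite modn0.
  by rewrite addnC mulnC modnMDl modn_small.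
case: (posnP (q M e)) => [->|q0 <-]; first by rewrite modn0; left.
right; split; first exact: ltn_pmod.
exists (x M e %/ q M e); first by apply: leq_ltn_trans (hD M e M1 se ae); exact: leq_div.
by rewrite addnC mulnC -divn_eq.
Qed.

Lemma dfn_divn mj k x q r : term k x -> term k q -> term k r ->
  dfn mj k (fun M e => x M e %/ q M e = r M e).
Proof.
move=> hx hq hr.
have h : dfn mj k (fun M e => (q M e = 0 /\ r M e = 0) \/
  (0 < q M e /\ (r M e * q M e <= x M e /\ x M e < (r M e + 1) * q M e))).
  have h0 := term_const k 0; have h1 := term_const k 1.
  apply: dfn_or; apply: dfn_and; [exact: dfn_eq|exact: dfn_eq|exact: dfn_lt|apply: dfn_and].
    by apply: dfn_le => //; apply: term_mul.
  by apply: dfn_lt => //; apply: term_mul => //; apply: term_add.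
apply: dfn_ext h => M e _ _; split.
  move=> [[-> ->]|[q0 [h1 h2]]]; first by rewrite divn0.
  by apply/eqP; rewrite eqn_leq -ltnS ltn_divLR // leq_divRL // h1 andbT -[(r M e).+1]addn1.
case: (posnP (q M e)) => [->|q0 <-]; first by rewrite divn0; left.
by right; split=> //; rewrite leq_trunc_div addn1 ltn_ceil.
Qed.

Lemma dfn_modeq mj k x y q : term k x -> term k y -> term k q ->
  dfn mj k (fun M e => x M e = y M e %[mod q M e]).
Proof.
move=> hx hy hq; have [D hD] := term_bound hx C0; have [D' hD'] := term_bound hy C0.
have h := dfn_or (@dfn_linear mj D' k x q y hx hq hy) (@dfn_linear mj D k y q x hy hq hx).
apply: dfn_ext2 h => M e M1 se ae; split.
  by move=> [[z _ <-]|[z _ <-]]; rewrite addnC mulnC modnMDl.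
have sol (u v : nat) : u <= v -> u = v %[mod q M e] -> exists2 z, z <= v & u + q M e * z = v.
  move=> uv /eqP; rewrite eq_sym eqn_mod_dvd // => /dvdnP[z zE].
  case: (posnP (q M e)) => [q0|q0].
    by exists 0 => //; rewrite muln0; move: zE; rewrite q0 muln0; lia.
  by exists z; nia.
move=> h; case: (leqP (x M e) (y M e)) => [xy|/ltnW yx].
  have [z zv zE] := sol _ _ xy h; left; exists z => //.
  exact: leq_ltn_trans zv (hD' M e M1 se ae).
have [z zv zE] := sol _ _ yx (esym h); right; exists z => //.
exact: leq_ltn_trans zv (hD M e M1 se ae).
Qed.

Lemma bdef_digits_zero mj K (idx : seq nat) : all (gtn K) idx ->
  @bdef A mj K (fun M e => digits_val (dom M) [seq nth 0 e i | i <- idx] = 0).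
Proof.
elim: idx => [_|i idx IH /= /andP[iK al]].
  have h : @bdef A mj K (fun M e => forall x, x < dom M -> x = x) by apply: bdef_all; apply: bdef_eq; solve_bvar.
  by apply: (bdef_ext (N1 := 0)) h => M e.
have h : @bdef A mj K (fun M e => nth 0 e i = 0 /\ digits_val (dom M) [seq nth 0 e i | i <- idx] = 0).
  by apply: bdef_and; [apply: bdef_const; exists i | exact: IH].
by apply: (bdef_ext (N1 := 1)) h => M e M1 _ _; split; nia.
Qed.

Lemma bdef_digits_eq mj K (idx : seq nat) t : all (gtn K) idx -> size idx = C -> bvar K t ->
  @bdef A mj K (fun M e => digits_val (dom M) [seq nth 0 e i | i <- idx] = t e).
Proof.
case: idx C0 => [|i idx] c0 /= al sz ht; first by lia.
case/andP: al => iK al.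
have h : @bdef A mj K (fun M e => nth 0 e i = t e /\ digits_val (dom M) [seq nth 0 e i | i <- idx] = 0).
  by apply: bdef_and; [apply: bdef_eq => //; exists i | exact: bdef_digits_zero].
apply: (bdef_ext (N1 := 1)) h => M e M1 se ae; split; first by move=> [-> ->]; rewrite muln0 addn0.
have tM : t e < dom M by case: ht => j -> jK; apply: (allP ae); rewrite mem_nth ?se.
move=> h; have w0 : digits_val (dom M) [seq nth 0 e i | i <- idx] = 0 by nia.
by rewrite w0 muln0 addn0 in h *.
Qed.

Lemma dfn_edge_var mj k s t : bvar k s -> bvar k t -> dfn mj k (fun M e => edge M (s e) (t e)).
Proof.
move=> [i si ik] [j tj jk].
have al K x : x < k -> 2 + k * C = K -> all (gtn K) (iota (2 + x * C) C).
  move=> xk <-; apply/allP => y; rewrite mem_iota /= => /andP[_ h]; apply: leq_trans h _.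
  by rewrite -addnA leq_add2l -mulSnr leq_mul2r xk orbT.
have h2 : @bdef A mj (k * C) (fun M e => exists2 u, u < dom M & exists2 v, v < dom M &
   (edge M u v /\ digits_val (dom M) [seq nth 0 [:: v, u & e] x | x <- iota (2 + i * C) C] = u) /\
   digits_val (dom M) [seq nth 0 [:: v, u & e] x | x <- iota (2 + j * C) C] = v).
  apply: bdef_ex; apply: bdef_ex.
  have hh : @bdef A mj (k * C).+2 (fun M e => (edge M (nth 0 e 1) (nth 0 e 0) /\ 
     digits_val (dom M) [seq nth 0 e x | x <- iota (2 + i * C) C] = nth 0 e 1) /\
     digits_val (dom M) [seq nth 0 e x | x <- iota (2 + j * C) C] = nth 0 e 0).
    apply: bdef_and; [apply: bdef_and|]; first by apply: bdef_edge; solve_bvar.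
      by apply: bdef_digits_eq; [exact: al|exact: size_iota|solve_bvar].
    by apply: bdef_digits_eq; [exact: al|exact: size_iota|solve_bvar].
  by apply: (bdef_ext (N1 := 0)) hh => M [|v [|u e]].
apply: (bdef_ext (N1 := 0)) h2 => M e _ se ae; rewrite si tj !nth_decode //.
have sh u v x : [seq nth 0 [:: v, u & e] y | y <- iota (2 + x) C] = [seq nth 0 e y | y <- iota x C].
  by rewrite iotaDl -map_comp; apply: eq_map.
split=> [[u _ [v _]]|h]; first by rewrite !sh => -[[h ->] ->].
have [a [b [ea eb _]]] := h.
exists (val a); first exact: ltn_ord.
by exists (val b); [exact: ltn_ord | rewrite !sh -ea -eb in h *].
Qed.

(** [digits] silently truncates to C digits; without the bound, numbers that agree modulo n^C would
    be confused. *)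
Definition auxn M (xs : seq nat) : Prop :=
  all (gtn (num M)) xs /\ auxrel M (flatten [seq digits (dom M) C x | x <- xs]).

Lemma dfn_auxn_var mj k (is_ : seq nat) : A = size is_ * C -> all (gtn k) is_ ->
  dfn mj k (fun M e => auxn M [seq nth 0 e i | i <- is_]).
Proof.
move=> AE al; set idx := flatten [seq iota (i * C) C | i <- is_].
have sz : size idx = A.
  rewrite AE /idx; elim: (is_) => //= i s IH; rewrite size_cat IH size_iota; lia.
have alx : all (gtn (k * C)) idx.
  apply/allP => x /flattenP[s /mapP[i /(allP al) /= ik ->]]; rewrite mem_iota => /andP[_ h].
  by apply: leq_trans h _; rewrite -mulSnr leq_mul2r ik orbT.
apply: (bdef_ext (N1 := 0)) (bdef_aux mj sz alx) => M e _ se ae; rewrite /auxn.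
have -> : [seq nth 0 e i | i <- idx] =
   flatten [seq digits (dom M) C x | x <- [seq nth 0 (decode (dom M) C k e) i | i <- is_]].
  rewrite /idx map_flatten -!map_comp; congr flatten; apply/eq_in_map => i /(allP al) /= ik.
  rewrite nth_decode //; set d := [seq nth 0 e j | j <- _].
  have sd : size d = C by rewrite size_map size_iota.
  rewrite -[X in digits _ X]sd digits_valK //; apply/allP => x /mapP[y]; rewrite mem_iota => /andP[_ h ->].
  apply: (allP ae); rewrite mem_nth // se; apply: leq_trans h _.
  by rewrite -mulSnr leq_mul2r ik orbT.
split=> [h|[]//]; split=> //; apply/allP => x /mapP[i /(allP al) /= ik ->].
by apply: (allP (decode_lt se ae)); rewrite mem_nth // size_decode.
Qed.

(** The majority quantifier binds a domain element, not a number. The block of digits with the same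
    value is supplied by existential quantifiers. *)
Lemma dfn_maj k (F : structure A -> seq nat -> nat -> Prop) :
  dfn true k.+1 (fun M e => F M (behead e) (nth 0 e 0)) ->
  dfn true k (fun M e => majority (dom M) (F M e)).
Proof.
move=> hF; apply: (@bdef_maj _ _ (fun M e => F M (decode (dom M) C k e))).
have al : all (gtn (C + (k * C).+1)) (iota 0 C ++ iota C.+1 (k * C)).
  by apply/allP => x; rewrite mem_cat !mem_iota /=; lia.
have h1 : @bdef A true (C + (k * C).+1) (fun M e =>
   digits_val (dom M) [seq nth 0 e i | i <- iota 0 C] = nth 0 e C /\
   (fun M e => F M (behead (decode (dom M) C k.+1 e)) (nth 0 (decode (dom M) C k.+1 e) 0)) M
      [seq nth 0 e i | i <- iota 0 C ++ iota C.+1 (k * C)]).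
  apply: bdef_and.
    apply: bdef_digits_eq; [|exact: size_iota|exists C => //; lia].
    by apply/allP => x; rewrite mem_iota /=; lia.
  by apply: bdef_subst hF => //; rewrite size_cat !size_iota mulSn.
apply: (bdef_ext (N1 := 0)) (bdef_exs h1) => M [|x e] //= _ [se] /andP[xM ae].
have e1 d : size d = C -> [seq nth 0 (d ++ x :: e) i | i <- iota 0 C] = d.
  by move=> sd; rewrite map_nth_iota0 ?size_cat ?sd /=; [rewrite take_size_cat | lia].
have e2 d : size d = C -> [seq nth 0 (d ++ x :: e) i | i <- iota C.+1 (k * C)] = e.
  move=> sd; rewrite map_nth_iota ?size_cat ?sd /=; last by lia.
  have -> : drop C.+1 (d ++ x :: e) = e.
    by rewrite -cat_rcons drop_size_cat // size_rcons sd.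
  by rewrite -se take_size.
have e3 d : size d = C -> nth 0 (d ++ x :: e) C = x by move=> sd; rewrite nth_cat sd ltnn subnn.
split.
  move=> [d [sd ad] []]; rewrite map_cat e1 // e2 // e3 // => dx.
  by rewrite take_size_cat // drop_size_cat // dx.
move=> h.
have M0 : 0 < dom M by lia.
have xC : x < dom M ^ C by apply: leq_trans xM _; rewrite -{1}[dom M]expn1 leq_pexp2l //; lia.
exists (digits (dom M) C x).
  by split; [exact: size_digits | apply: digits_lt; lia].
rewrite map_cat e1 ?e2 ?e3 ?size_digits // take_size_cat ?drop_size_cat ?size_digits //.
by rewrite digitsK.
Qed.

End Numbers.

(** * Walks and sums of polylogarithmic length *)

Definition consecutive_primes (q q' : nat) : Prop :=
  [/\ prime q, prime q', q < q' & forall r, q < r -> r < q' -> ~ prime r].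

(* A walk x = f 0, ..., f L = y along T is coded by one number W: its i-th state is the
   residue of W modulo the i-th prime of a window of consecutive primes. *)
Definition chain (N : nat) (T : nat -> nat -> Prop) (x y : nat) : Prop :=
  exists2 W, W < N & exists2 Q0, Q0 < N & exists2 Q1, Q1 < N &
    (prime Q0 /\ prime Q1) /\ Q0 <= Q1 /\ W %% Q0 = x /\ W %% Q1 = y /\
    forall q, q < N -> forall q', q' < N -> Q0 <= q -> q' <= Q1 -> consecutive_primes q q' ->
      exists2 a, a < N & exists2 b, b < N & W %% q = a /\ W %% q' = b /\ T a b.

(** One code below N holds only about log n / log log n states, but a step of an outer chain may
    itself be a chain: d levels of length r give walks of length r^d. The base case allows standing
    still, so shorter walks are covered as well. *)
Fixpoint nchain (N d : nat) (T : nat -> nat -> Prop) : nat -> nat -> Prop :=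
  if d is d'.+1 then chain N (nchain N d' T) else fun x y => x = y \/ T x y.

Lemma pred_prime Q0 q : prime Q0 -> prime q -> Q0 < q ->
  exists2 q', Q0 <= q' & consecutive_primes q' q.
Proof.
move=> p0 pq lt.
have ex : exists p, prime p && (p < q) by exists Q0; rewrite p0.
have ub p : prime p && (p < q) -> p <= q by case/andP => _ /ltnW.
case: (ex_maxnP ex ub) => p /andP[pp ppq] mx; exists p; first by apply: mx; rewrite p0.
split=> // r pr rq primer; have := mx r; rewrite primer rq => /(_ isT); lia.
Qed.

(** Soundness is needed only for properties preserved by T, and this form spares extracting the walk
    from its code. The induction runs through the primes of the window. *)
Lemma chain_inv N T x y (Inv : nat -> Prop) :
  (forall a b, T a b -> Inv a -> Inv b) -> chain N T x y -> Inv x -> Inv y.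
Proof.
move=> TI [W WN [Q0 Q0N [Q1 Q1N [[p0 p1] [Q01 [<- [<- h]]]]]]] I0.
suff H m q : q <= m -> prime q -> Q0 <= q -> q <= Q1 -> Inv (W %% q) by exact: (H Q1).
elim: m q => [|m IH] q qm pq Q0q qQ1; first by move: (prime_gt0 pq); lia.
move: Q0q; rewrite leq_eqVlt => /orP[/eqP <-//|lt].
have [q' Q0q' cp] := pred_prime p0 pq lt.
have [pq' _ q'q _] := cp.
have q'N : q' < N by lia.
have qN : q < N by lia.
have [a _ [b _ [ea [eb Tab]]]] := h q' q'N q qN Q0q' qQ1 cp.
by rewrite eb; apply: TI Tab _; rewrite -ea; apply: IH => //; lia.
Qed.

Lemma nchain_inv N d T x y (Inv : nat -> Prop) :
  (forall a b, T a b -> Inv a -> Inv b) -> nchain N d T x y -> Inv x -> Inv y.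
Proof.
move=> TI; elim: d x y => [|d IH] x y; first by case=> [->//|/TI].
by apply: chain_inv => a b; apply: IH.
Qed.

Lemma prod_le_exp (s : seq nat) b : {in s, forall x, x <= b} -> \prod_(x <- s) x <= b ^ size s.
Proof.
elim: s => [|x s IH] h; rewrite ?big_nil // big_cons /= expnS leq_mul //.
  by apply: h; rewrite mem_head.
by apply: IH => y ys; apply: h; rewrite inE ys orbT.
Qed.

Lemma chain_complete N B L T f : 32 <= B -> L < B -> (B ^ 2) ^ L.+2 <= N ->
  (forall i, i <= L -> f i < B) -> (forall i, i < L -> T (f i) (f i.+1)) ->
  chain N T (f 0) (f L).
Proof.
move=> B32 LB BN fB fT; set P := primes_in B (B ^ 2); set s := take L.+1 P.
have szP : L.+1 <= size P by apply: leq_trans LB _; exact: many_primes.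
have sz : size s = L.+1 by rewrite size_takel.
have sP x : x \in s -> x \in P by exact: mem_take.
have us : uniq s by rewrite take_uniq // primes_in_uniq.
have srt : sorted ltn s by rewrite take_sorted // primes_in_sorted.
have ap : all prime s by apply/allP => x /sP; rewrite mem_primes_in => /andP[].
have sB x : x \in s -> B < x by move/sP; rewrite mem_primes_in => /and3P[].
have sB2 x : x \in s -> x <= B ^ 2 by move/sP; rewrite mem_primes_in => /and3P[].
have B21 : 1 < B ^ 2 by rewrite -mulnn; nia.
have [W Wlt Wr] := crt_primes (fun q => f (index q s)) us ap.
have WN : W < N.
  apply: leq_trans Wlt _; apply: leq_trans BN.
  apply: leq_trans (_ : (B ^ 2) ^ L.+1 <= _); last by rewrite leq_exp2l.
  by rewrite -sz; apply: prod_le_exp => x /sB2.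
have BN2 : B ^ 2 < N by apply: leq_trans BN; rewrite -{1}[B ^ 2]expn1 ltn_exp2l.
have mN i : i <= L -> nth 0 s i \in s by move=> iL; rewrite mem_nth // sz.
have Wi i : i <= L -> W %% nth 0 s i = f i.
  move=> iL; rewrite (Wr _ (mN i iL)) index_uniq ?sz // modn_small //.
  exact: ltn_trans (fB i iL) (sB _ (mN i iL)).
have prs i : i <= L -> prime (nth 0 s i) by move=> iL; apply: (allP ap); exact: mN.
have mono i j : i <= L -> j <= L -> (nth 0 s i < nth 0 s j) = (i < j).
  have ho a b : a <= L -> b <= L -> a < b -> nth 0 s a < nth 0 s b.
    by move=> aL bL ab; apply: (sorted_ltn_nth ltn_trans 0 srt) => //; rewrite inE sz.
  move=> iL jL; case: (ltngtP i j) => [ij|ji|->]; first by rewrite ho.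
    by have := ho _ _ jL iL ji; lia.
  by rewrite ltnn.
(* The window is an initial segment of the sorted list of all primes in (B, B^2], so no prime
   between its ends is left out. *)
have win q : prime q -> nth 0 s 0 <= q -> q <= nth 0 s L -> exists2 i, i <= L & q = nth 0 s i.
  move=> pq q0 qL; have qP : q \in P.
    rewrite mem_primes_in pq (leq_trans (sB _ (mN 0 (leq0n L))) q0) /=.
    exact: leq_trans qL (sB2 _ (mN L (leqnn L))).
  case: (leqP (index q P) L) => h.
    by exists (index q P) => //; rewrite nth_take ?ltnS // nth_index.
  have := sorted_ltn_nth ltn_trans 0 (primes_in_sorted B (B ^ 2)) L (index q P).
  rewrite !inE index_mem qP szP => /(_ isT isT h); rewrite nth_index //.
  by move: qL; rewrite /s nth_take // -/P; lia.
exists W => //; exists (nth 0 s 0); first exact: leq_ltn_trans (sB2 _ (mN 0 _)) BN2.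
exists (nth 0 s L); first exact: leq_ltn_trans (sB2 _ (mN L _)) BN2.
split; first by split; apply: prs.
split; first by rewrite leqNgt mono // ltn0.
split; first exact: Wi.
split; first exact: Wi.
move=> q qN q' q'N q0 qL [pq pq' qq' nb].
have [i iL qE] := win q pq q0 (ltnW (leq_trans qq' qL)).
have [k kL q'E] := win q' pq' (leq_trans q0 (ltnW qq')) qL.
move: qq'; rewrite qE q'E mono // => ik.
have kE : k = i.+1.
  case: (ltngtP k i.+1) => // h; first by lia.
  case: (nb (nth 0 s i.+1)); rewrite ?qE ?q'E ?mono //; try lia.
  by apply: prs; lia.
rewrite kE in kL *; rewrite !Wi //.
have B1N : B <= N by apply: leq_trans (ltnW BN2); rewrite -mulnn; nia.
exists (f i); first exact: leq_trans (fB _ iL) B1N.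
exists (f i.+1); first exact: leq_trans (fB _ kL) B1N.
by split=> //; split=> //; apply: fT.
Qed.

(** [B] bounds the states and the length of the whole walk, [r] the length of a single chain: the
    residues of its states modulo primes up to B^2 fit into one number below N, and d levels reach
    length B. *)
Definition chain_params (N d B : nat) : Prop :=
  exists r, [/\ 0 < r, r < B, 32 <= B, (B ^ 2) ^ r.+2 <= N & B <= r ^ d].

Lemma nchain_complete N d B L T f : chain_params N d B -> L <= B ->
  (forall i, i <= L -> f i < B) -> (forall i, i < L -> T (f i) (f i.+1)) ->
  nchain N d T (f 0) (f L).
Proof.
move=> [r [r0 rB B32 BN Bd]] LB; have {LB Bd} : L <= r ^ d by lia.
elim: d L f => [|d IH] L f.
  by case: L => [|[|//]] _ _ fT; [left|right; apply: fT].
rewrite expnS => Ld fB fT /=.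
(* The outer chain samples the walk every r^d steps; [minn L] pads the end with stationary steps. *)
have := @chain_complete N B r (nchain N d T) (fun i => f (minn L (i * r ^ d))) B32 rB BN.
rewrite mul0n minn0; have -> : minn L (r * r ^ d) = L by lia.
apply=> [i _|i ir]; first by apply: fB; lia.
set a := minn L _; set b := minn L _.
have ab : a <= b by rewrite /a /b; nia.
have := IH (b - a) (fun i => f (a + i)); rewrite addn0 subnKC //; apply.
- by rewrite /a /b mulSn; lia.
- by move=> k kb; apply: fB; rewrite /b in kb; lia.
- by move=> k kb; rewrite addnS; apply: fT; rewrite /b in kb; lia.
Qed.

(** A state j*q + s carries the number j of summands already added and their sum s modulo q. *)
Definition sum_step (N : nat) (G : nat -> nat -> Prop) (q a b : nat) : Prop :=
  exists2 j, j < N & exists2 s, s < N & exists2 v, v < N & exists2 s', s' < N &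
    s < q /\ a = j * q + s /\ G j v /\ (s + v) %% q = s' /\ b = (j + 1) * q + s'.

Definition sum_mod (N d : nat) (G : nat -> nat -> Prop) (J q s : nat) : Prop :=
  s < q /\ nchain N d (sum_step N G q) 0 (J * q + s).

Lemma divmod_inj q i s j t : s < q -> t < q -> i * q + s = j * q + t -> i = j /\ s = t.
Proof.
move=> sq tq h; have q0 : 0 < q by lia.
have := congr1 (fun x => x %/ q) h; have := congr1 (fun x => x %% q) h.
by rewrite !modnMDl !modn_small // !divnMDl // !divn_small // !addn0.
Qed.

Lemma sum_mod_sound N d G J q s (g : nat -> nat) :
  (forall j v, j < J -> v < N -> G j v -> v = g j) ->
  sum_mod N d G J q s -> s = (\sum_(j < J) g j) %% q.
Proof.
move=> hG [sq ch]; have q0 : 0 < q by lia.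
pose Inv a := forall j t, t < q -> j <= J -> a = j * q + t -> t = (\sum_(i < j) g i) %% q.
suff H : Inv (J * q + s) by exact: H.
apply: (nchain_inv (Inv := Inv) _ ch).
  move=> a b [j jN [u uN [v vN [u' u'N [uq [-> [Gjv [<- ->]]]]]]]] Ia i t tq iJ.
  move/divmod_inj => h; have [] := h (ltn_pmod _ q0) tq; rewrite addn1 => ij <-.
  rewrite -ij in iJ *; rewrite big_ord_recr /= -(hG _ _ iJ vN Gjv).
  by rewrite (Ia j u uq (ltnW iJ) erefl) modnDml.
move=> j t tq _ h; have := @divmod_inj q 0 0 j t q0 tq; rewrite mul0n add0n => /(_ h)[<- <-].
by rewrite big_ord0 mod0n.
Qed.

Lemma sum_mod_complete N d G J q (g : nat -> nat) B :
  chain_params N d B -> 0 < q -> J.+1 * q <= B ->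
  (forall j, j < J -> g j < N /\ G j (g j)) ->
  sum_mod N d G J q ((\sum_(j < J) g j) %% q).
Proof.
move=> cp q0 JB hG; split; first exact: ltn_pmod.
have BN : B <= N.
  case: cp => r [r0 _ B32 BN _]; apply: leq_trans BN; rewrite -expnM.
  by rewrite -{1}[B]expn1 leq_exp2l //; lia.
have := @nchain_complete N d B J (sum_step N G q) (fun j => j * q + (\sum_(i < j) g i) %% q) cp.
rewrite big_ord0 mod0n mul0n; apply.
- by nia.
- by move=> i iJ; have := ltn_pmod (\sum_(k < i) g k) q0; nia.
move=> i iJ; have [gN Gi] := hG i iJ; exists i; first by nia.
have l1 := ltn_pmod (\sum_(k < i) g k) q0; have l2 := ltn_pmod (\sum_(k < i.+1) g k) q0.
exists ((\sum_(k < i) g k) %% q); first by nia.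
exists (g i) => //; exists ((\sum_(k < i.+1) g k) %% q); first by nia.
by rewrite addn1 modnDml big_ord_recr.
Qed.

(** For large q the walk of partial sums may have no code, but [sum_mod] is sound for every q, so
    the universal condition never excludes the true sum. The primes of polylogarithmic size already
    determine it. *)
Definition big_sum (N d : nat) (G : nat -> nat -> Prop) (J X : nat) : Prop :=
  X < N /\ forall q, q < N -> prime q -> forall s, s < N -> sum_mod N d G J q s -> X %% q = s.

(* y bounds the number of bits of the numbers below N *)
Definition sum_params (N d B y : nat) : Prop :=
  [/\ chain_params N d B, 32 <= y & N <= 2 ^ y].

Lemma chain_params_le N d B : chain_params N d B -> B < N.
Proof.
case=> r [r0 _ B32 BN _]; apply: leq_trans BN; rewrite -expnM.
by rewrite -{1}[B]expn1 ltn_exp2l //; lia.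
Qed.

Lemma big_sumP N d B y G J g X : sum_params N d B y -> J.+1 * y ^ 2 <= B ->
  (forall j v, j < J -> v < N -> (G j v <-> v = g j)) -> (forall j, j < J -> g j < N) ->
  \sum_(j < J) g j < N ->
  (big_sum N d G J X <-> X = \sum_(j < J) g j).
Proof.
move=> [cp y32 Ny] JB hG gN SN; have BN := chain_params_le cp.
have inst j v : j < J -> v < N -> G j v -> v = g j by move=> jJ vN /(hG _ _ jJ vN).
split=> [[XN h]|->]; last first.
  split=> // q _ _ s _ /(sum_mod_sound inst) ->; done.
apply: (@eq_of_congruent_primes (primes_in y (y ^ 2))).
- exact: primes_in_uniq.
- by apply/allP => p; rewrite mem_primes_in => /and3P[].
- by apply: leq_trans XN (leq_trans Ny _); rewrite leq_exp2l // many_primes.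
- by apply: leq_trans SN (leq_trans Ny _); rewrite leq_exp2l // many_primes.
move=> q; rewrite mem_primes_in => /and3P[pq yq qy]; have q0 := prime_gt0 pq.
have qB : J.+1 * q <= B by apply: leq_trans JB; rewrite leq_mul2l qy orbT.
have lt := ltn_pmod (\sum_(j < J) g j) q0.
apply: h => //; [by nia|by nia|].
apply: (sum_mod_complete cp q0 qB) => j jJ; split; first exact: gN.
by apply/hG => //; exact: gN.
Qed.

Definition is_hash (N : nat) (P : nat -> Prop) (q : nat) : Prop :=
  0 < q /\ forall u, u < N -> forall v, v < N -> P u -> P v -> u = v %[mod q] -> u = v.

Definition least_hash (N : nat) (P : nat -> Prop) (q : nat) : Prop :=
  is_hash N P q /\ forall q', q' < N -> q' < q -> ~ is_hash N P q'.

(** The elements of P are too large to index a sum of polylogarithmic length, so their residues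
    modulo an injective q are counted. Minimality of q matters: with a large modulus the sum would
    be too long, and [big_sum] could accept a wrong k. *)
Definition card_rel (N d : nat) (P : nat -> Prop) (k : nat) : Prop :=
  exists2 q, q < N & least_hash N P q /\
    big_sum N d (fun r v => (v = 1 /\ exists2 u, u < N & P u /\ u %% q = r) \/
                            (v = 0 /\ ~ exists2 u, u < N & P u /\ u %% q = r)) q k.

(** The product of all differences of distinct elements is positive and below 2^y, so one of the at
    least y primes in (y, y^2] does not divide it. [D] is 1 on the diagonal to keep the product
    nonzero. *)
Lemma exists_hash_prime (s : seq nat) n y : all (gtn n) s -> 32 <= y ->
  n ^ (size s ^ 2) < 2 ^ y ->
  exists q, [/\ prime q, q <= y ^ 2 & {in s &, forall u v, u = v %[mod q] -> u = v}].
Proof.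
move=> al y32 ny.
pose D u v := if u == v then 1 else maxn u v - minn u v.
set X := \prod_(u <- s) \prod_(v <- s) D u v.
have D0 u v : 0 < D u v by rewrite /D; case: eqP => // ?; lia.
have X0 : 0 < X by rewrite /X; apply: prodn_gt0 => u; apply: prodn_gt0 => v.
have Xle : X <= n ^ (size s ^ 2).
  have Dn u v : u \in s -> v \in s -> D u v <= n.
    by move=> /(allP al) /= un /(allP al) /= vn; rewrite /D; case: eqP; lia.
  have P1 u : u \in s -> \prod_(v <- s) D u v <= n ^ size s.
    move=> us; rewrite -(big_map (D u) xpredT id) /= -(size_map (D u) s).
    by apply: prod_le_exp => x /mapP[v vs ->]; exact: Dn.
  rewrite /X -(big_map (fun u => \prod_(v <- s) D u v) xpredT id) -mulnn expnM.
  rewrite -{2}(size_map (fun u => \prod_(v <- s) D u v) s).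
  by apply: prod_le_exp => x /mapP[u us ->]; exact: P1.
have Xlt : X < 2 ^ size (primes_in y (y ^ 2)).
  apply: leq_trans (_ : 2 ^ y <= _); last by rewrite leq_exp2l // many_primes.
  exact: leq_ltn_trans Xle ny.
have [|q] := exists_nondividing_prime (primes_in_uniq y (y ^ 2)) _ X0 Xlt.
  by apply/allP => p; rewrite mem_primes_in => /and3P[].
rewrite mem_primes_in => /and3P[pq _ qy] /negP nd; exists q; split=> // u v us vs uv.
apply/eqP/negPn/negP => nuv; apply: nd.
have dX : D u v %| X.
  by rewrite /X (big_rem u) //= dvdn_mulr // (big_rem v) //= dvdn_mulr.
apply: dvdn_trans dX; rewrite /D (negPf nuv).
case: (leqP u v) => h.
  by rewrite -eqn_mod_dvd // uv.
by rewrite -eqn_mod_dvd ?uv // ltnW.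
Qed.

Lemma card_residues (s : seq nat) q : 0 < q -> uniq s ->
  {in s &, forall u v, u = v %[mod q] -> u = v} ->
  \sum_(r < q) has (fun u => u %% q == r) s = size s.
Proof.
move=> q0 us inj; set t := map (modn^~ q) s.
have ut : uniq t by rewrite map_inj_in_uniq.
transitivity (\sum_(0 <= r < q) (r \in t : nat)).
  rewrite big_mkord; apply: eq_bigr => r _; congr nat_of_bool.
  by apply/hasP/mapP => -[u us' /eqP]; [|rewrite eq_sym => /eqP]; exists u => //; apply/eqP; rewrite // eq_sym.
have -> : \sum_(0 <= r < q) (r \in t : nat) = count (mem t) (iota 0 q).
  by rewrite -sum1_count [RHS]big_mkcond /= /index_iota subn0; apply: eq_bigr => r _; case: (r \in t).
rewrite -(size_map (modn^~ q) s) -size_filter; apply: perm_size; apply: uniq_perm => //.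
  by rewrite filter_uniq ?iota_uniq.
move=> r; rewrite mem_filter mem_iota /= add0n; case rt : (r \in t) => //=.
by move/mapP: rt => [u _ ->]; rewrite ltn_pmod.
Qed.

Lemma least_hash_exists N n y (s : seq nat) P :
  all (gtn n) s -> n <= N -> n ^ (size s ^ 2) < 2 ^ y -> 32 <= y -> y ^ 2 < N ->
  (forall u, u < N -> (P u <-> u \in s)) ->
  exists2 q, q <= y ^ 2 & least_hash N P q.
Proof.
move=> al nN ny y32 yN hP.
pose hb q := (0 < q) && all (fun u => all (fun v => (u == v %[mod q]) ==> (u == v)) s) s.
have hbP q : reflect (is_hash N P q) (hb q).
  apply: (iffP andP) => [[q0 /allP h]|[q0 h]]; split=> //.
    move=> u uN v vN /(hP _ uN) us /(hP _ vN) vs uv; have /allP/(_ v vs) := h u us.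
    by rewrite uv eqxx => /eqP.
  apply/allP => u us; apply/allP => v vs; apply/implyP => /eqP uv; apply/eqP.
  have uN : u < N by apply: leq_trans nN; exact: (allP al).
  have vN : v < N by apply: leq_trans nN; exact: (allP al).
  by apply: h => //; apply/hP.
have [q [pq qy inj]] := exists_hash_prime al y32 ny.
have ex : exists q, hb q.
  exists q; rewrite /hb prime_gt0 //; apply/allP => u us; apply/allP => v vs.
  by apply/implyP => /eqP uv; apply/eqP; exact: inj.
case: (ex_minnP ex) => q1 h1 mn; exists q1.
  apply: leq_trans qy; apply: mn; rewrite /hb prime_gt0 //; apply/allP => u us; apply/allP => v vs.
  by apply/implyP => /eqP uv; apply/eqP; exact: inj.
split; first exact/hbP.
by move=> q' _ lt /hbP/mn; lia.
Qed.

Lemma card_relP N d B y z n (s : seq nat) P k :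
  sum_params N d B y -> uniq s -> all (gtn n) s -> n <= N -> n ^ (size s ^ 2) < 2 ^ z ->
  32 <= z -> (z ^ 2).+1 * y ^ 2 <= B -> (forall u, u < N -> (P u <-> u \in s)) ->
  (card_rel N d P k <-> k = size s).
Proof.
move=> sp us al nN ns z32 zB hP; have [cp y32 Ny] := sp; have BN := chain_params_le cp.
have zN : z ^ 2 < N.
  by apply: ltn_trans BN; apply: leq_trans zB; rewrite -(mulnn y); nia.
have [q0 q0z lh] := @least_hash_exists N n z s P al nN ns z32 zN hP.
have uq q : q < N -> least_hash N P q -> q = q0.
  move=> qN [h1 h2]; have [g1 g2] := lh; case: (ltngtP q q0) => // lt.
    by case: (g2 q).
  by case: (h2 q0) => //; lia.
have sN u : u \in s -> u < N by move=> us'; apply: leq_trans nN; exact: (allP al).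
have [q00 inj0] := lh.1.
have inj : {in s &, forall u v, u = v %[mod q0] -> u = v}.
  by move=> u v us' vs; apply: inj0; rewrite ?sN //; apply/hP; rewrite ?sN.
have S := card_residues q00 us inj.
have hasE r : (exists2 u, u < N & P u /\ u %% q0 = r) <-> has (fun u => u %% q0 == r) s.
  split=> [[u uN [/(hP _ uN) us' /eqP h]]|/hasP[u us' /eqP h]]; first by apply/hasP; exists u.
  by exists u; [exact: sN | split=> //; apply/hP => //; exact: sN].
have BS X : big_sum N d (fun r v => (v = 1 /\ exists2 u, u < N & P u /\ u %% q0 = r) \/
              (v = 0 /\ ~ exists2 u, u < N & P u /\ u %% q0 = r)) q0 X <-> X = size s.
  rewrite -[X in _ <-> _ = X]S; refine (big_sumP (g := fun r => has (fun u => u %% q0 == r) s : nat) X sp _ _ _ _).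
  - by apply: leq_trans zB; rewrite leq_mul2r ltnS q0z orbT.
  - move=> r v rq vN; rewrite !hasE; case: (has _ s) => /=.
      by split=> [[[]//|[_ []//]]|->]; left.
    by split=> [[[]//|[->]//]|->]; right.
  - by move=> r _; case: (has _ s) => /=; lia.
  rewrite S; apply: leq_ltn_trans zN; apply: leq_trans q0z.
  rewrite -S; apply: leq_trans (_ : \sum_(r < q0) 1 <= _).
    by apply: leq_sum => r _; case: (has _ s).
  by rewrite sum_nat_const card_ord muln1.
split=> [[q qN [lq]]|->]; first by rewrite (uq q qN lq) BS.
by exists q0; [lia | split=> //; apply/BS].
Qed.

(** * Definability of walks and sums *)

Section Substitution.
Variables C A : nat.
Implicit Types (M : structure A) (e : seq nat).

Lemma decode_flatten n k (e : seq nat) (idx : seq nat) : size e = k * C -> all (gtn k) idx ->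
  decode n C (size idx) [seq nth 0 e i | i <- flatten [seq iota (i * C) C | i <- idx]] =
  [seq nth 0 (decode n C k e) i | i <- idx].
Proof.
move=> se; elim: idx => [//|i idx IH] /= /andP[ik al].
rewrite map_cat take_size_cat ?drop_size_cat ?size_map ?size_iota //.
by rewrite IH // nth_decode.
Qed.

Lemma dfn_subst mj k k' F (idx : seq nat) : size idx = k -> all (gtn k') idx ->
  @dfn C A mj k F -> dfn C mj k' (fun M e => F M [seq nth 0 e i | i <- idx]).
Proof.
move=> sz al hF.
have := @bdef_subst A mj (k * C) (k' * C) _ (flatten [seq iota (i * C) C | i <- idx]) _ _ hF.
move=> h; apply: (bdef_ext (N1 := 0)) (h _ _).
- by move=> M e _ se _; rewrite /= -sz (decode_flatten _ se al).
- rewrite -sz; elim: (idx) => //= i s IH; rewrite size_cat IH size_iota; lia.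
apply/allP => x /flattenP[s /mapP[i /(allP al) /= ik ->]]; rewrite mem_iota => /andP[_ h'].
by apply: leq_trans h' _; rewrite -mulSnr leq_mul2r ik orbT.
Qed.

(** [pr] forgets the variables of the quantifiers passed so far, which allows a hypothesis about k
    parameters to be used under them. *)
Definition is_tail (k K : nat) (pr : seq nat -> seq nat) : Prop :=
  exists2 n, (forall e, pr e = drop n e) & K = n + k.

Lemma dfn_rel1 mj k K (G : structure A -> seq nat -> nat -> Prop) pr s :
  dfn C mj k.+1 (fun M e => G M (behead e) (nth 0 e 0)) ->
  is_tail k K pr -> bvar K s ->
  dfn C mj K (fun M e => G M (pr e) (s e)).
Proof.
move=> hG [n prE KE] [i si iK].
have al : all (gtn K) (i :: iota n k).
  by rewrite /= iK; apply/allP => x; rewrite mem_iota /=; lia.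
apply: dfn_ext (dfn_subst _ al hG) => [M e se _|]; last by rewrite /= size_iota.
rewrite /= prE si map_nth_iota_take ?se ?KE // take_oversize // size_drop se; lia.
Qed.

Lemma dfn_rel2 mj k K (G : structure A -> seq nat -> nat -> nat -> Prop) pr s t :
  dfn C mj k.+2 (fun M e => G M (behead (behead e)) (nth 0 e 0) (nth 0 e 1)) ->
  is_tail k K pr -> bvar K s -> bvar K t ->
  dfn C mj K (fun M e => G M (pr e) (s e) (t e)).
Proof.
move=> hG [n prE KE] [i si iK] [j tj jK].
have al : all (gtn K) [:: i, j & iota n k].
  by rewrite /= iK jK; apply/allP => x; rewrite mem_iota /=; lia.
apply: dfn_ext (dfn_subst _ al hG) => [M e se _|]; last by rewrite /= size_iota.
rewrite /= prE si tj map_nth_iota_take ?se ?KE // take_oversize // size_drop se; lia.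
Qed.

Lemma dfn_rel3 mj k K (G : structure A -> seq nat -> nat -> nat -> nat -> Prop) pr s t u :
  dfn C mj k.+3 (fun M e => G M (behead (behead (behead e))) (nth 0 e 0) (nth 0 e 1) (nth 0 e 2)) ->
  is_tail k K pr -> bvar K s -> bvar K t -> bvar K u ->
  dfn C mj K (fun M e => G M (pr e) (s e) (t e) (u e)).
Proof.
move=> hG [n prE KE] [i si iK] [j tj jK] [l ul lK].
have al : all (gtn K) [:: i, j, l & iota n k].
  by rewrite /= iK jK lK; apply/allP => x; rewrite mem_iota /=; lia.
apply: dfn_ext (dfn_subst _ al hG) => [M e se _|]; last by rewrite /= size_iota.
rewrite /= prE si tj ul map_nth_iota_take ?se ?KE // take_oversize // size_drop se; lia.
Qed.

Lemma dfn_tail mj k K F pr : @dfn C A mj k F -> is_tail k K pr ->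
  dfn C mj K (fun M e => F M (pr e)).
Proof.
move=> hF [n prE KE].
have al : all (gtn K) (iota n k) by apply/allP => x; rewrite mem_iota /=; lia.
apply: dfn_ext (dfn_subst _ al hF) => [M e se _|]; last by rewrite /= size_iota.
rewrite /= prE map_nth_iota_take ?se ?KE // take_oversize // size_drop se; lia.
Qed.

Lemma term_S k t : @term C A k t -> term C k (fun M e => (t M e).+1).
Proof. by move=> ht; apply: term_ext (term_add ht (term_const _ _ k 1)) => M e; rewrite addn1. Qed.

End Substitution.

Ltac solve_tail := lazymatch goal with |- is_tail _ _ _ =>
  eexists; [let e := fresh in intro e; rewrite -?drop1 ?drop_drop;
            first [reflexivity | symmetry; exact: drop0]
           | by [] || lia] end.

Ltac up_term H n := first [exact: H | lazymatch n with S ?m =>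
  let H' := constr:(term_up H) in up_term H' m end].

Ltac solve_term := lazymatch goal with
 | |- term _ _ (fun M e => addn _ _) => apply: term_add; solve_term
 | |- term _ _ (fun M e => muln _ _) => apply: term_mul; solve_term
 | |- term _ _ (fun M e => expn _ _) => apply: term_exp; solve_term
 | |- term _ _ (fun M e => dom M) => exact: term_dom
 | |- term _ _ (fun M e => num _ M) => exact: term_num
 | |- term _ _ (fun M e => nth 0 _ _) =>
     eapply term_var; [let e := fresh in intro e; rewrite ?nth_behead; reflexivity | by [] || lia]
 | |- _ => first [ assumption | exact: term_const
     | (match goal with H : term _ _ _ |- _ => up_term H 16 end)
     | lazymatch goal with |- term _ _ (fun M e => S _) => apply: term_S; solve_term end ] end.

(** [df] proves definability by following the syntax of a predicate. [df_more] is its extension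
    point, redefined whenever new definable relations become available. *)
Ltac df_more := fail.

Ltac df_hyp := match goal with
 | Hh : dfn _ _ _ (fun M e => ?G M _ _ _ _) |- dfn _ _ _ (fun M e => ?G M _ _ _ _) =>
     apply: (@dfn_rel3 _ _ _ _ _ G _ _ _ _ Hh)
 | Hh : dfn _ _ _ (fun M e => ?G M _ _ _) |- dfn _ _ _ (fun M e => ?G M _ _ _) =>
     apply: (@dfn_rel2 _ _ _ _ _ G _ _ _ Hh)
 | Hh : dfn _ _ _ (fun M e => ?G M _ _) |- dfn _ _ _ (fun M e => ?G M _ _) =>
     apply: (@dfn_rel1 _ _ _ _ _ G _ _ Hh)
 | Hh : dfn _ _ _ (fun M e => ?G M _) |- dfn _ _ _ (fun M e => ?G M _) =>
     apply: (@dfn_tail _ _ _ _ _ G _ Hh) end.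

Ltac df := lazymatch goal with
 | |- dfn _ _ _ (fun M e => _ <-> _) => apply: dfn_iff; df
 | |- dfn _ _ _ (fun M e => _ /\ _) => apply: dfn_and; df
 | |- dfn _ _ _ (fun M e => _ \/ _) => apply: dfn_or; df
 | |- dfn _ _ _ (fun M e => ~ _) => apply: dfn_not; df
 | |- dfn _ _ _ (fun M e => exists2 x, is_true (x < num _ M) & _) => apply: dfn_ex; df
 | |- dfn _ _ _ (fun M e => forall x, is_true (x < num _ M) -> _) => apply: dfn_all; df
 | |- dfn _ _ _ (fun M e => _ -> _) => apply: dfn_imp; df
 | |- dfn _ _ _ (fun M e => is_true (leq (S _) _)) => apply: dfn_lt => //; solve_term
 | |- dfn _ _ _ (fun M e => is_true (leq _ _)) => apply: dfn_le => //; solve_term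
 | |- dfn _ _ _ (fun M e => modn _ _ = modn _ _) => apply: dfn_modeq => //; solve_term
 | |- dfn _ _ _ (fun M e => modn _ _ = _) => apply: dfn_modn => //; solve_term
 | |- dfn _ _ _ (fun M e => divn _ _ = _) => apply: dfn_divn => //; solve_term
 | |- dfn _ _ _ (fun M e => _ = _ :> nat) => apply: dfn_eq => //; solve_term
 | |- dfn _ _ _ (fun M e => edge M _ _) => apply: dfn_edge_var => //; solve_bvar
 | |- is_tail _ _ _ => solve_tail
 | |- bvar _ _ => solve_bvar
 | |- term _ _ _ => solve_term
 | |- dfn _ _ _ _ => first
      [ assumption | (df_hyp; df)
      | df_more | idtac ]
 | |- _ => try done end.

Section DefinableCombinators.
Variables C A : nat.
Hypothesis C0 : 0 < C.
Implicit Types (M : structure A) (e : seq nat).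

Lemma prime_bounded N p : p <= N -> prime p <-> 1 < p /\
  forall a, a < N -> forall b, b < N -> a * b = p -> a = 1 \/ b = 1.
Proof.
move=> pN; split=> [pp|[p1 h]].
  split; first exact: prime_gt1.
  move=> a aN b bN ab; have /primeP[_ hp] := pp.
  have /hp : a %| p by rewrite -ab dvdn_mulr.
  case/orP => /eqP; first by left.
  by move=> ap; right; have := prime_gt0 pp; nia.
apply/primeP; split=> // a /dvdnP[b pE].
case: (eqVneq a p) => [->|ap]; first by rewrite orbT.
rewrite orbF; case: (eqVneq a 1) => // a1.
have b1 : b != 1 by apply/eqP => b1; move: ap; rewrite pE b1 mul1n eqxx.
have a0 : 0 < a by case: a pE {h ap a1} => // pE; move: p1; rewrite pE muln0.
have b0 : 0 < b by case: b pE {h b1} => // pE; move: p1; rewrite pE.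
have bN : b < N by apply: leq_trans pN; rewrite pE; move: a1 a0 b0; clear; nia.
have aN : a < N by apply: leq_trans pN; rewrite pE; move: b1 a0 b0; clear; nia.
by case: (h b bN a aN (esym pE)) => /eqP; rewrite ?(negPf a1) ?(negPf b1).
Qed.

Lemma dfn_prime mj k t : term C k t -> @dfn C A mj k (fun M e => t M e < num C M /\ prime (t M e)).
Proof.
move=> ht; have h : dfn C mj k (fun M e => t M e < num C M /\ (1 < t M e /\
   forall a, a < num C M -> forall b, b < num C M -> a * b = t M e -> a = 1 \/ b = 1)) by df.
apply: dfn_ext h => M e _ _.
by split=> -[tM]; [move/(prime_bounded (ltnW tM)) | move=> pt; split=> //; apply/(prime_bounded (ltnW tM))].
Qed.

Lemma dfn_prime_var mj k t : bvar k t -> @dfn C A mj k (fun M e => prime (t e)).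
Proof.
move=> [i ti ik]; have h := dfn_prime mj (term_var C A ti ik).
apply: dfn_ext h => M e se ae; split=> [[]//|h]; split=> //.
by rewrite ti; apply: (allP ae); rewrite mem_nth // se.
Qed.

Lemma bvar_lt k t M e : bvar k t -> size e = k -> all (gtn (num C M)) e -> t e < num C M.
Proof. by move=> [i -> ik] se ae; apply: (allP ae); rewrite mem_nth // se. Qed.

Lemma dfn_consecutive mj k s t : bvar k s -> bvar k t ->
  @dfn C A mj k (fun M e => consecutive_primes (s e) (t e)).
Proof.
move=> hs ht.
have h : dfn C mj k (fun M e => (prime (s e) /\ prime (t e)) /\ (s e < t e /\
   forall r, r < num C M -> s e < r -> r < t e -> ~ prime r)).
  have [i si ik] := hs; have [j tj jk] := ht.
  have h1 := term_var C A si ik; have h2 := term_var C A tj jk.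
  apply: dfn_and; first by apply: dfn_and; exact: dfn_prime_var.
  by df; apply: dfn_prime_var; df.
apply: dfn_ext h => M e se ae; have tM := bvar_lt ht se ae; split=> [[[? ?] [? h]]|[? ? ? h]].
  by split=> // r sr rt; apply: h => //; exact: ltn_trans rt tM.
by split=> //; split=> // r _; exact: h.
Qed.

Ltac df_more ::= first
  [ (apply: dfn_prime_var; df) | (apply: dfn_consecutive; df) ].

Lemma dfn_chain mj k (T : structure A -> seq nat -> nat -> nat -> Prop) s t :
  dfn C mj k.+2 (fun M e => T M (behead (behead e)) (nth 0 e 0) (nth 0 e 1)) ->
  term C k s -> term C k t ->
  dfn C mj k (fun M e => chain (num C M) (T M e) (s M e) (t M e)).
Proof. by move=> hT hs ht; rewrite /chain; df. Qed.

(** At depth 0 the end points are arguments of T and must be named by quantified numbers, whence the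
    last hypothesis. At positive depth T is applied only to residues that [chain] already
    quantifies, and the end points may be arbitrary terms. *)
Lemma dfn_nchain mj d k (T : structure A -> seq nat -> nat -> nat -> Prop) s t :
  dfn C mj k.+2 (fun M e => T M (behead (behead e)) (nth 0 e 0) (nth 0 e 1)) ->
  term C k s -> term C k t ->
  (forall M e, size e = k -> all (gtn (num C M)) e -> d = 0 -> s M e < num C M /\ t M e < num C M) ->
  dfn C mj k (fun M e => nchain (num C M) d (T M e) (s M e) (t M e)).
Proof.
elim: d k T s t => [|d IH] k T s t hT hs ht st.
  have h : dfn C mj k (fun M e => exists2 x, x < num C M & exists2 y, y < num C M &
     s M e = x /\ t M e = y /\ (x = y \/ T M e x y)) by df.
  apply: dfn_ext h => M e se ae /=; split; first by move=> [x _ [y _ [-> [-> ]]]].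
  by have [sN tN] := st M e se ae erefl; exists (s M e) => //; exists (t M e).
apply: (@dfn_chain mj k (fun M e => nchain (num C M) d (T M e))) => //.
apply: (IH k.+2 (fun M e => T M (behead (behead e)))) => //; try by df.
move=> M e se ae _; split; apply: (allP ae); rewrite mem_nth // se //.
Qed.

Variable d : nat.
Hypothesis d0 : 0 < d.

Lemma dfn_sum_mod mj k (G : structure A -> seq nat -> nat -> nat -> Prop) J q s :
  dfn C mj k.+2 (fun M e => G M (behead (behead e)) (nth 0 e 0) (nth 0 e 1)) ->
  term C k J -> term C k q -> term C k s ->
  dfn C mj k (fun M e => sum_mod (num C M) d (G M e) (J M e) (q M e) (s M e)).
Proof.
move=> hG hJ hq hs; rewrite /sum_mod; apply: dfn_and; first by df.
apply: (@dfn_nchain mj d k (fun M e => sum_step (num C M) (G M e) (q M e))); try by df.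
  by rewrite /sum_step; df.
by move=> M e _ _ dE; move: d0; rewrite dE.
Qed.

Lemma dfn_big_sum mj k (G : structure A -> seq nat -> nat -> nat -> Prop) J X :
  dfn C mj k.+2 (fun M e => G M (behead (behead e)) (nth 0 e 0) (nth 0 e 1)) ->
  term C k J -> term C k X ->
  dfn C mj k (fun M e => big_sum (num C M) d (G M e) (J M e) (X M e)).
Proof.
move=> hG hJ hX; rewrite /big_sum; df.
by apply: (@dfn_sum_mod mj k.+2 (fun M e => G M (behead (behead e)))); df.
Qed.

Lemma dfn_least_hash mj k (P : structure A -> seq nat -> nat -> Prop) q :
  dfn C mj k.+1 (fun M e => P M (behead e) (nth 0 e 0)) -> term C k q ->
  dfn C mj k (fun M e => least_hash (num C M) (P M e) (q M e)).
Proof. by move=> hP hq; rewrite /least_hash /is_hash; df. Qed.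

Lemma dfn_card mj k (P : structure A -> seq nat -> nat -> Prop) X :
  dfn C mj k.+1 (fun M e => P M (behead e) (nth 0 e 0)) -> term C k X ->
  dfn C mj k (fun M e => card_rel (num C M) d (P M e) (X M e)).
Proof.
move=> hP hX; rewrite /card_rel; apply: dfn_ex; apply: dfn_and.
  by apply: (@dfn_least_hash mj k.+1 (fun M e => P M (behead e))); df.
by apply: dfn_big_sum; df.
Qed.
End DefinableCombinators.

Ltac df_sums := first
  [ (apply: dfn_prime_var; df) | (apply: dfn_consecutive; df)
  | (apply: dfn_sum_mod => //; df) | (apply: dfn_big_sum => //; df)
  | (apply: dfn_least_hash => //; df) | (apply: dfn_card => //; df) ].
Ltac df_more ::= df_sums.

(** * Determinants and polynomials over finite fields *)

Local Open Scope ring_scope.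

(** Multiplication by g permutes the summands and multiplies the sum by g^k. Some g has g^k <> 1,
    because X^k - 1 has at most k roots. *)
Lemma sum_nonzero_powers (F : finFieldType) k : (0 < k)%N -> (k < #|F|.-1)%N ->
  \sum_(a : F | a != 0) a ^+ k = 0.
Proof.
move=> k0 kF; have [g g0 gk] : exists2 g : F, g != 0 & g ^+ k != 1.
  pose rs := enum [pred x : F | x != 0].
  have sz : size rs = #|F|.-1.
    rewrite -cardE (cardD1 (0 : F)) [#|F|](cardD1 (0 : F)) /= !inE eqxx /=.
    by apply: eq_card => x; rewrite !inE andbT; case: eqP.
  case: (boolP (has (fun x => x ^+ k != 1) rs)) => [/hasP[g]|].
    by rewrite mem_enum inE => g0 gk; exists g.
  rewrite -all_predC => al; have : (size rs <= k)%N.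
    apply: (@max_unity_roots F k) => //; last exact: enum_uniq.
    apply/allP => x xs; apply/unity_rootP; move/allP/(_ x xs): al => /=.
    by rewrite negbK => /eqP.
  by rewrite sz leqNgt kF.
have : \sum_(a : F | a != 0) a ^+ k = g ^+ k * \sum_(a : F | a != 0) a ^+ k.
  rewrite mulr_sumr (reindex_onto (fun a => g * a) (fun a => g^-1 * a)) /=; last first.
    by move=> a _; rewrite mulrA mulfV // mul1r.
  apply: eq_big => [a|a _]; last by rewrite exprMn.
  by rewrite mulrA mulVf // mul1r eqxx andbT mulf_eq0 (negPf g0).
move/eqP; rewrite -subr_eq0 -{1}[\sum_(a | _) _]mul1r -mulrBl mulf_eq0 subr_eq0 eq_sym (negPf gk) /=.
by move/eqP.
Qed.

Lemma expf_card_pred (F : finFieldType) (a : F) : a != 0 -> a ^+ #|F|.-1 = 1.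
Proof.
move=> a0; apply: (mulfI a0); rewrite mulr1 -exprS prednK ?expf_card //.
by apply/card_gt0P; exists 0.
Qed.

(** Interpolation on the multiplicative group: the sum of a^(i-j) over all nonzero a is |F| - 1 = -1
    for i = j and 0 otherwise. *)
Lemma poly_coef_sum (F : finFieldType) (P : {poly F}) j : #|F|%:R = 0 :> F -> (size P <= #|F|.-1)%N -> (j < #|F|.-1)%N ->
  P`_j = - \sum_(a : F | a != 0) P.[a] / a ^+ j.
Proof.
move=> ch sP jF; set q := #|F|.-1 in sP jF *.
have q1 : (0 < q)%N by exact: leq_ltn_trans jF.
have S i : (i < q)%N -> \sum_(a : F | a != 0) a ^+ i / a ^+ j = if i == j then -1 else 0.
  move=> iq; case: eqP => [->|/eqP ij].
    rewrite (eq_bigr (fun _ => 1)); last by move=> a a0; rewrite divff // expf_neq0.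
    rewrite sumr_const; have -> : #|[pred a : F | a != 0]| = q.
      rewrite /q [#|F|](cardD1 (0 : F)) inE /=; apply: eq_card => x.
      by rewrite !inE andbT.
    apply/eqP; rewrite -subr_eq0 opprK natr1 /q prednK ?ch //.
    by apply/card_gt0P; exists 0.
  case: (ltngtP i j) ij => // ij _.
    rewrite -[RHS](@sum_nonzero_powers F (q - (j - i))); [|lia|rewrite -/q; lia].
    apply: eq_bigr => a a0; have -> : a ^+ j = a ^+ i * a ^+ (j - i) by rewrite -exprD subnKC // ltnW.
    rewrite invfM mulrA divff ?expf_neq0 // mul1r.
    apply: (mulIf (expf_neq0 (j - i) a0)); rewrite mulVf ?expf_neq0 // -exprD subnK ?expf_card_pred //.
    by lia.
  rewrite -[RHS](@sum_nonzero_powers F (i - j)); [|lia|rewrite -/q; lia].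
  apply: eq_bigr => a a0; rewrite -{1}(subnK (ltnW ij)) exprD -mulrA divff ?mulr1 //.
  by rewrite expf_neq0.
rewrite (eq_bigr (fun a => \sum_(i < q) P`_i * (a ^+ i / a ^+ j))); last first.
  move=> a a0; rewrite (horner_coef_wide a sP) mulr_suml; apply: eq_bigr => i _.
  by rewrite mulrA.
rewrite exchange_big /=.
rewrite (eq_bigr (fun i : 'I_q => if i == Ordinal jF then - P`_i else 0)); last first.
  move=> i _; rewrite -mulr_sumr S //; case: eqP => [ij|ij]; case: eqP => [e|e]; rewrite ?mulrN1 ?mulr0 //.
    by case: e; apply: val_inj.
  by case: ij; rewrite e.
by rewrite -big_mkcond /= big_pred1_eq opprK.
Qed.

Lemma sum_Fp (p : nat) (f : 'F_p -> 'F_p) : prime p ->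
  \sum_(a : 'F_p | a != 0) f a = \sum_(i < p.-1) f i.+1%:R.
Proof.
move=> pr; have E : (Zp_trunc (pdiv p)).+1 = p.-1 by rewrite -[in RHS](Fp_cast pr).
rewrite -(big_mkord xpredT (fun i => f i.+1%:R)) -E big_mkord [LHS]big_mkcond [LHS]big_ord_recl /=.
rewrite add0r; apply: eq_bigr => i _; congr f; by rewrite -[LHS]natr_Zp.
Qed.

(** The entries are indexed by all natural numbers, so that leading minors of all sizes come from
    one function. *)
Definition lead (F : Type) (c : nat -> nat -> F) (i : nat) : 'M[F]_i := \matrix_(r, s) c r s.

(** Cramer's rule: the last coordinate of the solution for the last unit vector is the quotient of
    two consecutive leading minors. Adding the adjugate identity instead of dividing covers singular
    matrices too. *)
Lemma pivot_det (F : comUnitRingType) (c : nat -> nat -> F) (x : nat -> F) i :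
  (forall r, (r <= i)%N -> \sum_(j < i.+1) c r j * x j = (r == i)%:R) ->
  \det (lead c i.+1) * x i = \det (lead c i).
Proof.
move=> h; set D := lead c i.+1; pose X : 'cV_i.+1 := \col_j x j.
have DX : D *m X = delta_mx ord_max 0.
  apply/matrixP => r s; rewrite !mxE (ord1 s) eqxx andbT -[in RHS]val_eqE /=.
  by rewrite -h -1?ltnS //; apply: eq_bigr => j _; rewrite !mxE.
have : \adj D *m (D *m X) = \det D *: X by rewrite mulmxA mul_adj_mx mul_scalar_mx.
rewrite DX => /matrixP/(_ ord_max 0); rewrite [RHS]mxE [X _ _]mxE /= => <-.
rewrite !mxE (bigD1 ord_max) //= !mxE !eqxx mulr1 big1 ?addr0; last first.
  by move=> j jm; rewrite !mxE (negPf jm) mulr0.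
rewrite /cofactor -signr_odd oddD addbb expr0 mul1r; congr (\det _).
by apply/matrixP => r s; rewrite !mxE !lift_max.
Qed.

Lemma pivot_exists (F : fieldType) (c : nat -> nat -> F) i : \det (lead c i.+1) != 0 ->
  exists x : nat -> F, forall r, (r <= i)%N -> \sum_(j < i.+1) c r j * x j = (r == i)%:R.
Proof.
move=> d0; have U : lead c i.+1 \in unitmx by rewrite unitmxE unitfE.
exists (fun j => invmx (lead c i.+1) (inord j) ord_max) => r ri.
have := congr1 (fun m : 'M_i.+1 => m (inord r) ord_max) (mulmxV U).
rewrite !mxE => e; transitivity (((inord r : 'I_i.+1) == ord_max)%:R : F).
  rewrite -e; apply: eq_bigr => j _; rewrite !mxE inordK // inord_val //.
by rewrite -val_eqE /= inordK.
Qed.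

Lemma det_shift (F : comNzRingType) (c : nat -> nat -> F) (z : F) i :
  \det (lead (fun r s => c r s + (r == s)%:R * z) i) = (char_poly (- lead c i)).[z].
Proof.
rewrite /char_poly -[RHS]/(horner_eval z _) -det_map_mx; congr (\det _).
apply/matrixP => r s; rewrite !mxE /= /horner_eval !hornerE ?rmorphN /= hornerMn hornerX mulr_natl.
by rewrite opprK addrC.
Qed.

Lemma vanishing_poly (F : finFieldType) (P : {poly F}) :
  (size P <= #|F|)%N -> (forall z, P.[z] = 0) -> P = 0.
Proof.
move=> sz h; apply/eqP/negPn/negP => P0.
have : (size (enum F) < size P)%N.
  apply: max_poly_roots => //; last exact: enum_uniq.
  by apply/allP => z _; apply/rootP.
by rewrite -cardE ltnNge sz.
Qed.

(** As functions of z the shifted leading minors are characteristic polynomials, hence monic. Their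
    product [B] has degree at most K(K+1), so (h1 - h2)B vanishes on the whole field and has degree
    below its size. *)
Lemma eq_poly_off_minors (F : finFieldType) (c : nat -> nat -> F) K (h1 h2 : {poly F}) :
  (size h1 <= K.+1)%N -> (size h2 <= K.+1)%N -> (K.+2 * K.+1 <= #|F|)%N ->
  (forall z, (forall i, (i <= K)%N -> \det (lead (fun r s => c r s + (r == s)%:R * z) i) != 0) ->
     h1.[z] = h2.[z]) -> h1 = h2.
Proof.
move=> s1 s2 sF h; pose B := \prod_(i < K.+1) char_poly (- lead c i).
have mB : B \is monic by apply: monic_prod => i _; exact: char_poly_monic.
have sB : (size B <= K * K.+1 + 1)%N.
  have gen m : (m <= K.+1)%N -> (size (\prod_(i < m) char_poly (- lead c i))%R <= K * m + 1)%N.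
    elim: m => [|m IH] mK; first by rewrite big_ord0 size_poly1 addn1.
    rewrite big_ord_recr /=; apply: leq_trans (size_polyMleq _ _) _.
    rewrite size_char_poly addnS /=; have := IH (ltnW mK); rewrite mulnSr.
    by move: (size _) => S; lia.
  exact: gen.
apply/eqP; rewrite -subr_eq0; have : (h1 - h2) * B = 0.
  apply: vanishing_poly.
    apply: leq_trans (size_polyMleq _ _) _; apply: leq_trans sF.
    have : (size (h1 - h2)%R <= K.+1)%N by rewrite (leq_trans (size_polyD _ _)) // size_polyN geq_max s1.
    by move: sB; move: (size B) (size _) => u v; nia.
  move=> z; rewrite hornerM; case: (eqVneq B.[z] 0) => [->|Bz]; first by rewrite mulr0.
  rewrite hornerD hornerN h ?subrr ?mul0r // => i iK; rewrite det_shift.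
  move: Bz; rewrite /B horner_prod => /prodf_neq0 /(_ (Ordinal (iK : (i < K.+1)%N)) isT) //.
move/eqP; rewrite mulf_eq0 => /orP[//|/eqP B0]; move: mB; rewrite B0 monicE lead_coef0.
by rewrite eq_sym oner_eq0.
Qed.

(** * Determinants of matrices of bit polynomials *)

Section BitLifting.
Variables (nb K : nat) (M : nat -> nat -> nat).

Definition bit (x u : nat) : nat := ((x %/ 2 ^ u) %% 2)%N.

Lemma bit_sum x n : (x < 2 ^ n)%N -> (\sum_(u < n) bit x u * 2 ^ u = x)%N.
Proof.
elim: n x => [|n IH] x; first by rewrite big_ord0 expn0; case: x.
rewrite expnS => xn; rewrite big_ord_recl /= /bit expn0 muln1 divn1.
have h : (x %/ 2 < 2 ^ n)%N by rewrite ltn_divLR // mulnC.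
rewrite (eq_bigr (fun u : 'I_n => 2 * (bit (x %/ 2) u * 2 ^ u))%N); last first.
  by move=> u _; rewrite /bit /bump /= add1n expnS divnMA; lia.
by rewrite -big_distrr /= IH //; lia.
Qed.

(** With the bits as coefficients, the coefficients of a K by K determinant are at most K! nb^K in
    absolute value, whatever the size of the entries. They can be recovered from residues modulo
    small primes. *)
Definition bit_poly (x : nat) : {poly int} := \poly_(u < nb) (bit x u)%:R.
Definition bit_mx : 'M[{poly int}]_K := \matrix_(i, j) bit_poly (M i j).
Definition bit_det : {poly int} := \det bit_mx.

Lemma bit_det_at2 : (forall i j, (i < K)%N -> (j < K)%N -> (M i j < 2 ^ nb)%N) ->
  bit_det.[2] = \det (lead (fun i j => (M i j)%:R : int) K).
Proof.
move=> h; rewrite /bit_det -[LHS]/(horner_eval 2 _) -det_map_mx; congr (\det _).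
apply/matrixP => i j; rewrite !mxE /= /horner_eval /bit_poly horner_poly -[in RHS](bit_sum (h i j _ _)) //.
by rewrite natr_sum; apply: eq_bigr => u _; rewrite natrM natrX.
Qed.

Lemma size_bit_det : (size bit_det <= K * nb + 1)%N.
Proof.
apply: leq_trans (size_sum _ _ _) _; apply/bigmax_leqP => s _.
have -> : size ((-1) ^+ s * \prod_i bit_mx i (s i)) = size (\prod_i bit_mx i (s i)).
  by rewrite -signr_odd; case: (odd s); rewrite ?expr1 ?expr0 ?mulN1r ?mul1r ?size_polyN.
apply: leq_trans (size_poly_prod_leq _ _) _.
have : (\sum_(i < K) size (bit_mx i (s i)) <= K * nb)%N; last by set S := (\sum_(i < K) _)%N; lia.
apply: leq_trans (_ : \sum_(i < K) nb <= _)%N; last by rewrite sum_nat_const card_ord.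
by apply: leq_sum => i _; rewrite mxE size_poly.
Qed.

Lemma bit_det_mod (R : comNzRingType) (a : R) :
  (map_poly intr bit_det).[a] =
  \det (lead (fun i j => \sum_(u < nb) (bit (M i j) u)%:R * a ^+ u) K).
Proof.
rewrite /bit_det.
have -> : (map_poly intr (\det bit_mx)).[a] = \det (map_mx (fun p : {poly int} => (map_poly (intr : int -> R) p).[a]) bit_mx).
  by rewrite -[LHS]/((horner_eval a \o map_poly intr) _) -det_map_mx.
congr (\det _); apply/matrixP => i j; rewrite !mxE.
rewrite (@horner_coef_wide _ nb); last first.
  by apply: leq_trans (size_poly _ _) (size_poly _ _).
by apply: eq_bigr => u _; rewrite coef_map coef_poly ltn_ord /= rmorph_nat.
Qed.

(** The sum of the absolute values of the coefficients is submultiplicative, and it bounds every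
    single coefficient. *)
Definition norm1 (p : {poly int}) : nat := (\sum_(i < size p) absz (p`_i)%R)%N.

Lemma norm1_wide n (p : {poly int}) : (size p <= n)%N -> norm1 p = (\sum_(i < n) absz (p`_i)%R)%N.
Proof.
move=> sp; rewrite /norm1 (big_ord_widen n (fun i => absz (p`_i)%R)) //.
rewrite big_mkcond /=; apply: eq_bigr => i _; case: ltnP => // h.
by rewrite nth_default ?absz0.
Qed.

Lemma norm1D p q : (norm1 (p + q)%R <= norm1 p + norm1 q)%N.
Proof.
set n := maxn (size p) (size q).
rewrite (@norm1_wide n) ?size_polyD // (@norm1_wide n p) ?leq_maxl // (@norm1_wide n q) ?leq_maxr //.
by rewrite -big_split /=; apply: leq_sum => i _; rewrite coefD; move: p`_i q`_i => a b; lia.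
Qed.

Lemma norm1_coef (p : {poly int}) i : (absz (p`_i)%R <= norm1 p)%N.
Proof.
case: (ltnP i (size p)) => h; last by rewrite nth_default ?absz0.
by rewrite /norm1 (bigD1 (Ordinal h)) //= leq_addr.
Qed.

Lemma norm1MX c n (q : {poly int}) : (norm1 (c *: ('X^n * q))%R <= absz c * norm1 q)%N.
Proof.
rewrite (@norm1_wide (n + size q)); last first.
  apply: leq_trans (size_scale_leq _ _) _; apply: leq_trans (size_polyMleq _ _) _.
  by rewrite size_polyXn.
rewrite big_split_ord /= big1; last first.
  by move=> i _; rewrite coefZ coefXnM /= ltn_ord mulr0.
rewrite add0n /norm1 big_distrr /=; apply: leq_sum => i _.
by rewrite coefZ coefXnM ltnNge leq_addr /= addKn abszM.
Qed.

Lemma norm1_sum I (r : seq I) (P : pred I) (f : I -> {poly int}) :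
  (norm1 (\sum_(i <- r | P i) f i)%R <= \sum_(i <- r | P i) norm1 (f i))%N.
Proof.
elim/big_rec2: _ => [|i y1 y2 _ h]; first by rewrite /norm1 size_poly0 big_ord0.
by apply: leq_trans (norm1D _ _) _; rewrite leq_add2l.
Qed.

Lemma norm1M p q : (norm1 (p * q)%R <= norm1 p * norm1 q)%N.
Proof.
rewrite -{1}[p]coefK poly_def mulr_suml.
apply: leq_trans (norm1_sum _ _ _) _; rewrite {2}/norm1 big_distrl /=.
by apply: leq_sum => i _; rewrite -scalerAl norm1MX.
Qed.

Lemma norm1_bit_poly x : (norm1 (bit_poly x) <= nb)%N.
Proof.
rewrite (@norm1_wide nb) ?size_poly //; apply: leq_trans (_ : \sum_(i < nb) 1 <= _)%N.
  by apply: leq_sum => i _; rewrite coef_poly ltn_ord /bit; lia.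
by rewrite sum_nat_const card_ord muln1.
Qed.

Lemma bit_det_coef j : (absz (bit_det`_j)%R <= K`! * nb ^ K)%N.
Proof.
apply: leq_trans (norm1_coef _ _) _; apply: leq_trans (norm1_sum _ _ _) _.
apply: leq_trans (_ : \sum_(s : 'S_K) nb ^ K <= _)%N; last first.
  by rewrite sum_nat_const card_Sn.
apply: leq_sum => s _; apply: leq_trans (norm1M _ _) _.
have -> : norm1 ((-1) ^+ s) = 1%N.
  by rewrite -[(-1) ^+ s]mulr1 -signr_odd; case: (odd s); rewrite /norm1 ?expr1 ?expr0 ?mulN1r ?mul1r ?size_polyN size_poly1 big_ord1 ?coefN coef1.
rewrite mul1n; have -> : (nb ^ K = \prod_(i < K) nb)%N by rewrite prod_nat_const card_ord.
elim/big_rec2: _ => [|i y1 y2 _ h].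
  by rewrite /norm1 size_poly1 big_ord1 coef1.
by apply: leq_trans (norm1M _ _) _; rewrite leq_mul // mxE norm1_bit_poly.
Qed.
End BitLifting.

(** * Low-rank updates and counting walks *)

(** Sylvester's identity, from two triangular factorisations of one block matrix. *)
Lemma det_1addmulC (F : comNzRingType) n k (A : 'M[F]_(n, k)) (B : 'M[F]_(k, n)) :
  \det (1%:M + A *m B) = \det (1%:M + B *m A).
Proof.
have e1 : block_mx 1%:M A (- B) 1%:M = block_mx 1%:M 0 (- B) 1%:M *m block_mx 1%:M A 0 (1%:M + B *m A).
  rewrite mulmx_block !mul1mx !mulmx0 !mul0mx !mulmx1 !addr0 mulNmx.
  by rewrite addrCA addNr addr0.
have e2 : block_mx 1%:M A (- B) 1%:M = block_mx 1%:M A 0 1%:M *m block_mx (1%:M + A *m B) 0 (- B) 1%:M.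
  rewrite mulmx_block !mul1mx !mulmx0 !mul0mx !mulmx1 !add0r mulmxN.
  by rewrite addrK.
have := congr1 determinant e1; rewrite e2 !det_mulmx !det_lblock !det_ublock !det1 !mul1r !mulr1.
by [].
Qed.

(** The Schur complement with the inverse of Z replaced by a given solution v of Zv = b, so that Z
    need not be invertible. *)
Lemma det_block_solve (F : comNzRingType) m l (Z : 'M[F]_m) (b v : 'M[F]_(m, l)) (c : 'M[F]_(l, m)) (d : 'M[F]_l) :
  Z *m v = b -> \det (block_mx Z b c d) = \det Z * \det (d - c *m v).
Proof.
move=> <-.
have -> : block_mx Z (Z *m v) c d = block_mx Z 0 c (d - c *m v) *m block_mx 1%:M v 0 1%:M.
  by rewrite mulmx_block !mulmx1 !mul0mx !mulmx0 !addr0 addrCA subrr addr0.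
by rewrite det_mulmx det_lblock det_ublock !det1 !mulr1.
Qed.

Section Woodbury.
Variables (F : fieldType) (n k : nat) (N : 'M[F]_n) (g : 'I_k -> 'I_n) (D : 'M[F]_k).
Hypothesis uN : N \in unitmx.
Let P : 'M[F]_(n, k) := \matrix_(u, i) (u == g i)%:R.
Let X := invmx N.
Let N' := N + P *m D *m P^T.
Let Xuu := P^T *m X *m P.
Let S := 1%:M + Xuu *m D.

Lemma det_update : \det N' = \det N * \det S.
Proof.
have -> : N' = N *m (1%:M + (X *m P *m D) *m P^T).
  by rewrite mulmxDr mulmx1 !mulmxA mulmxV // mul1mx.
by rewrite det_mulmx det_1addmulC /S /Xuu !mulmxA.
Qed.

Lemma inv_update : \det S != 0 -> N' \in unitmx /\
  invmx N' = X - X *m P *m D *m invmx S *m P^T *m X.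
Proof.
move=> dS; have uS : S \in unitmx by rewrite unitmxE unitfE.
have uN' : N' \in unitmx.
  by rewrite unitmxE det_update unitfE mulf_neq0 // -unitfE -unitmxE.
split=> //; set Y := X - _.
suff e : N' *m Y = 1%:M by rewrite -[LHS]mulmx1 -e mulmxA mulVmx // mul1mx.
have h : P *m D *m P^T *m X *m P *m D = P *m D *m (S - 1%:M).
  by rewrite /S /Xuu addrC addKr !mulmxA.
rewrite /N' /Y mulmxDl !mulmxBr mulmxV // !mulmxA mulmxV // mul1mx.
rewrite -[X in 1%:M - X + _]/(P *m D *m invmx S *m P^T *m X) h mulmxBr mulmx1 !mulmxBl.
rewrite -[P *m D *m S *m invmx S]mulmxA mulmxV // mulmx1.
by rewrite opprB [X in _ - _ + X]addrCA subrr addr0 subrK.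
Qed.

(** The matrix S = 1 + Xuu D contains a matrix product. Spreading it over a 2k by 2k block matrix
    leaves only single entries of the old inverse, of -D and constants, which a formula can name
    directly; the last row and column are the border for s and t. *)
Definition block_entry (Dn Xu : nat -> nat -> F) (xt xs : nat -> F) (xst : F) (i j : nat) : F :=
  if (i < k)%N then (if (j < k)%N then (i == j)%:R else if (j < k + k)%N then Dn i (j - k)%N else 0)
  else if (i < k + k)%N then
    (if (j < k)%N then Xu (i - k)%N j else if (j < k + k)%N then (i == j)%:R else xt (i - k)%N)
  else (if (j < k)%N then xs j else if (j < k + k)%N then 0 else xst).

Variables (Dn Xu : nat -> nat -> F) (xt xs : nat -> F) (s t : 'I_n).
Hypothesis DnE : forall i j : 'I_k, Dn i j = - D i j.
Hypothesis XuE : forall i j : 'I_k, Xu i j = X (g i) (g j).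
Hypothesis xtE : forall i : 'I_k, xt i = X (g i) t.
Hypothesis xsE : forall i : 'I_k, xs i = X s (g i).
Let ent := block_entry Dn Xu xt xs (X s t).

Lemma XuuE (i j : 'I_k) : Xuu i j = X (g i) (g j).
Proof.
rewrite mxE (bigD1 (g j)) //= big1 ?addr0; last first.
  by move=> u /negPf uj; rewrite [P _ _]mxE uj mulr0.
rewrite [P _ _]mxE eqxx mulr1 mxE (bigD1 (g i)) //= big1 ?addr0; last first.
  by move=> u /negPf uj; rewrite !mxE uj mul0r.
by rewrite !mxE eqxx mul1r.
Qed.

Lemma lead_block : lead ent (k + k) = block_mx 1%:M (- D) Xuu 1%:M.
Proof.
apply/matrixP => i j; rewrite mxE /ent /block_entry.
case: (split_ordP i) => i1 ->; case: (split_ordP j) => j1 ->;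
  rewrite ?block_mxEul ?block_mxEur ?block_mxEdl ?block_mxEdr /= ?mxE ?ltn_ord ?ltn_add2l ?ltn_ord //.
- by rewrite addKn DnE.
- by rewrite addKn XuE -XuuE mxE.
by do ?(rewrite ifF; last by lia); rewrite eqn_add2l.
Qed.

Lemma det_lead_block : \det (lead ent (k + k)) = \det S.
Proof.
rewrite lead_block (@det_block_solve _ _ _ _ _ (- D)) ?mul1mx // det1 mul1r mulmxN opprK.
by [].
Qed.

(** The Schur complement of the border is X_st - X_sU D S^-1 X_Ut, which is the entry given by the
    Woodbury identity. *)
Lemma det_lead_border : \det S != 0 ->
  \det (lead ent (k + k + 1)) = \det S * invmx N' s t.
Proof.
move=> dS; have uS : S \in unitmx by rewrite unitmxE unitfE.
have [uN' ->] := inv_update dS.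
pose ct : 'cV[F]_k := \col_i X (g i) t; pose rs : 'rV[F]_k := \row_i X s (g i).
have -> : lead ent (k + k + 1) =
    block_mx (block_mx 1%:M (- D) Xuu 1%:M) (col_mx 0 ct) (row_mx rs 0) (X s t)%:M.
  apply/matrixP => i j; case: (split_ordP i) => i1 ->; case: (split_ordP j) => j1 ->.
  - by rewrite block_mxEul -lead_block !mxE.
  - rewrite block_mxEur mxE /ent /block_entry /= (ord1 j1) addn0.
    have := ltn_ord i1; case: (split_ordP i1) => i2 -> /= i1k; rewrite ?col_mxEu ?col_mxEd /= !mxE.
      by have := ltn_ord i2; do !(case: ifP => //; try lia).
    by rewrite -xtE; have := ltn_ord i2; do !(case: ifP => //; try lia); rewrite addKn.
  - rewrite block_mxEdl mxE /ent /block_entry /= (ord1 i1) addn0.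
    case: (split_ordP j1) => j2 -> /=; rewrite ?row_mxEl ?row_mxEr /= !mxE -?xsE;
      by have := ltn_ord j2; do !(case: ifP => //; try lia).
  rewrite block_mxEdr !mxE /ent /block_entry /= (ord1 i1) (ord1 j1) !addn0.
  by do !(case: ifP => //; try lia).
(* The system for the Schur complement has the solution (D v2, v2): its first block row is v1 - D v2
   = 0, its second Xuu v1 + v2 = [ct], that is S v2 = [ct]. *)
pose v2 := invmx S *m ct.
rewrite (@det_block_solve _ _ _ _ _ (col_mx (D *m v2) v2)); last first.
  rewrite mul_block_col !mul1mx mulNmx subrr; congr col_mx.
  rewrite mulmxA -{2}[v2]mul1mx -mulmxDl addrC -/S /v2 mulmxA mulmxV // mul1mx.
  by [].
congr (_ * _).
  by rewrite -lead_block det_lead_block.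
rewrite det_mx11 mxE [_%:M _ _]mxE eqxx mulr1n [in RHS]mxE; congr (_ + _).
rewrite mul_row_col mul0mx addr0 mxE [in RHS]mxE; congr (- _).
have -> : rs = row s (X *m P).
  apply/rowP => i; rewrite !mxE (bigD1 (g i)) //= big1 ?addr0 ?mxE ?eqxx ?mulr1 //.
  by move=> u /negPf ui; rewrite mxE ui mulr0.
have ctE : ct = col t (P^T *m X).
  apply/colP => i; rewrite !mxE (bigD1 (g i)) //= big1 ?addr0 ?mxE ?eqxx ?mul1r //.
  by move=> u /negPf ui; rewrite !mxE ui mul0r.
have gen (Y : 'M[F]_(n, k)) (B : 'M[F]_k) (Z : 'M[F]_(k, n)) :
    (row s Y *m (B *m col t Z)) 0 0 = (Y *m B *m Z) s t.
  rewrite mulmxA -row_mul [LHS]mxE [RHS]mxE; apply: eq_bigr => j _.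
  by rewrite [row _ _ _ _]mxE [col _ _ _ _]mxE.
by rewrite /v2 ctE [D *m (_ *m _)]mulmxA gen !mulmxA.
Qed.
End Woodbury.

(** * Walk counts as coefficients of the inverse of 1 - xA *)

Section WalkCounts.
Variables (n : nat) (G : digraph n).

Fixpoint walks (d : nat) (s t : 'I_n) : nat :=
  if d is d'.+1 then (\sum_x ((s, x) \in G) * walks d' x t)%N else (s == t).

Lemma walks_path d s t : (0 < walks d s t)%N <-> exists2 p, path_from_to G s t p & size p = d.
Proof.
elim: d s => [|d IH] s /=.
  split=> [|[p /andP[_ lp] sp]].
    by case: eqP => // -> _; exists [::] => //; rewrite /path_from_to /= eqxx.
  by move: lp; rewrite (size0nil sp) /= => ->.
rewrite lt0n sum_nat_eq0 negb_forall; split.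
  move=> /existsP[x]; rewrite ?implyTb muln_eq0 negb_or eqb0 negbK -lt0n => /andP[sx /IH[p pp sp]].
  by exists (x :: p); [move: pp; rewrite /path_from_to /= sx | rewrite /= sp].
move=> [[|x p] //]; rewrite /path_from_to /= => /andP[/andP[sx pp] lp] [sp].
apply/existsP; exists x; rewrite ?implyTb muln_eq0 negb_or eqb0 negbK sx -lt0n /=.
by apply/IH; exists p => //; rewrite /path_from_to pp.
Qed.

Lemma walks_le d s t : (walks d s t <= n ^ d)%N.
Proof.
elim: d s => [|d IH] s /=; first by rewrite expn0; case: eqP.
apply: leq_trans (_ : \sum_(x < n) n ^ d <= _)%N.
  by apply: leq_sum => x _; case: (_ \in G); rewrite ?mul1n ?mul0n.
by rewrite sum_nat_const card_ord expnS.
Qed.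

Definition adj_mx (F : comNzRingType) : 'M[F]_n := \matrix_(u, v) ((u, v) \in G)%:R.
Definition lap_mx (F : comNzRingType) (a : F) : 'M[F]_n := 1%:M - a *: adj_mx F.
Definition lap_poly (F : comNzRingType) : 'M[{poly F}]_n := 1%:M - 'X *: adj_mx {poly F}.

Lemma lap_poly_eval (F : comNzRingType) (a : F) : map_mx (horner_eval a) (lap_poly F) = lap_mx a.
Proof.
apply/matrixP => i j; rewrite !mxE /= /horner_eval hornerD hornerN hornerM hornerX.
by case: (i == j); case: (_ \in G); rewrite ?mulr1n ?mulr0n ?hornerC ?horner0 ?hornerC.
Qed.

Lemma det_lap_eval (F : comNzRingType) (a : F) : (\det (lap_poly F)).[a] = \det (lap_mx a).
Proof. by rewrite -lap_poly_eval det_map_mx. Qed.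

Lemma adj_lap_eval (F : comNzRingType) (a : F) s t : (\adj (lap_poly F) s t).[a] = \adj (lap_mx a) s t.
Proof. by rewrite -lap_poly_eval -map_mx_adj [RHS]mxE. Qed.

Lemma det_lap0 (F : comNzRingType) : (\det (lap_poly F)).[0] = 1.
Proof. by rewrite det_lap_eval /lap_mx scale0r subr0 det1. Qed.

Lemma size_det_le2 (F : comNzRingType) m (A : 'M[{poly F}]_m) :
  (forall i j, (size (A i j) <= 2)%N) -> (size (\det A) <= m.+1)%N.
Proof.
move=> h; apply: leq_trans (size_sum _ _ _) _; apply/bigmax_leqP => s _.
have -> : size ((-1) ^+ s * \prod_i A i (s i)) = size (\prod_i A i (s i)).
  by rewrite -signr_odd; case: (odd s); rewrite ?expr1 ?expr0 ?mulN1r ?mul1r ?size_polyN.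
apply: leq_trans (size_poly_prod_leq _ _) _.
have : (\sum_(i < m) size (A i (s i)) <= m * 2)%N.
  apply: leq_trans (_ : \sum_(i < m) 2 <= _)%N; last by rewrite sum_nat_const card_ord.
  exact: leq_sum.
by rewrite card_ord; set S := (\sum_(i < m) _)%N; lia.
Qed.

Lemma size_lap_entry (F : comNzRingType) i j : (size (lap_poly F i j) <= 2)%N.
Proof.
rewrite !mxE; apply: leq_trans (size_polyD _ _) _; rewrite geq_max size_polyN.
apply/andP; split; first by case: eqP; rewrite ?size_poly1 ?size_poly0.
by case: (_ \in G); rewrite ?mulr1 ?mulr0 ?size_polyX ?size_poly0.
Qed.

Lemma size_det_lap (F : comNzRingType) : (size (\det (lap_poly F)) <= n.+1)%N.
Proof. by apply: size_det_le2 => i j; exact: size_lap_entry. Qed.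

Lemma size_adj_lap (F : comNzRingType) s t : (size (\adj (lap_poly F) s t) <= n)%N.
Proof.
rewrite mxE /cofactor; have -> : size ((-1) ^+ (t + s) * \det (row' t (col' s (lap_poly F)))) =
   size (\det (row' t (col' s (lap_poly F)))).
  by rewrite -signr_odd; case: (odd _); rewrite ?expr1 ?expr0 ?mulN1r ?mul1r ?size_polyN.
have n0 : (0 < n)%N by exact: leq_ltn_trans (ltn_ord s).
apply: leq_trans (size_det_le2 _) _; last by rewrite prednK.
by move=> i j; rewrite !mxE; have := size_lap_entry F (lift t i) (lift s j); rewrite !mxE.
Qed.

Definition walk_mx (F : comNzRingType) d : 'M[F]_n := \matrix_(s, t) (walks d s t)%:R.

Lemma walk_mxS (F : comNzRingType) d : walk_mx F d.+1 = adj_mx F *m walk_mx F d.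
Proof.
by apply/matrixP => s t; rewrite !mxE natr_sum; apply: eq_bigr => x _; rewrite !mxE natrM.
Qed.

Lemma lap_walks (F : comNzRingType) m :
  lap_poly F *m (\sum_(i < m) 'X^i *: walk_mx {poly F} i) = 1%:M - 'X^m *: walk_mx {poly F} m.
Proof.
elim: m => [|m IH].
  rewrite big_ord0 mulmx0 expr0 scale1r; apply/esym/eqP; rewrite subr_eq0; apply/eqP/matrixP => s t.
  by rewrite !mxE.
rewrite big_ord_recr /= mulmxDr IH mulmxBl mul1mx -scalemxAl -scalemxAr -walk_mxS scalerA -exprS.
by rewrite addrA subrK.
Qed.

(** Modulo x^(d+1) the adjugate is the determinant times the generating series of walks. When the
    first nonzero count is at index d, only the constant terms of R and of the determinant, both 1,
    influence coefficient d. *)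
Lemma first_coef_walks (F : idomainType) (R : {poly F}) s t d : R.[0] = 1 ->
  (forall i, (i < d)%N -> walks i s t = 0%N) ->
  (R * \adj (lap_poly F) s t)`_d = (walks d s t)%:R.
Proof.
move=> R0 h; set W := \sum_(i < d.+1) 'X^i *: walk_mx {poly F} i.
have e : \det (lap_poly F) *: W = \adj (lap_poly F) - 'X^(d.+1) *: (\adj (lap_poly F) *m walk_mx _ d.+1).
  transitivity (\adj (lap_poly F) *m (lap_poly F *m W)).
    by rewrite mulmxA mul_adj_mx mul_scalar_mx.
  by rewrite lap_walks mulmxBr mulmx1 -scalemxAr.
have : \adj (lap_poly F) s t = \det (lap_poly F) * W s t +
    'X^(d.+1) * (\adj (lap_poly F) *m walk_mx _ d.+1) s t.
  by have /matrixP/(_ s t) := e; rewrite !mxE => ->; rewrite subrK.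
have -> : W s t = 'X^d * (walks d s t)%:R.
  rewrite /W summxE big_ord_recr /= big1 ?add0r; first by rewrite !mxE.
  by move=> i _; rewrite !mxE h // mulr0.
move=> ->; rewrite mulrDr coefD [X in _ + X](_ : _ = 0) ?addr0; last first.
  by rewrite mulrCA coefXnM ltnSn.
have -> : R * (\det (lap_poly F) * ('X^d * (walks d s t)%:R)) =
   (R * \det (lap_poly F) * (walks d s t)%:R) * 'X^d by ring.
rewrite coefMXn ltnn subnn -horner_coef0 !hornerM R0 det_lap0 hornerMn hornerC.
by rewrite !mul1r.
Qed.
End WalkCounts.

Local Close Scope ring_scope.

(** * Small determinants modulo small primes *)

Definition digit (q x i : nat) : nat := x %/ q ^ i %% q.

Lemma digit_code q (d : seq nat) i : all (gtn q) d -> digit q (digits_val q d) i = nth 0 d i.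
Proof.
rewrite /digit; elim: d i => [|x d IH] i /=; first by rewrite div0n mod0n nth_nil.
move=> /andP[xq ad]; have q0 : 0 < q by lia.
case: i => [|i] /=; first by rewrite expn0 divn1 addnC mulnC modnMDl modn_small.
by rewrite expnS divnMA addnC (mulnC q) divnMDl // (divn_small xq) addn0 IH.
Qed.

Lemma natr_Fp_eq p x y : prime p -> (x%:R = y%:R :> 'F_p)%R <-> x = y %[mod p].
Proof.
move=> pr; split=> [/(congr1 val) /=|h].
  by rewrite !val_Fp_nat.
by apply: val_inj; rewrite /= !val_Fp_nat.
Qed.

Lemma val_Fp_lt p (x : 'F_p) : prime p -> x < p.
Proof. by move=> pr; have := ltn_ord x; move: (nat_of_ord x) => y; rewrite Fp_cast. Qed.

Lemma natr_val_Fp p (x : 'F_p) : ((val x)%:R = x :> 'F_p)%R.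
Proof. exact: natr_Zp. Qed.

Section DetQ.
Variables (N d : nat) (XP : nat -> nat -> nat -> Prop) (PW : nat -> nat -> nat -> nat -> Prop).

Definition dig_rel (q x i v : nat) : Prop :=
  exists2 w, w < N & XP q i w /\ exists2 u, u < N & x %/ w = u /\ u %% q = v.

(** The vector is the number x, read in base q. Its coordinates are residues modulo a
    polylogarithmic q, which is why all of them fit into one number. Row r of the system is a sum
    modulo q, with z added on the diagonal. *)
Definition solves (C : nat -> nat -> nat -> Prop) (q z i x : nat) : Prop :=
  forall r, r < N -> r <= i -> exists2 t, t < N & ((r = i /\ t = 1) \/ (r <> i /\ t = 0)) /\
    sum_mod N d (fun j v => exists2 c, c < N & exists2 y, y < N & C r j c /\ dig_rel q x j y /\
       ((r = j /\ v = (c + z) * y) \/ (r <> j /\ v = c * y))) (i + 1) q t.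

(** A state i*q + v carries the i-th leading minor v modulo q. The solution x certifies the next
    minor w through w * y = v, where y is its last coordinate. *)
Definition det_step (C : nat -> nat -> nat -> Prop) (K q z a b : nat) : Prop :=
  exists2 i, i < N & exists2 v, v < N & exists2 w, w < N &
    (v < q /\ w < q) /\ i < K /\ a = i * q + v /\ b = (i + 1) * q + w /\
    exists2 x, x < N & exists2 y, y < N & solves C q z i x /\ dig_rel q x i y /\
      ~ y = 0 /\ (w * y) %% q = v.

Definition minor_rel (C : nat -> nat -> nat -> Prop) (K q z v : nat) : Prop :=
  v < q /\ nchain N d (det_step C K q z) 1 (K * q + v).

(** If a leading minor vanishes, the walk of minors may not exist. Hence the code h of the
    polynomial det(c + z) in z is guessed, and compared with the minors only at those z where a walk
    exists; its constant term is the determinant. *)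
Definition det_rel (C : nat -> nat -> nat -> Prop) (K q v : nat) : Prop :=
  exists2 h, h < N & dig_rel q h 0 v /\ forall z, z < N -> z < q -> forall w, w < N ->
    minor_rel C K q z w ->
    sum_mod N d (fun i u => exists2 a, a < N & exists2 b, b < N &
       dig_rel q h i a /\ PW q z i b /\ u = a * b) (K + 1) q w.

(** Powers are read from auxiliary relations. Entries must be correct whenever present, but presence
    is required only for exponents below n. *)
Definition tables_ok (n : nat) : Prop :=
  (forall a j v, XP a j v -> v = a ^ j) /\
  (forall a j, a < N -> j < n -> a ^ j < N -> XP a j (a ^ j)) /\
  (forall p a j v, PW p a j v -> v = a ^ j %% p) /\
  (forall p a j, 0 < p -> p < N -> a < N -> j < n -> PW p a j (a ^ j %% p)).

Variables (n B K q : nat) (C : nat -> nat -> nat -> Prop) (c : nat -> nat -> nat).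
Hypothesis tok : tables_ok n.
Hypothesis cp : chain_params N d B.
Hypothesis pq : prime q.
Hypothesis Kq : K.+2 * K.+1 <= q.
Hypothesis qB : K.+2 * q <= B.
Hypothesis qN : q ^ K.+2 <= N.
Hypothesis Kn : K.+2 <= n.
Hypothesis CE : forall i j v, i < K -> j < K -> v < N -> (C i j v <-> v = c i j).
Hypothesis cq : forall i j, i < K -> j < K -> c i j < q.

Let q1 : 1 < q := prime_gt1 pq.
Let BN : B < N := chain_params_le cp.

Lemma qlt : q < N. Proof. by nia. Qed.

Lemma qjN j : j <= K.+1 -> q ^ j < N.
Proof. by move=> jK; apply: leq_trans qN; rewrite ltn_exp2l. Qed.

Lemma dig_relP x i v : i <= K -> x < N -> (dig_rel q x i v <-> v = digit q x i).
Proof.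
move=> iK xN; have [X1 [X2 _]] := tok; split.
  by move=> [w _ [/X1 -> [u _ [<- <-]]]].
move=> ->; exists (q ^ i); first by apply: qjN; lia.
split; first by apply: X2; [exact: qlt|lia|apply: qjN; lia].
exists (x %/ q ^ i) => //; exact: leq_ltn_trans (leq_div _ _) xN.
Qed.

Definition shifted (z r s : nat) : 'F_q := ((c r s)%:R + (r == s)%:R * z%:R)%R.

Lemma solvesP z i x : z < q -> i < K -> x < N -> solves C q z i x <->
  forall r, r <= i -> (\sum_(j < i.+1) shifted z r j * (digit q x j)%:R = (r == i)%:R)%R.
Proof.
move=> zq iK xN.
pose g r j := (c r j + (r == j) * z) * digit q x j.
have gE r : ((\sum_(j < i.+1) g r j)%:R = \sum_(j < i.+1) shifted z r j * (digit q x j)%:R :> 'F_q)%R.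
  by rewrite natr_sum; apply: eq_bigr => j _; rewrite /g /shifted natrM natrD natrM.
have dlt j : digit q x j < q by rewrite ltn_pmod // prime_gt0.
have q3 : q ^ 3 <= N by apply: leq_trans qN; rewrite leq_exp2l //; lia.
have gN r j : r <= i -> j < i.+1 -> g r j < N.
  move=> ri ji; apply: leq_trans q3; rewrite /g.
  have h1 := @cq r j; have h2 := dlt j; rewrite !expnS expn0 muln1.
  have : c r j + (r == j) * z < q * 2 by move: (h1 ltac:(lia) ltac:(lia)); case: eqP; lia.
  by move: h2 q1; clear; nia.
set G := fun r j v => exists2 c0, c0 < N & exists2 y, y < N & C r j c0 /\ dig_rel q x j y /\
       ((r = j /\ v = (c0 + z) * y) \/ (r <> j /\ v = c0 * y)).
have GE r j v : r <= i -> j < i.+1 -> G r j v <-> v = g r j.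
  move=> ri ji; have cN : c r j < N by apply: ltn_trans (qlt); apply: cq; lia.
  have CE' u : u < N -> (C r j u <-> u = c r j) by apply: CE; lia.
  have DE u := dig_relP u (ltac:(lia) : j <= K) xN.
  rewrite /g; split.
    move=> [c0 c0N [y yN [/(CE' _ c0N) -> [/DE -> [[-> ->]|[/eqP/negPf-> ->]]]]]].
      by rewrite eqxx mul1n.
    by rewrite mul0n addn0.
  move=> ->; exists (c r j) => //; exists (digit q x j); first exact: ltn_trans (dlt j) qlt.
  split; first exact/CE'.
  split; first exact/DE.
  by case: eqP => [->|h]; [left; rewrite mul1n|right; rewrite mul0n addn0].
split=> [h r ri|h r rN ri].
  have [t _ [tE]] := h r (ltac:(nia) : r < N) ri; rewrite addn1 => sm.
  have := sum_mod_sound (g := g r) _ sm; rewrite -gE => tS.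
  have -> : ((r == i)%:R = t%:R :> 'F_q)%R.
    by case: tE => [[-> ->]|[/eqP/negPf -> ->]]; rewrite ?eqxx.
  apply/natr_Fp_eq => //; rewrite -[LHS]modn_mod -tS //.
  by move=> j v ji vN /(GE _ _ _ ri ji).
exists (nat_of_bool (r == i)); first by have := qlt; case: eqP; lia.
split; first by case: eqP; [left|right].
have := sum_mod_complete (G := G r) (J := i.+1) (g := g r) cp (prime_gt0 pq) _ _.
have -> : (\sum_(j < i.+1) g r j) %% q = (r == i).
  rewrite -[RHS](@modn_small _ q); last by case: eqP; lia.
  by apply/natr_Fp_eq => //; rewrite gE h.
rewrite addn1; apply; first by nia.
by move=> j ji; split; [exact: gN | apply/GE].
Qed.

Lemma minor_sound z v : z < q -> minor_rel C K q z v ->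
  (v%:R = \det (lead (shifted z) K) :> 'F_q)%R.
Proof.
move=> zq [vq ch].
pose Inv a := forall i u, u < q -> i <= K -> a = i * q + u ->
  (u%:R = \det (lead (shifted z) i) :> 'F_q)%R.
suff H : Inv (K * q + v) by exact: H.
apply: (nchain_inv (Inv := Inv) _ ch).
  move=> a b [i iN [u uN [w wN [[uq wq] [iK [-> [-> h]]]]]]] Ia j t tq jK.
  case/divmod_inj => //; rewrite addn1 => <- <-.
  case: h => x xN [y yN [/(solvesP zq iK xN) sv [/(dig_relP _ (ltnW iK) xN) yE [y0 wy]]]].
  have pv := @pivot_det _ (shifted z) (fun j => (digit q x j)%:R)%R i sv.
  have yF : (y%:R != 0 :> 'F_q)%R.
    apply/eqP => /(natr_Fp_eq y 0 pq); rewrite mod0n modn_small //.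
    by rewrite yE /digit ltn_pmod // ltnW.
  apply: (mulIf yF); rewrite {2}yE pv -(Ia i u uq (ltnW iK) erefl) -natrM.
  by apply/natr_Fp_eq => //; rewrite wy modn_small.
move=> i u uq _ h; have := @divmod_inj q 0 1 i u q1 uq; rewrite mul0n add0n => /(_ h)[<- <-].
by rewrite det_mx00.
Qed.

Definition code (x : nat -> 'F_q) (m : nat) : nat := digits_val q [seq val (x i) | i <- iota 0 m].

Lemma code_all (x : nat -> 'F_q) m : all (gtn q) [seq val (x i) | i <- iota 0 m].
Proof. by apply/allP => y /mapP[i _ ->] /=; exact: val_Fp_lt. Qed.

Lemma code_lt x m : m <= K.+1 -> code x m < N.
Proof.
move=> mK; apply: leq_ltn_trans (_ : q ^ m < N); last exact: qjN.
by have := digits_val_lt (code_all x m); rewrite size_map size_iota => /ltnW.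
Qed.

Lemma digit_of_code x m i : i < m -> digit q (code x m) i = val (x i).
Proof.
move=> im; rewrite /code digit_code ?code_all // (nth_map 0) ?size_iota // nth_iota //.
Qed.

Lemma minor_complete z : z < q -> (forall i, i <= K -> (\det (lead (shifted z) i) != 0)%R) ->
  minor_rel C K q z (val (\det (lead (shifted z) K))%R).
Proof.
move=> zq h; split; first exact: val_Fp_lt.
pose f i := i * q + val (\det (lead (shifted z) i))%R.
have f0 : f 0 = 1.
  rewrite /f det_mx00 mul0n add0n /=; have := val_Fp_nat pq 1; rewrite modn_small //.
have lt i : val (\det (lead (shifted z) i))%R < q by exact: val_Fp_lt.
rewrite -f0; apply: (nchain_complete (f := f) cp).
- by nia.
- by move=> i iK; rewrite /f; have := lt i; nia.
move=> i iK; have qN' := qlt.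
have [x xP] := pivot_exists (h i.+1 iK).
have pv := pivot_det xP.
exists i; first by nia.
exists (val (\det (lead (shifted z) i))%R); first exact: ltn_trans (lt _) qN'.
exists (val (\det (lead (shifted z) i.+1))%R); first exact: ltn_trans (lt _) qN'.
split=> //; split=> //; split=> //; split; first by rewrite /f addn1.
have cN : code x i.+1 < N by apply: code_lt; lia.
exists (code x i.+1) => //.
have yE : digit q (code x i.+1) i = val (x i) by exact: digit_of_code.
exists (val (x i)); first exact: ltn_trans (val_Fp_lt _ pq) qN'.
split.
  apply/solvesP => // r ri; rewrite -(xP r ri); apply: eq_bigr => j _.
  by rewrite digit_of_code // natr_val_Fp.
split; first by apply/dig_relP => //; lia.
split.
  move=> x0; have : x i = 0%R by rewrite -[x i]natr_val_Fp x0.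
  move=> xi0; have := h i (ltnW iK); rewrite -pv xi0 mulr0 eqxx.
  by [].
rewrite -[RHS](@modn_small _ q) //; apply/natr_Fp_eq => //.
by rewrite natrM !natr_val_Fp.
Qed.

Lemma det_relP v : det_rel C K q v <-> v = val (\det (lead (fun i j => (c i j)%:R : 'F_q) K))%R.
Proof.
set hp := char_poly (- lead (fun i j => (c i j)%:R : 'F_q) K)%R.
have hpE z : (hp.[z%:R] = \det (lead (shifted z) K))%R by rewrite -det_shift.
have hp0 : (hp`_0 = \det (lead (fun i j => (c i j)%:R : 'F_q) K))%R.
  rewrite -horner_coef0 -[0%R]/(0%:R)%R hpE; congr (\det _)%R.
  by apply/matrixP => i j; rewrite !mxE /shifted mulr0 addr0.
have szh : size hp = K.+1 by rewrite size_char_poly.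
have [_ [_ [P1 P2]]] := tok.
have qN' := qlt.
have evalE hh (a : nat) : hh < N -> a < q ->
   ((\sum_(i < K.+1) digit q hh i * (a ^ i %% q))%:R =
    (\poly_(i < K.+1) (digit q hh i)%:R).[a%:R] :> 'F_q)%R.
  move=> hN aq; rewrite horner_poly natr_sum; apply: eq_bigr => i _.
  by rewrite natrM Fp_nat_mod // natrX.
have GE hh z i u : hh < N -> z < q -> i < K + 1 ->
   (exists2 a, a < N & exists2 b, b < N & dig_rel q hh i a /\ PW q z i b /\ u = a * b) <->
   u = digit q hh i * (z ^ i %% q).
  move=> hN zq iK; have DE a := dig_relP a (ltac:(lia) : i <= K) hN; split.
    by move=> [a _ [b _ [/DE -> [/P1 -> ->]]]].
  move=> ->; exists (digit q hh i); first by apply: ltn_trans qN'; rewrite ltn_pmod // ltnW.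
  exists (z ^ i %% q); first by apply: ltn_trans qN'; rewrite ltn_pmod // ltnW.
  by split; [exact/DE | split=> //; apply: P2; lia].
split.
  move=> [hh hN [/(dig_relP _ (leq0n K) hN) -> H]].
  (* The guess is forced: it agrees with the characteristic polynomial wherever no leading minor
     vanishes, and these points determine a polynomial of degree at most K. *)
  have : (\poly_(i < K.+1) (digit q hh i)%:R : {poly 'F_q})%R = hp.
    apply: (@eq_poly_off_minors _ (fun i j => (c i j)%:R)%R K); [exact: size_poly|by rewrite szh|by rewrite card_Fp|].
    move=> z hz; have zq := val_Fp_lt z pq; have zE : ((val z)%:R = z)%R by exact: natr_val_Fp.
    have mc := minor_complete zq _; rewrite -zE in hz *.
    have sm := H _ (ltn_trans zq qN') zq _ (ltn_trans (val_Fp_lt _ pq) qN') (mc hz).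
    rewrite -evalE // hpE -[RHS]natr_val_Fp; apply/natr_Fp_eq => //.
    rewrite -[LHS]modn_mod.
    have := sum_mod_sound (g := fun i => digit q hh i * (val z ^ i %% q)) _ sm; rewrite addn1 => <- //.
    by move=> i u iK _ /(GE _ _ _ _ hN zq); apply; lia.
  move=> e; have := congr1 (fun p : {poly 'F_q} => p`_0)%R e; rewrite hp0 coef_poly /= => <-.
  by rewrite val_Fp_nat // modn_small // ltn_pmod // ltnW.
move=> ->; pose hh := code (fun i => hp`_i)%R K.+1.
have hN : hh < N by exact: code_lt.
have dE i : i < K.+1 -> digit q hh i = val (hp`_i)%R by move=> iK; exact: digit_of_code.
exists hh => //; split; first by apply/dig_relP => //; rewrite dE // hp0.
move=> z _ zq w wN mw; have wE := minor_sound zq mw; have wq := mw.1.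
have -> : w = (\sum_(i < K + 1) digit q hh i * (z ^ i %% q)) %% q.
  rewrite -[LHS](@modn_small _ q) //; apply/natr_Fp_eq => //; rewrite addn1 evalE // wE -hpE.
  congr (_.[_])%R; apply/polyP => i; rewrite coef_poly; case: ltnP => iK.
    by rewrite dE // natr_val_Fp.
  by rewrite nth_default // szh.
apply: (sum_mod_complete (g := fun i => digit q hh i * (z ^ i %% q)) cp) => //; [exact: ltnW|by rewrite addn1|].
move=> j jK; split; last by apply/GE.
have q2 : q * q <= N by rewrite mulnn; apply: leq_trans qN; rewrite leq_exp2l.
by apply: leq_trans q2; apply: ltn_mul; rewrite ltn_pmod // ltnW.
Qed.
End DetQ.

(** * Small determinants modulo large primes *)

Lemma intr_Fp_eq p (z : int) (x : nat) : prime p ->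
  (z%:~R = x%:R :> 'F_p)%R -> forall y : nat, (z + Posz y)%R = Posz (absz (z + Posz y)%R) ->
  absz (z + Posz y)%R = x + y %[mod p].
Proof.
move=> pr zx y h; apply/(natr_Fp_eq _ _ pr); rewrite natrD -zx.
by rewrite -[LHS]/((Posz (absz (z + Posz y)%R))%:~R)%R -h rmorphD.
Qed.

Section DetP.
Variables (N d : nat) (XP : nat -> nat -> nat -> Prop) (PW : nat -> nat -> nat -> nat -> Prop).

Definition bit_eval (nb q a M v : nat) : Prop :=
  sum_mod N d (fun u w => exists2 t, t < N & exists2 b, b < N & exists2 x, x < N &
     XP 2 u t /\ PW q a u b /\ M %/ t = x /\ ((x %% 2 = 1 /\ w = b) \/ (x %% 2 = 0 /\ w = 0))) nb q v.

Definition eval_entry (E : nat -> nat -> nat -> Prop) (nb q a i j v : nat) : Prop :=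
  exists2 M, M < N & E i j M /\ bit_eval nb q a M v.

(** Interpolation modulo q: v is minus the sum s of D(a) / a^j over 0 < a < q, with the quotient w
    expressed by w * a^j = D. Sums start at index 0, so a = a' + 1. *)
Definition coef_rel (E : nat -> nat -> nat -> Prop) (K nb q j v : nat) : Prop :=
  v < q /\ exists2 l, l < N & l + 1 = q /\ exists2 s, s < N & (v + s) %% q = 0 /\
    sum_mod N d (fun a' w => w < q /\ exists2 a, a < N & a = a' + 1 /\ exists2 D, D < N &
       exists2 b, b < N & det_rel N d XP PW (eval_entry E nb q a) K q D /\ PW q a j b /\ (w * b) %% q = D) l q s.

(** Coefficients of the integer determinant may be negative; the offset [off] exceeds their absolute
    values and makes X a natural number. The primes in (J, J^2] determine it. *)
Definition lift_rel (E : nat -> nat -> nat -> Prop) (K nb J off j X : nat) : Prop :=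
  forall q, q < N -> prime q -> J < q -> q <= J * J -> forall v, v < N ->
    coef_rel E K nb q j v -> X = v + off %[mod q].

(** The bit polynomial is evaluated at 2 modulo p. Since l = p - 1 is -1 modulo p, adding l * off
    removes the offset. *)
Definition detp_rel (E : nat -> nat -> nat -> Prop) (K nb J off p V : nat) : Prop :=
  V < p /\ exists2 Y, Y < N & Y %% p = V /\
    big_sum N d (fun j w => exists2 X, X < N & exists2 b, b < N & exists2 l, l < N &
      l + 1 = p /\ lift_rel E K nb J off j X /\ PW p 2 j b /\ ((X + l * off) * b) %% p = w) J Y.

Variables (n B y K nb J off p : nat) (E : nat -> nat -> nat -> Prop) (e : nat -> nat -> nat).
Hypothesis tok : tables_ok N XP PW n.
Hypothesis sp : sum_params N d B y.
Hypothesis J32 : 32 <= J.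
Hypothesis NJ : N <= 2 ^ J.
Hypothesis Jn : J <= n.
Hypothesis JB : J ^ 5 <= B.
Hypothesis JyB : J.+1 * y ^ 2 <= B.
Hypothesis JN : (J ^ 2) ^ K.+2 <= N.
Hypothesis KJ : K.+2 * K.+2 <= J.
Hypothesis KnbJ : K * nb + 2 <= J.
Hypothesis nbJ : nb.+2 <= J.
Hypothesis nb2 : 2 ^ nb < N * 2.
Hypothesis offE : K`! * nb ^ K < off.
Hypothesis offN : 2 * off < N.
Hypothesis pp : prime p.
Hypothesis pN : J * p < N.
Hypothesis p2 : p <= 2 ^ nb.
Hypothesis EE : forall i j v, i < K -> j < K -> v < N -> (E i j v <-> v = e i j).
Hypothesis ep : forall i j, i < K -> j < K -> e i j < p.

Let cp : chain_params N d B. Proof. by case: sp. Qed.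
Let BN : B < N := chain_params_le cp.
Let D := bit_det nb K e.

Let J2N : J * J < N.
Proof. by apply: leq_ltn_trans BN; apply: leq_trans JB; rewrite mulnn leq_exp2l // (leq_trans _ J32). Qed.

Let KJ' : K.+2 <= J. Proof. by apply: leq_trans KJ; rewrite leq_pmulr. Qed.

Let pltN : p < N.
Proof. by apply: leq_ltn_trans pN; rewrite leq_pmull // (leq_trans _ J32). Qed.

Section FixQ.
Variable q : nat.
Hypothesis pq : prime q.
Hypothesis Jq : J < q.
Hypothesis qJ : q <= J * J.

Let q0 : 0 < q := prime_gt0 pq.
Let qN : q < N. Proof. by move: J2N; lia. Qed.
Let qB : q * q <= B.
Proof.
apply: leq_trans JB; apply: leq_trans (leq_mul qJ qJ) _.
by rewrite !mulnn -expnM leq_exp2l // (leq_trans _ J32).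
Qed.

Definition ev (a i j : nat) : nat := (\sum_(u < nb) bit (e i j) u * (a ^ u %% q)) %% q.

Lemma eval_entryP a i j v : a < q -> i < K -> j < K -> v < N ->
  (eval_entry E nb q a i j v <-> v = ev a i j).
Proof.
move=> aq iK jK vN; have [X1 [X2 [P1 P2]]] := tok.
pose g u := bit (e i j) u * (a ^ u %% q).
have eN : e i j < N by apply: ltn_trans pltN; apply: ep.
have lt u : a ^ u %% q < q by rewrite ltn_pmod.
have gN u : g u < N by rewrite /g /bit; have := lt u; have := ltn_pmod (e i j %/ 2 ^ u) (ltn0Sn 1); move: qN; clear; case: (_ %% 2) => [|[|//]]; lia.
have tN u : u < nb -> 2 ^ u < N.
  by move=> un; have : 2 ^ u * 2 <= 2 ^ nb; [rewrite -expnSr leq_exp2l | lia].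
have GE M u w : M < N -> u < nb -> w < N ->
  (exists2 t, t < N & exists2 b, b < N & exists2 x, x < N &
     XP 2 u t /\ PW q a u b /\ M %/ t = x /\ ((x %% 2 = 1 /\ w = b) \/ (x %% 2 = 0 /\ w = 0))) <->
  w = bit M u * (a ^ u %% q).
  move=> MN un wN; split.
    move=> [t _ [b _ [x _ [/X1 -> [/P1 -> [<- ]]]]]]; rewrite /bit.
    by move=> [[-> ->]|[-> ->]]; rewrite ?mul1n ?mul0n.
  move=> wE; exists (2 ^ u); first exact: tN.
  exists (a ^ u %% q); first exact: ltn_trans (lt u) qN.
  exists (M %/ 2 ^ u); first exact: leq_ltn_trans (leq_div _ _) MN.
  split; first by apply: X2; [lia|lia|exact: tN].
  split; first by apply: P2; lia.
  split=> //; move: wE; rewrite /bit; have := ltn_pmod (M %/ 2 ^ u) (ltn0Sn 1).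
  by case: (_ %% 2) => [|[|//]] _ ->; [right|left]; rewrite ?mul1n ?mul0n.
split.
  move=> [M MN [/(EE iK jK MN) -> be]]; apply: (sum_mod_sound (g := g) _ be).
  by move=> u w un wN /(GE _ _ _ eN un wN).
move=> ->; exists (e i j) => //; split; first exact/EE.
apply: (sum_mod_complete (g := g) cp) => //; first by apply: leq_trans qB; rewrite leq_mul2r; lia.
by move=> u un; split=> //; apply/GE.
Qed.

Let Dq : {poly 'F_q} := map_poly intr D.

Lemma det_evalP a v : a < q ->
  (det_rel N d XP PW (eval_entry E nb q a) K q v <-> v = val (Dq.[a%:R])%R).
Proof.
move=> aq; have evq i j : ev a i j < q by rewrite ltn_pmod.
have -> : (Dq.[a%:R])%R = (\det (lead (fun i j => (ev a i j)%:R : 'F_q) K))%R.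
  rewrite /Dq /D bit_det_mod; congr (\det _)%R; apply/matrixP => i j; rewrite !mxE.
  rewrite Fp_nat_mod // natr_sum; apply: eq_bigr => u _.
  by rewrite natrM Fp_nat_mod // natrX.
apply: (det_relP tok cp pq).
- by apply: leq_trans (ltnW Jq); apply: leq_trans KJ; rewrite leq_mul2l; lia.
- by apply: leq_trans qB; rewrite leq_mul2r; apply/orP; right; apply: leq_trans KJ' (ltnW Jq).
- by apply: leq_trans JN; apply: leq_expl; rewrite -mulnn.
- exact: leq_trans KJ' Jn.
- by move=> i j w iK jK wN; apply: eval_entryP.
- by [].
Qed.

Lemma coef_relP j v : j < J -> v < N -> (coef_rel E K nb q j v <-> v = val (Dq`_j)%R).
Proof.
move=> jJ vN; have [X1 [X2 [P1 P2]]] := tok.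
pose g a' : nat := val (Dq.[(a'.+1)%:R] / (a'.+1)%:R ^+ j)%R.
have gq a' : g a' < q by exact: val_Fp_lt.
have aF a' : a' < q.-1 -> ((a'.+1)%:R != 0 :> 'F_q)%R.
  move=> aq; apply/eqP => /(natr_Fp_eq a'.+1 0 pq); rewrite mod0n modn_small //; lia.
have GE a' w : a' < q.-1 -> w < N ->
   (w < q /\ exists2 a, a < N & a = a' + 1 /\ exists2 D, D < N &
       exists2 b, b < N & det_rel N d XP PW (eval_entry E nb q a) K q D /\ PW q a j b /\ (w * b) %% q = D)
   <-> w = g a'.
  move=> aq wN; have a1q : a'.+1 < q by lia.
  have wE w' : w' < q -> ((w' * (a'.+1 ^ j %% q)) %% q = val (Dq.[(a'.+1)%:R])%R <-> w' = g a').
    move=> wq; split=> [h|->].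
      rewrite -[w'](@modn_small _ q) // -[RHS](@modn_small _ q) //; apply/natr_Fp_eq => //.
      rewrite natr_val_Fp; apply: (mulIf (expf_neq0 j (aF _ aq))).
      rewrite divfK ?expf_neq0 ?aF // -natrX -natrM -[RHS]natr_val_Fp -h.
      by apply/natr_Fp_eq => //; rewrite modn_mod modnMmr.
    rewrite -[RHS](@modn_small _ q) ?val_Fp_lt //; apply/natr_Fp_eq => //.
    by rewrite natr_val_Fp natrM Fp_nat_mod // natrX natr_val_Fp divfK // expf_neq0 ?aF.
  split.
    move=> [wq [a _ [-> [D' _ [b _ [dr [/P1 -> h]]]]]]]; rewrite addn1 in dr h.
    by apply/(wE _ wq); rewrite h; move/(det_evalP _ a1q): dr.
  move=> wg; split; first by rewrite wg.
  exists (a'.+1); first by move: qN; lia.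
  split; first by rewrite addn1.
  exists (val (Dq.[(a'.+1)%:R])%R); first exact: ltn_trans (val_Fp_lt _ pq) qN.
  exists (a'.+1 ^ j %% q); first by apply: ltn_trans qN; rewrite ltn_pmod.
  split; first exact/det_evalP.
  split; first by apply: P2; lia.
  by apply/wE => //; rewrite wg.
have szD : size Dq <= #|'F_q|.-1.
  rewrite card_Fp //; apply: leq_trans (size_poly _ _) _; apply: leq_trans (size_bit_det _ _ _) _.
  lia.
have co : (Dq`_j = - (\sum_(a' < q.-1) g a')%:R)%R.
  rewrite (@poly_coef_sum _ Dq j) //; last by rewrite card_Fp //; lia.
    rewrite sum_Fp // natr_sum; congr (- _)%R; apply: eq_bigr => a' _.
    by rewrite natr_val_Fp.
  by rewrite card_Fp // pchar_Fp_0.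
have vE s : s = (\sum_(a' < q.-1) g a') %% q -> v < q -> (v + s) %% q = 0 <-> v = val (Dq`_j)%R.
  move=> -> vq; rewrite modnDmr; split=> h.
    rewrite -[v](@modn_small _ q) // -[RHS](@modn_small _ q) ?val_Fp_lt //; apply/natr_Fp_eq => //.
    rewrite natr_val_Fp co; apply/eqP; rewrite -addr_eq0 -natrD; apply/eqP.
    by rewrite -[0%R]/(0%:R)%R; apply/natr_Fp_eq => //; rewrite h mod0n.
  rewrite -[RHS](mod0n q); apply/natr_Fp_eq => //; rewrite natrD h natr_val_Fp co.
  by rewrite addNr.
split.
  move=> [vq [l lN [lq [s sN [vs sm]]]]]; have lE : l = q.-1 by lia.
  apply/(vE s) => //; rewrite lE in sm.
  by apply: (sum_mod_sound (g := g) _ sm) => a' w aq wN /(GE _ _ aq wN).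
move=> vE'; have vq : v < q by rewrite vE' val_Fp_lt.
split=> //; exists q.-1; first by lia.
split; first by lia.
exists ((\sum_(a' < q.-1) g a') %% q); first by apply: ltn_trans qN; rewrite ltn_pmod.
split; first exact/vE.
apply: (sum_mod_complete (g := g) cp) => //; first by rewrite prednK.
move=> a' aq; have gN : g a' < N by exact: ltn_trans (gq a') qN.
by split=> //; apply/GE.
Qed.
End FixQ.

Definition lifted (j : nat) : nat := absz (D`_j + Posz off)%R.

Lemma lifted_pos j : (D`_j + Posz off)%R = Posz (lifted j).
Proof. by rewrite /lifted; have := bit_det_coef nb K e j; rewrite -/D; lia. Qed.

Lemma lifted_lt j : lifted j < N.
Proof. by rewrite /lifted; have := bit_det_coef nb K e j; rewrite -/D; lia. Qed.

Lemma lift_relP j X : j < J -> X < N -> (lift_rel E K nb J off j X <-> X = lifted j).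
Proof.
move=> jJ XN.
have vE q : prime q -> lifted j = val ((map_poly intr D : {poly 'F_q})`_j)%R + off %[mod q].
  move=> pq; apply: intr_Fp_eq => //; last exact: lifted_pos.
  by rewrite natr_val_Fp coef_map.
split=> [h|-> q qN pq Jq qJ v vN /(coef_relP pq Jq qJ jJ vN) ->]; last exact: vE.
apply: (@eq_of_congruent_primes (primes_in J (J ^ 2))).
- exact: primes_in_uniq.
- by apply/allP => q; rewrite mem_primes_in => /and3P[].
- by apply: leq_trans XN (leq_trans NJ _); rewrite leq_exp2l // many_primes.
- by apply: leq_trans (lifted_lt j) (leq_trans NJ _); rewrite leq_exp2l // many_primes.
move=> q; rewrite mem_primes_in -mulnn => /and3P[pq Jq qJ].
have qN : q < N by move: J2N; lia.
have vN : val ((map_poly intr D : {poly 'F_q})`_j)%R < N by exact: ltn_trans (val_Fp_lt _ pq) qN.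
by rewrite vE //; apply: h => //; apply/coef_relP.
Qed.

Lemma detp_relP V : detp_rel E K nb J off p V <->
  V = val (\det (lead (fun i j => (e i j)%:R : 'F_p) K))%R.
Proof.
have [X1 [X2 [P1 P2]]] := tok; have p0 := prime_gt0 pp.
pose g j := ((lifted j + p.-1 * off) * (2 ^ j %% p)) %% p.
have gp j : g j < p by rewrite ltn_pmod.
have gN j : g j < N by exact: ltn_trans (gp j) pltN.
have GE j w : j < J -> w < N -> (exists2 X, X < N & exists2 b, b < N & exists2 l, l < N &
      l + 1 = p /\ lift_rel E K nb J off j X /\ PW p 2 j b /\ ((X + l * off) * b) %% p = w) <-> w = g j.
  move=> jJ wN; split.
    move=> [X XN [b _ [l _ [lp [/(lift_relP jJ XN) -> [/P1 -> <-]]]]]].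
    by have -> : l = p.-1 by lia.
  move=> ->; exists (lifted j); first exact: lifted_lt.
  exists (2 ^ j %% p); first by apply: ltn_trans pltN; rewrite ltn_pmod.
  exists p.-1; first by move: pltN; lia.
  split; first by lia.
  split; first by apply/lift_relP => //; exact: lifted_lt.
  by split=> //; apply: P2; move: pltN; lia.
have Slt : \sum_(j < J) g j < N.
  apply: leq_ltn_trans pN; apply: leq_trans (_ : \sum_(j < J) p <= _).
    by apply: leq_sum => j _; exact: ltnW.
  by rewrite sum_nat_const card_ord.
have BS Y := big_sumP (g := g) Y sp JyB GE (fun j _ => gN j) Slt.
have gF j : ((g j)%:R = (D`_j)%:~R * 2%:R ^+ j :> 'F_p)%R.
  rewrite /g Fp_nat_mod // natrM Fp_nat_mod // natrX; congr (_ * _)%R.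
  rewrite natrD natrM -[((lifted j)%:R)%R]/((Posz (lifted j))%:~R)%R -lifted_pos rmorphD /=.
  have -> : (p.-1%:R = -1 :> 'F_p)%R.
    by apply/eqP; rewrite -subr_eq0 opprK natr1 prednK // pchar_Fp_0.
  by rewrite mulN1r addrK.
have SE : ((\sum_(j < J) g j)%:R = \det (lead (fun i j => (e i j)%:R : 'F_p) K) :> 'F_p)%R.
  rewrite natr_sum; have szD : size D <= J by apply: leq_trans (size_bit_det _ _ _) _; lia.
  have -> : (\sum_(i < J) (g i)%:R = (D.[2])%:~R :> 'F_p)%R.
    rewrite (horner_coef_wide 2%R szD) rmorph_sum; apply: eq_bigr => j _.
    by rewrite gF rmorphM rmorphXn.
  rewrite /D bit_det_at2; last by move=> i j iK jK; apply: leq_trans p2; exact: ep.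
  rewrite -[LHS]/(intr _) -det_map_mx; congr (\det _)%R.
  by apply/matrixP => i j; rewrite !mxE rmorph_nat.
have VE : val (\det (lead (fun i j => (e i j)%:R : 'F_p) K))%R = (\sum_(j < J) g j) %% p.
  by rewrite -SE; exact: val_Fp_nat.
split; first by move=> [_ [Y _ [<- /BS ->]]].
move=> ->; split; first exact: val_Fp_lt.
by exists (\sum_(j < J) g j) => //; split; [rewrite VE | apply/BS].
Qed.
End DetP.

(** * Definability of determinants *)

Section AuxiliaryRelations.
Variables (C : nat).
Notation A := (6 * C).
Implicit Types (M : structure A) (e : seq nat).

(** Five arguments after the tag are what a cell of a copy needs: prime, point a, row, column and
    value. *)
Definition aux6 M (tag x1 x2 x3 x4 x5 : nat) : Prop := auxn C M [:: tag; x1; x2; x3; x4; x5].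

Definition xpow M (a j v : nat) : Prop := aux6 M 1 a j v 0 0.
Definition ppow M (p a j v : nat) : Prop := aux6 M 2 p a j v 0.

Hypothesis C0 : 0 < C.
Variable d : nat.
Hypothesis d0 : 0 < d.

Lemma dfn_aux6 mj k t0 t1 t2 t3 t4 t5 : term C k t0 -> term C k t1 -> term C k t2 ->
  term C k t3 -> term C k t4 -> term C k t5 ->
  dfn C mj k (fun M e => aux6 M (t0 M e) (t1 M e) (t2 M e) (t3 M e) (t4 M e) (t5 M e)).
Proof.
move=> h0 h1 h2 h3 h4 h5.
have h : dfn C mj k (fun M e => exists2 x0, x0 < num C M & exists2 x1, x1 < num C M &
  exists2 x2, x2 < num C M & exists2 x3, x3 < num C M & exists2 x4, x4 < num C M &
  exists2 x5, x5 < num C M & (x0 = t0 M e /\ x1 = t1 M e /\ x2 = t2 M e /\ x3 = t3 M e /\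
  x4 = t4 M e /\ x5 = t5 M e) /\ aux6 M x0 x1 x2 x3 x4 x5).
  do 6!apply: dfn_ex; apply: dfn_and; first by df.
  have := @dfn_auxn_var C A C0 mj k.+4.+2 [:: 5; 4; 3; 2; 1; 0] erefl isT.
  by apply: dfn_ext => M e _ _; rewrite /aux6 /= !nth_behead.
apply: dfn_ext h => M e _ _; split.
  by move=> [x0 _ [x1 _ [x2 _ [x3 _ [x4 _ [x5 _ [[-> [-> [-> [-> [-> ->]]]]] h]]]]]]].
move=> h; have [/= /and5P[a0 a1 a2 a3 /andP[a4 /andP[a5 _]]] _] := h.
exists (t0 M e) => //; exists (t1 M e) => //; exists (t2 M e) => //.
by exists (t3 M e) => //; exists (t4 M e) => //; exists (t5 M e).
Qed.

Lemma dfn_xpow mj k a j v : term C k a -> term C k j -> term C k v ->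
  dfn C mj k (fun M e => xpow M (a M e) (j M e) (v M e)).
Proof. by move=> *; apply: dfn_aux6; df. Qed.

Lemma dfn_ppow mj k p a j v : term C k p -> term C k a -> term C k j -> term C k v ->
  dfn C mj k (fun M e => ppow M (p M e) (a M e) (j M e) (v M e)).
Proof. by move=> *; apply: dfn_aux6; df. Qed.

Ltac df_more ::= first [ df_sums
  | (apply: dfn_xpow => //; df) | (apply: dfn_ppow => //; df) | (apply: dfn_aux6 => //; df) ].

Lemma dfn_dig mj k q x i v : term C k q -> term C k x -> term C k i -> term C k v ->
  dfn C mj k (fun M e => dig_rel (num C M) (xpow M) (q M e) (x M e) (i M e) (v M e)).
Proof. by move=> hq hx hi hv; rewrite /dig_rel; df. Qed.

Ltac df_more ::= first [ df_sums | (apply: dfn_dig => //; df)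
  | (apply: dfn_xpow => //; df) | (apply: dfn_ppow => //; df) | (apply: dfn_aux6 => //; df) ].

Lemma dfn_solves mj k E q z i x :
  dfn C mj k.+3 (fun M e => E M (behead (behead (behead e))) (nth 0 e 0) (nth 0 e 1) (nth 0 e 2)) ->
  term C k q -> term C k z -> term C k i -> term C k x ->
  dfn C mj k (fun M e => solves (num C M) d (xpow M) (E M e) (q M e) (z M e) (i M e) (x M e)).
Proof. by move=> hE hq hz hi hx; rewrite /solves; df. Qed.

Lemma dfn_minor_rel mj k E K q z v :
  dfn C mj k.+3 (fun M e => E M (behead (behead (behead e))) (nth 0 e 0) (nth 0 e 1) (nth 0 e 2)) ->
  term C k K -> term C k q -> term C k z -> term C k v ->
  dfn C mj k (fun M e => minor_rel (num C M) d (xpow M) (E M e) (K M e) (q M e) (z M e) (v M e)).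
Proof.
move=> hE hK hq hz hv; rewrite /minor_rel; apply: dfn_and; first by df.
apply: dfn_nchain => //; try by df.
  by rewrite /det_step; df; apply: dfn_solves => //; df.
by move=> M e _ _ dE; move: d0; rewrite dE.
Qed.

Lemma dfn_det_rel mj k E K q v :
  dfn C mj k.+3 (fun M e => E M (behead (behead (behead e))) (nth 0 e 0) (nth 0 e 1) (nth 0 e 2)) ->
  term C k K -> term C k q -> term C k v ->
  dfn C mj k (fun M e => det_rel (num C M) d (xpow M) (ppow M) (E M e) (K M e) (q M e) (v M e)).
Proof. by move=> hE hK hq hv; rewrite /det_rel; df; apply: dfn_minor_rel => //; df. Qed.

Lemma dfn_eval_entry mj k E nb q a i j v :
  dfn C mj k.+3 (fun M e => E M (behead (behead (behead e))) (nth 0 e 0) (nth 0 e 1) (nth 0 e 2)) ->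
  term C k nb -> term C k q -> term C k a -> bvar k i -> bvar k j -> term C k v ->
  dfn C mj k (fun M e => eval_entry (num C M) d (xpow M) (ppow M) (E M e) (nb M e) (q M e) (a M e) (i e) (j e) (v M e)).
Proof.
move=> hE *; rewrite /eval_entry /bit_eval; apply: dfn_ex; apply: dfn_and; last by df.
by apply: (dfn_rel3 hE); [df|exact: bvarS|exact: bvarS|df].
Qed.

Lemma dfn_coef_rel mj k E K nb q j v :
  dfn C mj k.+3 (fun M e => E M (behead (behead (behead e))) (nth 0 e 0) (nth 0 e 1) (nth 0 e 2)) ->
  term C k K -> term C k nb -> term C k q -> term C k j -> term C k v ->
  dfn C mj k (fun M e => coef_rel (num C M) d (xpow M) (ppow M) (E M e) (K M e) (nb M e) (q M e) (j M e) (v M e)).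
Proof.
move=> hE hK hnb hq hj hv; rewrite /coef_rel; df.
by apply: dfn_det_rel; df; apply: dfn_eval_entry; df.
Qed.

Lemma dfn_detp mj k E K nb J off p V :
  dfn C mj k.+3 (fun M e => E M (behead (behead (behead e))) (nth 0 e 0) (nth 0 e 1) (nth 0 e 2)) ->
  term C k K -> term C k nb -> term C k J -> term C k off -> term C k p -> term C k V ->
  dfn C mj k (fun M e => detp_rel (num C M) d (xpow M) (ppow M) (E M e) (K M e) (nb M e) (J M e) (off M e) (p M e) (V M e)).
Proof.
move=> hE hK hnb hJ hoff hp hV; rewrite /detp_rel /lift_rel; df.
by apply: dfn_coef_rel; df.
Qed.
End AuxiliaryRelations.

(** * The update formula *)

Section CopyUpdate.
Variables (N d n : nat) (XP : nat -> nat -> nat -> Prop) (PW : nat -> nat -> nat -> nat -> Prop).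

Definition log_rel (l : nat) : Prop := exists2 w, w < N & XP 2 l w /\ (w <= n /\ n < w * 2).
(** This is the least nb with N <= 2^nb. The table is consulted at nb - 1, because 2^nb itself is
    not below N. *)
Definition bits_rel (nb : nat) : Prop :=
  exists2 m, m < N & nb = m + 1 /\ exists2 w, w < N & XP 2 m w /\ N <= w * 2.

Variables (H H' : nat -> nat -> Prop).

Definition differ (u w : nat) : Prop := (H' u w /\ ~ H u w) \/ (~ H' u w /\ H u w).
Definition changed (u : nat) : Prop := exists2 w, w < N & differ u w \/ differ w u.
Definition rank_rel (u i : nat) : Prop :=
  changed u /\ card_rel N d (fun v => changed v /\ v < u) i.

Definition delta_rel (i j v : nat) : Prop := (i = j /\ v = 1) \/ (~ i = j /\ v = 0).

(* Entry (i, j) of the block matrix [[1, -D, 0], [X_UU, 1, X_Ut], [X_sU, 0, X_st]], where U is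
   the set of the k changed nodes, ordered by rank, and -D = a * (A' - A) on U. *)
Definition entry_rel (X : nat -> nat -> nat -> Prop) (p a k s t i j v : nat) : Prop :=
  (i < k /\ ((j < k /\ delta_rel i j v) \/
     (k <= j /\ j < k + k /\ exists2 u, u < N & exists2 w, w < N & exists2 m, m < N &
        rank_rel u i /\ rank_rel w m /\ m + k = j /\
        ((H' u w /\ ~ H u w /\ v = a) \/ (~ H' u w /\ H u w /\ v + a = p) \/ (~ differ u w /\ v = 0))) \/
     (k + k <= j /\ v = 0))) \/
  (k <= i /\ i < k + k /\ exists2 m, m < N & m + k = i /\
     ((j < k /\ exists2 u, u < N & exists2 w, w < N & rank_rel u m /\ rank_rel w j /\ X u w v) \/
      (k <= j /\ j < k + k /\ delta_rel i j v) \/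
      (k + k <= j /\ exists2 u, u < N & rank_rel u m /\ X u t v))) \/
  (k + k <= i /\ ((j < k /\ exists2 w, w < N & rank_rel w j /\ X s w v) \/
     (k <= j /\ j < k + k /\ v = 0) \/ (k + k <= j /\ X s t v))).

(* The value cell of a copy is X i j for i, j < n; cell (n, 0) holds the determinant and
   cell (n, 1) the product of the determinants since the last reset. *)
Definition copy_update (c1 : nat) (X : nat -> nat -> nat -> Prop) (p a i j v : nat) : Prop :=
  v < p /\
  ((i = n /\ j = 1 /\ X n 1 0 /\ v = 0) \/
   exists2 k, k < N & card_rel N d changed k /\ exists2 l, l < N & log_rel l /\
   exists2 nb, nb < N & bits_rel nb /\ exists2 D, D < N &
     detp_rel N d XP PW (entry_rel X p a k k k) (k + k) nb (l ^ 5) (n ^ c1) p D /\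
     ((i = n /\ j = 1 /\ exists2 x, x < N & exists2 y, y < N &
         X n 1 x /\ ~ x = 0 /\ X n 0 y /\ (x * (y * D)) %% p = v) \/
      (i = n /\ j = 0 /\ exists2 y, y < N & X n 0 y /\ (y * D) %% p = v) \/
      (i < n /\ j < n /\ exists2 b, b < N &
         detp_rel N d XP PW (entry_rel X p a k i j) (k + k + 1) nb (l ^ 5) (n ^ c1) p b /\
         (v * D) %% p = b))).

End CopyUpdate.

Section Program.
Variables (C d c1 : nat).
Notation A := (6 * C).
Implicit Types (M : structure A) (e : seq nat).

Definition old_edge M u v := aux6 M 0 u v 0 0 0.
Definition graphB M u v := aux6 M 3 u v 0 0 0.
Definition valid M := aux6 M 5 0 0 0 0 0.
Definition cellA M := aux6 M 6.
Definition cellB M := aux6 M 7.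

Definition tables_complete M : Prop :=
  forall p, p < num C M -> 0 < p -> forall a, a < num C M -> forall j, j < num C M -> j < dom M ->
    exists2 v, v < num C M & ppow M p a j v.

(** All auxiliary relations start empty, so even powers have to be tabulated during the run. Adding
    two known exponents doubles the covered range with every change, and about log n changes reach
    all exponents below n. *)
Definition new_xpow M (a j v : nat) : Prop :=
  (j = 0 /\ v = 1) \/ (j = 1 /\ v = a) \/
  exists2 j1, j1 < num C M & exists2 j2, j2 < num C M & exists2 v1, v1 < num C M & exists2 v2, v2 < num C M &
    xpow M a j1 v1 /\ xpow M a j2 v2 /\ j = j1 + j2 /\ v = v1 * v2.

Definition new_ppow M (p a j v : nat) : Prop :=
  0 < p /\ ((j = 0 /\ 1 %% p = v) \/ (j = 1 /\ a %% p = v) \/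
  exists2 j1, j1 < num C M & exists2 j2, j2 < num C M & exists2 v1, v1 < num C M & exists2 v2, v2 < num C M &
    ppow M p a j1 v1 /\ ppow M p a j2 v2 /\ j = j1 + j2 /\ (v1 * v2) %% p = v).

(* Copy B is maintained for a subgraph of the current graph that catches up by one missing edge
   per change. *)
Definition keptB M (u v : nat) : Prop := edge M u v /\ (graphB M u v \/ ~ old_edge M u v).
Definition missing M (u v : nat) : Prop := edge M u v /\ ~ keptB M u v.
Definition least_missing M (u v : nat) : Prop := missing M u v /\
  forall u', u' < num C M -> forall v', v' < num C M -> missing M u' v' -> u < u' \/ (u = u' /\ v <= v').
Definition new_graphB M (u v : nat) : Prop := keptB M u v \/ least_missing M u v.
Definition finished M : Prop :=
  forall u, u < num C M -> forall v, v < num C M -> edge M u v -> new_graphB M u v.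

Definition updB M (p a i j v : nat) : Prop :=
  copy_update (num C M) d (dom M) (xpow M) (ppow M) (graphB M) (new_graphB M) c1 (cellB M p a) p a i j v.

Definition updA M (p a i j v : nat) : Prop :=
  copy_update (num C M) d (dom M) (xpow M) (ppow M) (old_edge M) (edge M) c1 (cellA M p a) p a i j v.

(** The cells for the empty graph: 1 - aA is the identity, and its determinant and the product of
    determinants are 1. *)
Definition init_cell M (i j v : nat) : Prop :=
  (i < dom M /\ j < dom M /\ delta_rel i j v) \/ (i = dom M /\ v = 1).

(** Tags 0 to 3 hold the previous graph, powers, powers modulo p and the graph of copy B; tag 5 is
    the flag that copy A is usable; tags 6 and 7 are the cells of copies A and B. When B has caught
    up, its updated cells become those of A, and B restarts from the empty graph. Until the tables
    are complete, B stays empty. *)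
Definition new_aux M (tag x1 x2 x3 x4 x5 : nat) : Prop :=
  (tag = 0 /\ x3 = 0 /\ x4 = 0 /\ x5 = 0 /\ edge M x1 x2) \/
  (tag = 1 /\ x4 = 0 /\ x5 = 0 /\ new_xpow M x1 x2 x3) \/
  (tag = 2 /\ x5 = 0 /\ new_ppow M x1 x2 x3 x4) \/
  (tag = 3 /\ x3 = 0 /\ x4 = 0 /\ x5 = 0 /\ tables_complete M /\ ~ finished M /\ new_graphB M x1 x2) \/
  (tag = 5 /\ x1 = 0 /\ x2 = 0 /\ x3 = 0 /\ x4 = 0 /\ x5 = 0 /\
     tables_complete M /\ (valid M \/ finished M)) \/
  (tag = 6 /\ tables_complete M /\
     ((finished M /\ updB M x1 x2 x3 x4 x5) \/ (~ finished M /\ updA M x1 x2 x3 x4 x5))) \/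
  (tag = 7 /\
     ((tables_complete M /\ ~ finished M /\ updB M x1 x2 x3 x4 x5) \/
      ((~ tables_complete M \/ finished M) /\ init_cell M x3 x4 x5))).

Hypothesis C0 : 0 < C.
Hypothesis d0 : 0 < d.

Ltac df_more ::= first [ df_sums | (apply: dfn_dig => //; df)
  | (apply: dfn_xpow => //; df) | (apply: dfn_ppow => //; df) | (apply: dfn_aux6 => //; df) ].

Lemma dfn_changed mj k (H H' : structure A -> seq nat -> nat -> nat -> Prop) t :
  dfn C mj k.+2 (fun M e => H M (behead (behead e)) (nth 0 e 0) (nth 0 e 1)) ->
  dfn C mj k.+2 (fun M e => H' M (behead (behead e)) (nth 0 e 0) (nth 0 e 1)) ->
  bvar k t ->
  dfn C mj k (fun M e => changed (num C M) (H M e) (H' M e) (t e)).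
Proof.
move=> hH hH' ht; rewrite /changed /differ; apply: dfn_ex.
have T := bvarS ht.
by do 2!apply: dfn_or; apply: dfn_and; try apply: dfn_not; df_hyp => //; df.
Qed.

Lemma dfn_rank mj k (H H' : structure A -> seq nat -> nat -> nat -> Prop) t i :
  dfn C mj k.+2 (fun M e => H M (behead (behead e)) (nth 0 e 0) (nth 0 e 1)) ->
  dfn C mj k.+2 (fun M e => H' M (behead (behead e)) (nth 0 e 0) (nth 0 e 1)) ->
  bvar k t -> bvar k i ->
  dfn C mj k (fun M e => rank_rel (num C M) d (H M e) (H' M e) (t e) (i e)).
Proof.
move=> hH hH' ht hi; have [it tE tk] := ht; have [ii iE ik] := hi.
have T1 := term_var C A tE tk; have T2 := term_var C A iE ik.
rewrite /rank_rel; apply: dfn_and; first exact: dfn_changed.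
apply: dfn_card => //; apply: dfn_and; last by df.
by apply: dfn_changed; df.
Qed.

Ltac df_more ::= first [ df_sums | (apply: dfn_rank; df) | (apply: dfn_changed; df)
  | (apply: dfn_dig => //; df)
  | (apply: dfn_xpow => //; df) | (apply: dfn_ppow => //; df) | (apply: dfn_aux6 => //; df) ].

Section Entries.
Variables (mj : bool) (k : nat) (H H' : structure A -> seq nat -> nat -> nat -> Prop).
Variables (X : structure A -> seq nat -> nat -> nat -> nat -> Prop) (p a : structure A -> seq nat -> nat).
Hypothesis hH : dfn C mj k.+2 (fun M e => H M (behead (behead e)) (nth 0 e 0) (nth 0 e 1)).
Hypothesis hH' : dfn C mj k.+2 (fun M e => H' M (behead (behead e)) (nth 0 e 0) (nth 0 e 1)).
Hypothesis hX : dfn C mj k.+3 (fun M e => X M (behead (behead (behead e))) (nth 0 e 0) (nth 0 e 1) (nth 0 e 2)).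
Hypothesis hp : term C k p.
Hypothesis ha : term C k a.

Lemma dfn_entry kk s t : bvar k kk -> bvar k s -> bvar k t ->
  dfn C mj k.+3 (fun M e => entry_rel (num C M) d (H M (behead (behead (behead e))))
     (H' M (behead (behead (behead e)))) (X M (behead (behead (behead e))))
     (p M (behead (behead (behead e)))) (a M (behead (behead (behead e)))) (kk (behead (behead (behead e))))
     (s (behead (behead (behead e)))) (t (behead (behead (behead e)))) (nth 0 e 0) (nth 0 e 1) (nth 0 e 2)).
Proof.
move=> [ik kE kk'] [is_ sE sk] [it tE tk].
apply: (@dfn_ext C A mj k.+3 (fun M e => entry_rel (num C M) d (H M (behead (behead (behead e))))
     (H' M (behead (behead (behead e)))) (X M (behead (behead (behead e))))
     (p M (behead (behead (behead e)))) (a M (behead (behead (behead e)))) (nth 0 (behead (behead (behead e))) ik)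
     (nth 0 (behead (behead (behead e))) is_) (nth 0 (behead (behead (behead e))) it) (nth 0 e 0) (nth 0 e 1) (nth 0 e 2))).
  by move=> M e _ _; rewrite -sE -tE -kE.
by rewrite /entry_rel /delta_rel /differ; df.
Qed.
End Entries.

Lemma dfn_copy_update mj k (H H' : structure A -> seq nat -> nat -> nat -> Prop) tag p a i j v :
  dfn C mj k.+2 (fun M e => H M (behead (behead e)) (nth 0 e 0) (nth 0 e 1)) ->
  dfn C mj k.+2 (fun M e => H' M (behead (behead e)) (nth 0 e 0) (nth 0 e 1)) ->
  p < k -> a < k -> i < k -> j < k -> v < k ->
  dfn C mj k (fun M e => copy_update (num C M) d (dom M) (xpow M) (ppow M) (H M e) (H' M e) c1
     (aux6 M tag (nth 0 e p) (nth 0 e a)) (nth 0 e p) (nth 0 e a) (nth 0 e i) (nth 0 e j) (nth 0 e v)).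
Proof.
move=> hH hH' hp ha hi hj hv; rewrite /copy_update /log_rel /bits_rel.
df; apply: dfn_detp => //; try by df.
  refine (@dfn_entry mj k.+4 (fun M e => H M (behead (behead (behead (behead e))))) (fun M e => H' M (behead (behead (behead (behead e)))))
    (fun M e => aux6 M tag (nth 0 (behead (behead (behead (behead e)))) p) (nth 0 (behead (behead (behead (behead e)))) a))
    (fun M e => nth 0 (behead (behead (behead (behead e)))) p) (fun M e => nth 0 (behead (behead (behead (behead e)))) a) _ _ _ _ _
    (fun e => nth 0 (behead (behead (behead e))) 0) (fun e => nth 0 (behead (behead (behead e))) 0) (fun e => nth 0 (behead (behead (behead e))) 0) _ _ _); df.
refine (@dfn_entry mj k.+4.+1 (fun M e => H M (behead (behead (behead (behead (behead e)))))) (fun M e => H' M (behead (behead (behead (behead (behead e))))))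
    (fun M e => aux6 M tag (nth 0 (behead (behead (behead (behead (behead e))))) p) (nth 0 (behead (behead (behead (behead (behead e))))) a))
    (fun M e => nth 0 (behead (behead (behead (behead (behead e))))) p) (fun M e => nth 0 (behead (behead (behead (behead (behead e))))) a) _ _ _ _ _
    (fun e => nth 0 (behead (behead (behead (behead e)))) 0) (fun e => nth 0 (behead (behead (behead (behead (behead e))))) i) (fun e => nth 0 (behead (behead (behead (behead (behead e))))) j) _ _ _); df.
Qed.

Lemma dfn_new_graphB mj k u v : bvar k u -> bvar k v -> dfn C mj k (fun M e => new_graphB M (u e) (v e)).
Proof.
move=> [iu uE uk] [ii iE ik].
apply: (@dfn_ext C A mj k (fun M e => new_graphB M (nth 0 e iu) (nth 0 e ii))).
  by move=> M e _ _; rewrite -uE -iE.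
by rewrite /new_graphB /least_missing /missing /keptB /graphB /old_edge; df.
Qed.

Ltac df_more ::= first [ df_sums | (apply: dfn_new_graphB; df)
  | (apply: dfn_xpow => //; df) | (apply: dfn_ppow => //; df) | (apply: dfn_aux6 => //; df) ].

Lemma dfn_new_aux : dfn C false 6 (fun M e =>
  new_aux M (nth 0 e 0) (nth 0 e 1) (nth 0 e 2) (nth 0 e 3) (nth 0 e 4) (nth 0 e 5)).
Proof.
have hB : dfn C false 6 (fun M e => updB M (nth 0 e 1) (nth 0 e 2) (nth 0 e 3) (nth 0 e 4) (nth 0 e 5)).
  apply: dfn_copy_update => //.
    by rewrite /graphB; df.
  by df.
have hA : dfn C false 6 (fun M e => updA M (nth 0 e 1) (nth 0 e 2) (nth 0 e 3) (nth 0 e 4) (nth 0 e 5)).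
  apply: dfn_copy_update => //; first by rewrite /old_edge; df.
  by df.
rewrite /new_aux /new_xpow /new_ppow /tables_complete /finished /init_cell /valid /delta_rel.
by df.
Qed.
End Program.

(** * Correctness of one update *)

Definition log2 (n : nat) : nat := trunc_log 2 n.

(* F bounds the number of nodes whose adjacency changes in one update of a copy. *)
Record large (C d c1 F n : nat) : Prop := Large {
  large_chain : chain_params (n ^ C) d (log2 n ^ 60);
  large_log : 64 <= log2 n;
  large_C : 20 <= C;
  large_bits : n ^ C <= 2 ^ (log2 n ^ 2);
  large_F : 2 * F + 8 <= log2 n;
  large_code : (log2 n ^ 10) ^ (2 * F + 3) <= n ^ C;
  large_off : (2 * F + 1)`! * (log2 n ^ 2) ^ (2 * F + 1) < n ^ c1;
  large_offC : 2 * n ^ c1 < n ^ C;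
  large_dom : log2 n ^ 60 < n }.

Section LargeFacts.
Variables (C d c1 F n : nat).
Hypothesis L : large C d c1 F n.
Let l := log2 n.
Let N := n ^ C.

Lemma large_n2 : 2 <= n.
Proof.
apply: leq_ltn_trans (large_dom L); rewrite expn_gt0; apply/orP; left.
by apply: leq_trans (large_log L).
Qed.

Lemma log2_lt : n < 2 ^ l.+1.
Proof. exact: trunc_log_ltn. Qed.

Lemma log_pow_le i j : i <= j -> l ^ i <= l ^ j.
Proof. by move=> ij; rewrite leq_exp2l //; have := large_log L; rewrite -/l; lia. Qed.

Lemma pow_n_le i j : i <= j -> n ^ i <= n ^ j.
Proof. by move=> ij; rewrite leq_exp2l //; exact: large_n2. Qed.

Lemma nN : n < N.
Proof. by rewrite /N -{1}[n]expn1 ltn_exp2l; [have := large_C L; lia | exact: large_n2]. Qed.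

Lemma large_sum : sum_params N d (l ^ 60) (l ^ 2).
Proof.
split; [exact: large_chain L| |exact: large_bits L].
by have := large_log L; rewrite -/l -mulnn; nia.
Qed.

Lemma exists_bits : exists2 nb, 0 < nb & 2 ^ nb.-1 < N /\ N <= 2 ^ nb.
Proof.
have ex : exists m, N <= 2 ^ m by exists (l ^ 2); exact: large_bits L.
case: (ex_minnP ex) => m h mn; exists m.
  by case: m h {mn} => //; rewrite expn0; have := nN; have := large_n2; lia.
split=> //; rewrite ltnNge; apply/negP => /mn; case: m h {mn} => //=; last by move=> *; lia.
by rewrite expn0; have := nN; have := large_n2; lia.
Qed.

Lemma bits_le nb : 2 ^ nb.-1 < N -> nb <= l ^ 2.
Proof.
move=> h; have : 2 ^ nb.-1 < 2 ^ (l ^ 2) by apply: leq_trans h (large_bits L).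
by rewrite ltn_exp2l //; lia.
Qed.
End LargeFacts.

Definition edge_of (n : nat) (G : digraph n) (u w : nat) : Prop :=
  exists a b : 'I_n, [/\ val a = u, val b = w & (a, b) \in G].

Lemma edge_ofE n (G : digraph n) (a b : 'I_n) : edge_of G a b <-> (a, b) \in G.
Proof. by split=> [[a' [b' [/val_inj -> /val_inj ->]]]|]; last exists a, b. Qed.

Section Changes.
Variables (n : nat) (G G' : digraph n).

Definition diff_node (u : 'I_n) : bool :=
  [exists w, (((u, w) \in G) != ((u, w) \in G')) || (((w, u) \in G) != ((w, u) \in G'))].

Definition diff_ords : seq 'I_n := [seq u <- enum 'I_n | diff_node u].
Definition diff_seq : seq nat := map val diff_ords.

Lemma diff_seq_sorted : sorted ltn diff_seq.
Proof.
rewrite /diff_seq sorted_map; apply: sorted_filter; first by move=> x y z; exact: ltn_trans.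
by have := iota_ltn_sorted 0 n; rewrite -val_enum_ord sorted_map.
Qed.

Lemma diff_seq_uniq : uniq diff_seq.
Proof. by apply: sorted_uniq diff_seq_sorted; [exact: ltn_trans | exact: ltnn]. Qed.

Lemma diff_seq_lt : all (gtn n) diff_seq.
Proof. by apply/allP => x /mapP[u _ ->] /=. Qed.

Lemma mem_diff_seq (u : 'I_n) : (val u \in diff_seq) = diff_node u.
Proof.
rewrite /diff_seq (mem_map val_inj) mem_filter mem_enum inE.
by rewrite andbT.
Qed.

Lemma diff_seq_changed N H H' u : n <= N ->
  (forall u w, u < N -> w < N -> (H u w <-> edge_of G u w)) ->
  (forall u w, u < N -> w < N -> (H' u w <-> edge_of G' u w)) ->
  u < N -> changed N H H' u <-> u \in diff_seq.
Proof.
move=> nN hH hH' uN.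
have dP a b : a < N -> b < N -> differ H H' a b ->
    exists x y : 'I_n, [/\ val x = a, val y = b & ((x, y) \in G) != ((x, y) \in G')].
  move=> aN bN; rewrite /differ !hH // !hH' //.
  move=> [[[x [y [ex ey xy]]] nh]|[nh [x [y [ex ey xy]]]]]; exists x, y; split=> //; rewrite xy.
    by rewrite eqb_id; apply/negP => h; apply: nh; exists x, y.
  by rewrite eq_sym eqb_id; apply/negP => h; apply: nh; exists x, y.
have dQ (x y : 'I_n) : ((x, y) \in G) != ((x, y) \in G') -> differ H H' x y.
  have xN : x < N by exact: leq_trans (ltn_ord x) nN.
  have yN : y < N by exact: leq_trans (ltn_ord y) nN.
  rewrite /differ !hH // !hH' // !edge_ofE.
  by case: (_ \in G); case: (_ \in G') => // _; [right|left].
split=> [[w wN [/(dP _ _ uN wN)|/(dP _ _ wN uN)] [x [y [xE yE xy]]]]|].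
- by rewrite -xE mem_diff_seq; apply/existsP; exists y; rewrite xy.
- by rewrite -yE mem_diff_seq; apply/existsP; exists x; rewrite xy orbT.
move=> /mapP[x]; rewrite mem_filter mem_enum andbT => /existsP[w /orP[h|h]] ->.
  by exists w; [exact: leq_trans (ltn_ord w) nN | left; exact: dQ].
by exists w; [exact: leq_trans (ltn_ord w) nN | right; exact: dQ].
Qed.
End Changes.

Lemma sorted_count_lt (s : seq nat) i : sorted ltn s -> i < size s ->
  size [seq v <- s | v < nth 0 s i] = i.
Proof.
move=> srt iS.
have -> : [seq v <- s | v < nth 0 s i] = take i s.
  have -> : [seq v <- s | v < nth 0 s i] = [seq v <- take i s ++ drop i s | v < nth 0 s i] by rewrite cat_take_drop.
  rewrite filter_cat.
  have -> : [seq v <- take i s | v < nth 0 s i] = take i s.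
    apply/all_filterP/allP => v /(nthP 0)[j]; rewrite size_take iS => ji <-.
    rewrite nth_take //; apply: (sorted_ltn_nth ltn_trans 0 srt) => //; rewrite inE; lia.
  have -> : [seq v <- drop i s | v < nth 0 s i] = [::]; last by rewrite cats0.
  apply/eqP; rewrite -[_ == _]negbK -has_filter; apply/negP => /hasP[v /(nthP 0)[j]].
  rewrite size_drop => jS <-; rewrite nth_drop => h.
  case: (posnP j) => [j0|j0]; first by rewrite j0 addn0 ltnn in h.
  have h2 : nth 0 s i < nth 0 s (i + j) by apply: (sorted_ltn_nth ltn_trans 0 srt); rewrite ?inE -?ltn_subRL // -{1}[i]addn0 ltn_add2l.
  by have := ltn_trans h h2; rewrite ltnn.
by rewrite size_take iS.
Qed.

Lemma val_Fp_bool p (b : bool) : prime p -> val ((b : nat)%:R : 'F_p)%R = b.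
Proof.
by move=> pp; rewrite /= val_Fp_nat // modn_small //; have := prime_gt1 pp; case: b => //; exact: ltnW.
Qed.

Lemma delta_relP p i j v : prime p -> delta_rel i j v <-> v = val (((i == j) : nat)%:R : 'F_p)%R.
Proof.
move=> pp; rewrite val_Fp_bool // /delta_rel; case: eqP => h; split.
- by move=> [[_ ->]|[nh _]].
- by left.
- by move=> [[hh _]|[_ ->]].
- by right.
Qed.

Lemma dvdn_fact_le m n : m <= n -> m`! %| n`!.
Proof. by move=> /subnK <-; elim: (n - m) => // i IH; rewrite addSn factS dvdn_mull. Qed.

Section CopySpec.
Variables (C d c1 F n : nat) (XP : nat -> nat -> nat -> Prop) (PW : nat -> nat -> nat -> nat -> Prop).
Hypothesis L : large C d c1 F n.
Let N := n ^ C.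
Let l := log2 n.
Hypothesis tok : tables_ok N XP PW n.
Variables (G G' : digraph n) (H H' : nat -> nat -> Prop).
Hypothesis HE : forall u w, u < N -> w < N -> (H u w <-> edge_of G u w).
Hypothesis HE' : forall u w, u < N -> w < N -> (H' u w <-> edge_of G' u w).
Hypothesis szF : size (diff_seq G G') <= F.
Variables (p a : nat).
Hypothesis pp : prime p.
Hypothesis pn : p <= n ^ 8.
Hypothesis a0 : 0 < a.
Hypothesis ap : a < p.


Let us := diff_seq G G'.
Let k := size us.
Let nltN : n < N := nN L.

Let l64 : 64 <= l. Proof. exact: large_log L. Qed.

Lemma FltN m : m <= 2 * F + 8 -> m < n.
Proof.
move=> h; apply: leq_ltn_trans (_ : l ^ 1 < n); first by rewrite expn1; exact: leq_trans h (large_F L).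
by apply: leq_ltn_trans (large_dom L); apply: (log_pow_le L).
Qed.

Let kn : k < n.
Proof. by apply: FltN; apply: leq_trans szF _; lia. Qed.

Let n0 : 0 < n. Proof. exact: leq_ltn_trans kn. Qed.
Let x0 : 'I_n := Ordinal n0.

Lemma pltN : p < N.
Proof. by apply: leq_ltn_trans pn _; rewrite ltn_exp2l; [have := large_C L; lia | exact: large_n2 L]. Qed.

(** At most F <= l elements below n < 2^(l+1) are distinguished by a modulus of size at most l^12,
    since n^(F^2) < 2^(l^6). *)
Lemma card_few (P : nat -> Prop) (s : seq nat) m : uniq s -> all (gtn n) s -> size s <= F ->
  (forall u, u < N -> (P u <-> u \in s)) -> (card_rel N d P m <-> m = size s).
Proof.
move=> uS aS sF hP; refine (@card_relP N d (l ^ 60) (l ^ 2) (l ^ 6) n s P m (large_sum L) uS aS _ _ _ _ hP).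
- exact: ltnW.
- have h1 : size s ^ 2 <= l ^ 2.
    by apply: leq_expl; apply: leq_trans sF _; apply: leq_trans (large_F L); lia.
  apply: leq_ltn_trans (_ : n ^ (l ^ 2) < _).
    by rewrite leq_exp2l //; exact: large_n2 L.
  apply: leq_ltn_trans (_ : (2 ^ l.+1) ^ (l ^ 2) < _); first by apply: leq_expl; apply: ltnW; exact: log2_lt.
  rewrite -expnM ltn_exp2l //; apply: leq_trans (log_pow_le L (ltac:(lia) : 4 <= 6)).
  by rewrite -[l ^ 4]/(l ^ (2 + 2)) expnD ltn_mul2r expn_gt0 -[l ^ 2]mulnn; apply/andP; split; nia.
- by apply: leq_trans (log_pow_le L (ltac:(lia) : 1 <= 6)); rewrite expn1; lia.
rewrite -/N -/l -expnM -expnM /=.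
apply: leq_trans (_ : l ^ 13 * l ^ 4 <= _).
  by rewrite leq_pmul2r; [rewrite [l ^ 13]expnS ltn_Pmull // ?expn_gt0 //; [lia|apply/orP; left; lia]|rewrite expn_gt0; lia].
by rewrite -expnD; apply: (log_pow_le L).
Qed.

Let ks : nat -> 'I_n := nth x0 (diff_ords G G').

Let sizek : size (diff_ords G G') = k. Proof. by rewrite /k /us size_map. Qed.

Let ksE i : i < k -> nth 0 us i = val (ks i).
Proof. by move=> ik; rewrite /us (nth_map x0) ?sizek. Qed.

Let ks_inj i j : i < k -> j < k -> ks i = ks j -> i = j.
Proof.
move=> ik jk h; apply/eqP; rewrite -(nth_uniq x0 (s := diff_ords G G')) ?sizek //; first exact/eqP.
by apply: filter_uniq; exact: enum_uniq.
Qed.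

Lemma card_changed m : card_rel N d (changed N H H') m <-> m = k.
Proof.
apply: card_few => //; [exact: diff_seq_uniq|exact: diff_seq_lt|].
by move=> u uN; apply: diff_seq_changed => //; exact: ltnW.
Qed.

Lemma rank_relP u i : u < N -> rank_rel N d H H' u i <-> i < k /\ u = val (ks i).
Proof.
move=> uN; rewrite /rank_rel.
have chP v : v < N -> changed N H H' v <-> v \in us by move=> vN; apply: diff_seq_changed => //; exact: ltnW.
rewrite (chP u uN).
have key : u \in us -> card_rel N d (fun v => changed N H H' v /\ v < u) i <-> i = index u us.
  move=> uu; have iu : index u us < size us by rewrite index_mem.
  have e : size [seq v <- us | v < u] = index u us.
    by rewrite -[in LHS](nth_index 0 uu) sorted_count_lt //; exact: diff_seq_sorted.
  rewrite -e; apply: card_few.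
  - by apply: filter_uniq; exact: diff_seq_uniq.
  - by apply/allP => v; rewrite mem_filter => /andP[_]; apply/allP; exact: diff_seq_lt.
  - by rewrite e; apply: leq_trans szF; exact: ltnW.
  by move=> v vN; rewrite chP // mem_filter andbC; split=> [[-> ->]|/andP[]].
split=> [[uu /(key uu) ->]|[ik ->]].
  by split; [rewrite index_mem|rewrite -ksE ?index_mem // nth_index].
have uu : val (ks i) \in us by rewrite -ksE // mem_nth.
split=> //; rewrite -ksE //.
have e : size [seq v <- us | v < nth 0 us i] = i by rewrite sorted_count_lt //; exact: diff_seq_sorted.
refine (proj2 (@card_few _ [seq v <- us | v < nth 0 us i] i _ _ _ _) (esym e)).
- by apply: filter_uniq; exact: diff_seq_uniq.
- by apply/allP => v; rewrite mem_filter => /andP[_]; apply/allP; exact: diff_seq_lt.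
- by rewrite e; apply: leq_trans szF; exact: ltnW.
by move=> v vN; rewrite chP // mem_filter andbC; split=> [[-> ->]|/andP[]].
Qed.

Local Notation Fp := ('F_p).
Let aF : Fp := (a%:R)%R.
Let NG := lap_mx G aF.
Let NG' := lap_mx G' aF.
Let g (i : 'I_k) : 'I_n := ks i.
Let dn (i j : nat) : Fp := (aF * (((ks i, ks j) \in G')%:R - ((ks i, ks j) \in G)%:R))%R.
Let D : 'M[Fp]_k := (\matrix_(i, j) (- dn i j))%R.
Let P : 'M[Fp]_(n, k) := (\matrix_(u, i) (u == g i)%:R)%R.

(** A changed entry has both ends among the changed nodes, so the difference of the matrices is
    supported on the rows and columns selected by [P]. *)
Lemma lap_update : NG' = (NG + P *m D *m P^T)%R.
Proof.
apply/matrixP => u w; rewrite [RHS]mxE.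
have PDP : ((P *m D *m P^T) u w = \sum_(j < k) \sum_(i < k) (u == g i)%:R * D i j * (w == g j)%:R)%R.
  rewrite mxE; apply: eq_bigr => j _; rewrite mxE big_distrl /=; apply: eq_bigr => i _.
  by rewrite !mxE.
have dif : (NG' u w = NG u w - aF * (((u, w) \in G')%:R - ((u, w) \in G)%:R))%R.
  by rewrite !mxE -addrA -opprD -mulrDr addrCA subrr addr0.
rewrite dif PDP; congr (_ + _)%R.
have mem_ks (x : 'I_n) : diff_node G G' x -> exists i : 'I_k, x = g i.
  move=> dx; have xd : x \in diff_ords G G' by rewrite mem_filter dx mem_enum.
  have ix : index x (diff_ords G G') < k by rewrite -sizek index_mem.
  by exists (Ordinal ix); rewrite /g /ks /= nth_index.
have [e|ne] := eqVneq ((u, w) \in G') ((u, w) \in G).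
  rewrite e subrr mulr0 oppr0 big1 // => j _; rewrite big1 // => i _.
  case: (eqVneq u (g i)) => [ui|]; last by rewrite !mul0r.
  case: (eqVneq w (g j)) => [wj|]; last by rewrite mulr0.
  by rewrite mxE /dn -/(g i) -/(g j) -ui -wj e subrr mulr0 oppr0 mulr0 mul0r.
have [iu ui] : exists i : 'I_k, u = g i.
  by apply: mem_ks; apply/existsP; exists w; rewrite eq_sym ne.
have [jw wj] : exists i : 'I_k, w = g i.
  by apply: mem_ks; apply/existsP; exists u; apply/orP; right; rewrite eq_sym.
have ginj (i j : 'I_k) : g i = g j -> i = j by move=> h; apply: val_inj; exact: ks_inj (ltn_ord i) (ltn_ord j) h.
rewrite (bigD1 jw) //= [X in _ = (_ + X)%R]big1 ?addr0; last first.
  move=> j jn; rewrite big1 // => i _; case: (eqVneq w (g j)) => [wj'|]; last by rewrite mulr0.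
  by case/eqP: jn; apply: ginj; rewrite -wj -wj'.
rewrite (bigD1 iu) //= [X in _ = (_ + X)%R]big1 ?addr0; last first.
  move=> i inn; case: (eqVneq u (g i)) => [ui'|]; last by rewrite !mul0r.
  by case/eqP: inn; apply: ginj; rewrite -ui -ui'.
by rewrite -ui -wj !eqxx mul1r mulr1 mxE /dn -/(g iu) -/(g jw) -ui -wj.
Qed.

Variable X : nat -> nat -> nat -> Prop.
Hypothesis XE : forall (i j : 'I_n) v, v < N -> X i j v <-> v = val (invmx NG i j).
Hypothesis uNG : NG \in unitmx.

Let p1 : 1 < p := prime_gt1 pp.
Let valFp (x : Fp) : val x < N.
Proof. by apply: ltn_trans pltN; exact: val_Fp_lt. Qed.

Definition entry_val (s t : 'I_n) (i j : nat) : Fp :=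
  block_entry k dn (fun i j => invmx NG (ks i) (ks j)) (fun i => invmx NG (ks i) t)
    (fun j => invmx NG s (ks j)) (invmx NG s t) i j.

(** A deleted edge contributes -a, whose representative is p - a because 0 < a < p. *)
Lemma diff_valP i j v : v < N -> i < k -> j < k ->
  ((H' (ks i) (ks j) /\ ~ H (ks i) (ks j) /\ v = a) \/
   (~ H' (ks i) (ks j) /\ H (ks i) (ks j) /\ v + a = p) \/ (~ differ H H' (ks i) (ks j) /\ v = 0)) <->
  v = val (dn i j).
Proof.
move=> vN ik jk; have iN : ks i < N by exact: ltn_trans (ltn_ord _) nltN.
have jN : ks j < N by exact: ltn_trans (ltn_ord _) nltN.
rewrite /differ !HE // !HE' // !edge_ofE /dn.
have va : val aF = a by rewrite /= val_Fp_nat // modn_small.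
have vma : val (- aF)%R = p - a.
  have -> : (- aF = (p - a)%:R)%R.
    by apply/eqP; rewrite eq_sym -subr_eq0 opprK -natrD subnK ?pchar_Fp_0 // ltnW.
  by rewrite /= val_Fp_nat // modn_small //; lia.
case: (_ \in G'); case: (_ \in G); rewrite ?subrr ?subr0 ?sub0r ?mulr0 ?mulrN1 ?mulr1 ?vma ?va; split.
- by move=> [[_ [nh _]]|[[nh _]|[_ ->]]] //; case: nh.
- by move=> ->; right; right; split=> // -[[_ []]|[]].
- by move=> [[_ [_ ->]]|[[nh _]|[nh ->]]] //; case: nh => //; left.
- by move=> ->; left.
- by move=> [[nh _]|[[_ [_ h]]|[nh _]]] //; [lia|case: nh; right].
- by move=> ->; right; left; do 2!split=> //; lia.
- by move=> [[nh _]|[[_ [nh _]]|[_ ->]]].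
- by move=> ->; right; right; split=> // -[[]|[]].
Qed.

Lemma entry_relP (s t : 'I_n) i j v : i < k + k + 1 -> j < k + k + 1 -> v < N ->
  entry_rel N d H H' X p a k s t i j v <-> v = val (entry_val s t i j).
Proof.
move=> iK jK vN; rewrite /entry_rel /entry_val /block_entry.
have ksN m : ks m < N by exact: ltn_trans (ltn_ord _) nltN.
have rk m : m < k -> rank_rel N d H H' (ks m) m by move=> mk; apply/rank_relP.
have v0 : val (0 : Fp)%R = 0 by [].
have kN : k < N by exact: ltn_trans nltN.
case: (ltnP i k) => [ik|ki].
  case: (ltnP j k) => [jk|kj].
    split; last by move=> h; left; split=> //; left; split=> //; apply/(delta_relP _ _ _ pp).
    by move=> [[_ [[_ /(delta_relP _ _ _ pp)]|[[]|[]]]]|[[]|[]]] //; lia.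
  case: (ltnP j (k + k)) => [jk|kkj]; last first.
    split; last by move=> ->; left; split=> //; right; right.
    by move=> [[_ [[]|[[_ []]|[_ ->]]]]|[[]|[]]] //; lia.
  split.
    move=> [[_ [[]|[[_ [_ [u uN [w wN [m mN [ru [rw [mE h]]]]]]]]|[]]]]|[[]|[]]]; try lia.
    have /(rank_relP _ uN)[_ uE] := ru; have /(rank_relP _ wN)[mk wE] := rw.
    have <- : m = j - k by lia.
    by apply/diff_valP => //; rewrite -uE -wE.
  move=> h; left; split=> //; right; left; do 2!split=> //.
  exists (ks i) => //; exists (ks (j - k)) => //; exists (j - k); first by apply: leq_ltn_trans kN; lia.
  split; first exact: rk. 
  split; first by apply: rk; lia.
  split; first by lia.
  by apply/diff_valP => //; lia.
case: (ltnP i (k + k)) => [ikk|kki].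
  have ik' : i - k < k by lia.
  have ikN : i - k < N by apply: ltn_trans kN.
  split.
    move=> [[]|[[_ [_ [m mN [mE h]]]]|[]]]; try lia.
    have mE' : m = i - k by lia.
    case: h => [[jk [u uN [w wN [/(rank_relP _ uN)[_ ->] [/(rank_relP _ wN)[_ ->] /XE ->]]]]]|h]; rewrite ?mE' //.
      by rewrite jk.
    case: h => [[kj [jkk /(delta_relP _ _ _ pp) ->]]|[kkj [u uN [/(rank_relP _ uN)[_ ->] /XE ->]]]] //.
      by rewrite ltnNge kj jkk.
    by rewrite mE' ltnNge (leq_trans _ kkj) ?leq_addr //= ltnNge kkj.
  move=> h; right; left; do 2!split=> //; exists (i - k) => //; split; first by lia.
  case: (ltnP j k) h => [jk|kj] h.
    left; split=> //; exists (ks (i - k)) => //; exists (ks j) => //; split; first exact: rk.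
    by split; [exact: rk | apply/XE].
  case: (ltnP j (k + k)) h => [jkk|kkj] h; first by right; left; do 2!split=> //; apply/(delta_relP _ _ _ pp).
  right; right; split=> //; exists (ks (i - k)) => //; split; first exact: rk.
  exact/XE.
split.
  move=> [[]|[[_ []]|[_ h]]]; try lia.
  case: h => [[jk [w wN [/(rank_relP _ wN)[_ ->] /XE ->]]]|[[kj [jkk ->]]|[kkj /XE ->]]] //.
  - by rewrite jk.
  - by rewrite ltnNge kj jkk.
  by rewrite ltnNge (leq_trans _ kkj) ?leq_addr //= ltnNge kkj.
move=> h; right; right; split=> //.
case: (ltnP j k) h => [jk|kj] h.
  by left; split=> //; exists (ks j) => //; split; [exact: rk|apply/XE].
case: (ltnP j (k + k)) h => [jkk|kkj] h; first by right; left.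
by right; right; split=> //; apply/XE.
Qed.

Lemma log_relP m : m < N -> log_rel N n XP m <-> m = l.
Proof.
move=> mN; have [X1 [X2 _]] := tok; have n0' := n0.
have lo : 2 ^ l <= n by apply: trunc_logP.
have hi : n < 2 ^ l.+1 by exact: trunc_log_ltn.
split=> [[w wN [/X1 -> [h1 h2]]]|->].
  by apply/esym; apply: trunc_log_eq => //; rewrite h1 expnS mulnC.
exists (2 ^ l); first exact: leq_ltn_trans nltN.
split; last by split=> //; rewrite mulnC -expnS.
apply: X2; last by exact: leq_ltn_trans nltN.
  by apply: leq_ltn_trans nltN; exact: large_n2 L.
by apply: leq_trans (ltn_expl l (ltnSn 1)) lo.
Qed.

Lemma bits_relP nb : bits_rel N XP nb <-> 0 < nb /\ (2 ^ nb.-1 < N /\ N <= 2 ^ nb).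
Proof.
have [X1 [X2 _]] := tok; split.
  move=> [m mN [-> [w wN [/X1 we h]]]]; rewrite addn1 /=; split=> //.
  by rewrite -we expnS mulnC -we.
case: nb => [[]//|m] /= [_ [h1 h2]]; have ml : m < l ^ 2 by exact: (@bits_le _ _ _ _ _ L m.+1 h1).
have mn : m < n.
  by apply: ltn_trans ml _; apply: leq_ltn_trans (large_dom L); apply: (log_pow_le L).
exists m; first exact: ltn_trans nltN.
split; first by rewrite addn1.
exists (2 ^ m) => //; split; last by rewrite mulnC -expnS.
by apply: X2 => //; apply: leq_ltn_trans nltN; exact: large_n2 L.
Qed.

(** Here J = l^5, which exceeds the degree K * nb < l^3 of the bit determinant, the (K+2)^2 elements
    needed for shifting the minors, and the at most l^2 bits of N. Small primes are at most J^2 =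
    l^10, the base in [large_code]; all walks stay far below the bound l^60. *)
Lemma entry_detP K (s t : 'I_n) nb V : K <= k + k + 1 -> 2 ^ nb.-1 < N -> N <= 2 ^ nb ->
  detp_rel N d XP PW (entry_rel N d H H' X p a k s t) K nb (l ^ 5) (n ^ c1) p V <->
  V = val (\det (lead (entry_val s t) K))%R.
Proof.
move=> Kk nb1 nb2; have nbl := bits_le L nb1; rewrite -/l in nbl.
have KF : K <= 2 * F + 1.
  by apply: leq_trans Kk _; rewrite addnn -mul2n leq_add2r leq_mul2l szF.
have Kl : K.+2 < l by apply: leq_trans (large_F L); move: KF; lia.
have l1 : 1 <= l by lia.
have powl i : 0 < l ^ i by rewrite expn_gt0 l1.
have l2 : 64 * l <= l ^ 2 by rewrite -mulnn leq_mul2r l64 orbT.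
have l25 : l ^ 2 * 64 <= l ^ 5.
  apply: leq_trans (_ : l ^ 2 * l ^ 3 <= _); last by rewrite -expnD.
  by rewrite leq_mul2l; apply/orP; right; apply: leq_trans l64 _; rewrite -{1}[l]expn1; apply: (log_pow_le L).
have -> : lead (entry_val s t) K = lead (fun i j => ((val (entry_val s t i j))%:R : Fp)%R) K.
  by apply/matrixP => i j; rewrite !mxE natr_val_Fp.
apply: (@detp_relP N d XP PW n (l ^ 60) (l ^ 2)) => //.
- exact: large_sum L.
- by apply: leq_trans l25; apply: leq_trans (_ : 1 * 64 <= _) => //; rewrite leq_mul2r powl.
- by apply: leq_trans (large_bits L) _; rewrite leq_exp2l //; apply: (log_pow_le L).
- by apply: ltnW; apply: leq_ltn_trans (large_dom L); apply: (log_pow_le L).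
- by rewrite -expnM; apply: (log_pow_le L).
- rewrite -expnM; apply: leq_trans (_ : l ^ 6 * l ^ 4 <= _); last by rewrite -expnD; apply: (log_pow_le L).
  by rewrite leq_pmul2r // [l ^ 6]expnS ltn_Pmull //; move: l64; clear; lia.
- rewrite -[(l ^ 5) ^ 2]expnM; apply: leq_trans (large_code L); apply: leq_pexp2l; first exact: powl.
  by move: KF; lia.
- apply: leq_trans (_ : l ^ 2 <= _); last by apply: (log_pow_le L).
  by rewrite -mulnn leq_mul // ltnW.
- apply: leq_trans (_ : l * l ^ 2 + l ^ 2 <= _); last first.
    apply: leq_trans (_ : 2 * l ^ 3 <= _).
      by rewrite mul2n -addnn -expnS leq_add2l; apply: (log_pow_le L).
    rewrite -[l ^ 5]/(l ^ (2 + 3)) expnD leq_mul2r; apply/orP; right.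
    by move: (powl 2) l2 l64; move: (l ^ 2) => y; clear; lia.
  by apply: leq_add; [apply: leq_mul => //; move: Kl; clear; lia | move: l2 l64; move: (l ^ 2) => y; clear; lia].
- by move: nbl l25 l2 l64; move: (l ^ 5) (l ^ 2) => x y; clear; lia.
- have nb0 : 0 < nb by case: nb nb2 {nb1 nbl} => //; rewrite expn0; move: nltN n0; clear; lia.
  by rewrite -(prednK nb0) expnS mulnC ltn_mul2r nb1.
- apply: leq_ltn_trans (large_off L); apply: leq_mul.
    by apply: dvdn_leq; [exact: fact_gt0 | exact: dvdn_fact_le].
  apply: leq_trans (_ : (l ^ 2) ^ K <= _); first exact: leq_expl.
  by apply: leq_pexp2l => //; exact: powl.
- exact: large_offC L.
- apply: leq_ltn_trans (_ : n ^ 1 * n ^ 8 < _).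
    apply: leq_mul => //; rewrite expn1; apply: ltnW; apply: leq_ltn_trans (large_dom L).
    exact: (log_pow_le L).
  by rewrite -expnD ltn_exp2l; [have := large_C L; clear; lia | exact: large_n2 L].
- by apply: leq_trans nb2; apply: ltnW; exact: pltN.
- move=> i j v iK jK vN; apply: entry_relP => //; exact: leq_trans Kk.
by move=> i j _ _; exact: val_Fp_lt.
Qed.

Lemma val_FpM (x y : Fp) : val (x * y)%R = (val x * val y) %% p.
Proof. by rewrite -{1}[x]natr_val_Fp -{1}[y]natr_val_Fp -natrM /= val_Fp_nat. Qed.

Lemma det_entry_block (s t : 'I_n) : (\det NG * \det (lead (entry_val s t) (k + k)) = \det NG')%R.
Proof.
rewrite lap_update (det_update g D uNG); congr (_ * _)%R.
by apply: det_lead_block => // i j; rewrite mxE opprK.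
Qed.

Lemma det_entry_border (s t : 'I_n) : (\det NG' != 0)%R ->
  (\det (lead (entry_val s t) (k + k + 1)) = \det (lead (entry_val s t) (k + k)) * invmx NG' s t)%R.
Proof.
rewrite -(det_entry_block s t) mulf_eq0 negb_or => /andP[_ h].
rewrite lap_update.
have E : (\det (lead (entry_val s t) (k + k)) = \det (1%:M + (P^T *m invmx NG *m P) *m D))%R.
  by apply: det_lead_block => // i j; rewrite mxE opprK.
by rewrite E in h *; apply: det_lead_border => // i j; rewrite mxE opprK.
Qed.

Lemma invmx_entry (s t : 'I_n) (v : nat) : v < p -> (\det NG' != 0)%R ->
  (v * val (\det (lead (entry_val s t) (k + k)))%R) %% p =
    val (\det (lead (entry_val s t) (k + k + 1)))%R <-> v = val (invmx NG' s t).
Proof.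
move=> vp h; rewrite (det_entry_border s t h).
have dn0 : (\det (lead (entry_val s t) (k + k)) != 0)%R.
  by move: h; rewrite -(det_entry_block s t) mulf_eq0 negb_or => /andP[].
move: (\det _)%R dn0 => x x0'; move: (invmx _ _ _) => y.
have vv : val ((v%:R : Fp)%R) = v by rewrite /= val_Fp_nat // modn_small.
rewrite -{1}vv -val_FpM; split=> [/val_inj|->].
  by rewrite mulrC => /(mulfI x0') <-.
by rewrite natr_val_Fp mulrC.
Qed.

Variable e : Fp.
Hypothesis X1E : forall v, v < N -> X n 1 v <-> v = val e.
Hypothesis X0E : forall v, v < N -> X n 0 v <-> v = val (\det NG)%R.
Hypothesis e0 : (e != 0)%R.

Let U := copy_update N d n XP PW H H' c1 X p a.

(** The 2k by 2k block does not involve s and t, so its determinant may be stated for any border.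
    The formula uses node k, which exists because k < n. *)
Lemma copy_updateP i j v : U i j v <-> v < p /\
  exists nb, (2 ^ nb.-1 < N /\ N <= 2 ^ nb) /\
  exists s : 'I_n, exists2 D, D = val (\det (lead (entry_val s s) (k + k)))%R &
  ((i = n /\ j = 1 /\ (val e * (val (\det NG)%R * D)) %% p = v) \/
   (i = n /\ j = 0 /\ (val (\det NG)%R * D) %% p = v) \/
   (i < n /\ j < n /\ exists2 b, detp_rel N d XP PW (entry_rel N d H H' X p a k i j) (k + k + 1) nb (l ^ 5) (n ^ c1) p b &
      (v * D) %% p = b)).
Proof.
have kN : k < N by exact: ltn_trans nltN.
have lN : l < N.
  by apply: leq_ltn_trans nltN; apply: ltnW; apply: leq_ltn_trans (large_dom L); rewrite -[X in X <= _]expn1; apply: (log_pow_le L).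
have D0P nb D0 : 2 ^ nb.-1 < N -> N <= 2 ^ nb ->
    detp_rel N d XP PW (entry_rel N d H H' X p a k k k) (k + k) nb (l ^ 5) (n ^ c1) p D0 <->
    D0 = val (\det (lead (entry_val (Ordinal kn) (Ordinal kn)) (k + k)))%R.
  by move=> b1 b2; apply: (@entry_detP (k + k) (Ordinal kn) (Ordinal kn)) => //; lia.
rewrite /U /copy_update; split.
  move=> [vp [[_ [_ [/(X1E _)]]]|]].
    by move=> /(_ (leq_ltn_trans (leq0n _) nltN))/esym e00; case/eqP: e0; apply: val_inj.
  move=> [k' k'N [/card_changed -> [l' l'N [/(log_relP l'N) -> [nb nbN [/bits_relP[_ [b1 b2]] [D' D'N [/(D0P _ _ b1 b2) D'E h]]]]]]]].
  split=> //; exists nb; split=> //; exists (Ordinal kn); exists D' => //.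
  case: h => [[iE [jE [x xN [y yN [/(X1E xN) -> [_ [/(X0E yN) -> h]]]]]]]|[[iE [jE [y yN [/(X0E yN) -> h]]]]|[il [jl [b bN [h1 h2]]]]]].
  - by left.
  - by right; left.
  by right; right; split=> //; split=> //; exists b.
move=> [vp [nb [[b1 b2] [s [D' D'E h]]]]]; split=> //; right; exists k => //.
split; first exact/card_changed.
exists l => //; split; first exact/log_relP.
have nbN : nb < N.
  apply: leq_ltn_trans nltN; apply: ltnW; apply: leq_ltn_trans (large_dom L).
  by apply: leq_trans (bits_le L b1) _; apply: (log_pow_le L).
exists nb => //; split.
  apply/bits_relP; split=> //.
  by case: nb b2 {h b1 nbN} => //; rewrite expn0; move: nltN n0; clear; lia.
have D'E2 : D' = val (\det (lead (entry_val (Ordinal kn) (Ordinal kn)) (k + k)))%R.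
  rewrite D'E; congr (val _); apply: (mulfI (x := \det NG)); first by rewrite -unitfE -unitmxE.
  by rewrite !det_entry_block.
exists D'; first by rewrite D'E.
split; first by apply/D0P.
case: h => [[-> [-> h]]|[[-> [-> h]]|[il [jl [b h1 h2]]]]].
- left; do 2!split=> //; exists (val e) => //; exists (val (\det NG)%R) => //; split; first exact/X1E.
  by split; [move=> ee; case/eqP: e0; apply: val_inj | split=> //; exact/X0E].
- by right; left; do 2!split=> //; exists (val (\det NG)%R) => //; split=> //; exact/X0E.
right; right; do 2!split=> //; exists b => //; rewrite -h2; apply: ltn_trans pltN.
by rewrite ltn_pmod //; lia.
Qed.

Lemma copy_update_regular : (forall v, v < N -> U n 1 v <-> v = val (e * \det NG')%R) /\
  ((e * \det NG' != 0)%R -> [/\ NG' \in unitmx, forall v, v < N -> U n 0 v <-> v = val (\det NG')%R &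
    forall (i j : 'I_n) v, v < N -> U i j v <-> v = val (invmx NG' i j)]).
Proof.
have [nb0 nbp [nb1 nb2]] := exists_bits L.
split.
  have dE : (e * \det NG' = e * (\det NG * \det (lead (entry_val x0 x0) (k + k))))%R by rewrite det_entry_block.
  move=> v vN; rewrite dE; split=> [/copy_updateP|].
    move=> [vp [nb [_ [s [D' D'E [[_ [_ <-]]|[[_ []]|[]]]]]]]] //; last by rewrite ltnn.
    rewrite D'E !val_FpM modnMmr; congr (_ %% _); congr (_ * _); congr (_ * _).
    congr (val _); apply: (mulfI (x := \det NG)); first by rewrite -unitfE -unitmxE.
    by rewrite !det_entry_block.
  move=> ->; apply/copy_updateP; split; first exact: val_Fp_lt.
  exists nb0; split=> //; exists x0; exists (val (\det (lead (entry_val x0 x0) (k + k)))%R) => //.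
  by left; do 2!split=> //; rewrite !val_FpM modnMmr.
rewrite mulf_eq0 negb_or => /andP[_ dn0]; split; first by rewrite unitmxE unitfE.
  have dE := esym (det_entry_block x0 x0).
  move=> v vN; rewrite dE; split=> [/copy_updateP|].
    move=> [vp [nb [_ [s [D' D'E [[_ []]|[[_ [_ <-]]|[]]]]]]]] //; last by rewrite ltnn.
    rewrite D'E !val_FpM; congr (_ %% _); congr (_ * _).
    congr (val _); apply: (mulfI (x := \det NG)); first by rewrite -unitfE -unitmxE.
    by rewrite !det_entry_block.
  move=> ->; apply/copy_updateP; split; first exact: val_Fp_lt.
  exists nb0; split=> //; exists x0; exists (val (\det (lead (entry_val x0 x0) (k + k)))%R) => //.
  by right; left; do 2!split=> //; rewrite !val_FpM.
have same s s' t t' : (\det (lead (entry_val s s') (k + k)) = \det (lead (entry_val t t') (k + k)))%R.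
  apply: (mulfI (x := \det NG)); first by rewrite -unitfE -unitmxE.
  by rewrite !det_entry_block.
move=> i j v vN; split=> [/copy_updateP|].
  move=> [vp [nb [[b1 b2] [s [D' D'E [[iE]|[[iE]|[_ [_ [b h1 h2]]]]]]]]]]; try by have := ltn_ord i; rewrite iE ltnn.
  apply/(invmx_entry i j vp dn0); rewrite (same _ _ s s) -D'E h2.
  exact: (proj1 (entry_detP i j b (leqnn _) b1 b2) h1).
move=> vE; have vp : v < p by rewrite vE; exact: val_Fp_lt.
apply/copy_updateP; split=> //; exists nb0; split=> //; exists x0; exists (val (\det (lead (entry_val x0 x0) (k + k)))%R) => //.
right; right; do 2!split=> //; exists (val (\det (lead (entry_val i j) (k + k + 1)))%R).
  by apply/entry_detP.
by rewrite (same _ _ i j); apply/invmx_entry.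
Qed.
End CopySpec.

(** [e] is the value at a of the product of determinants. Once it is 0, some matrix of the history
    was singular, and nothing is claimed about the other cells. *)
Definition copy_ok (N p n : nat) (G : digraph n) (a : 'F_p) (X : nat -> nat -> nat -> Prop) (e : 'F_p) : Prop :=
  (forall v, v < N -> X n 1 v <-> v = val e) /\
  ((e != 0)%R -> [/\ lap_mx G a \in unitmx, forall v, v < N -> X n 0 v <-> v = val (\det (lap_mx G a))%R &
    forall (i j : 'I_n) v, v < N -> X i j v <-> v = val (invmx (lap_mx G a) i j)]).

Lemma copy_update_ok C d c1 F n XP PW (G G' : digraph n) H H' p a X (e : 'F_p) :
  large C d c1 F n -> tables_ok (n ^ C) XP PW n ->
  (forall u w, u < n ^ C -> w < n ^ C -> (H u w <-> edge_of G u w)) ->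
  (forall u w, u < n ^ C -> w < n ^ C -> (H' u w <-> edge_of G' u w)) ->
  size (diff_seq G G') <= F -> prime p -> p <= n ^ 8 -> 0 < a -> a < p ->
  copy_ok (n ^ C) G (a%:R)%R X e ->
  copy_ok (n ^ C) G' (a%:R)%R (copy_update (n ^ C) d n XP PW H H' c1 X p a) (e * \det (lap_mx G' (a%:R)))%R.
Proof.
move=> L tok HE HE' szF pp pn a0 ap [X1 Xr].
(* If e = 0, the new product is 0 as well, and the first alternative of [copy_update] records this
   without reading the meaningless cells. *)
have [e0|en0] := eqVneq e 0%R; last first.
  have [uNG X0 XE] := Xr en0.
  exact: (copy_update_regular L tok HE HE' szF pp pn a0 ap XE uNG X1 X0 en0).
rewrite e0 mul0r; split; last by rewrite eqxx.
have N0 : 0 < n ^ C by rewrite expn_gt0; have := large_n2 L; case: (n).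
move=> v vN; rewrite /copy_update; split.
  move=> [vp [[_ [_ [_ ->]]]|]] //.
  move=> [k kN [_ [l lN [_ [nb nbN [_ [D DN [_ [[_ [_ [x xN [y yN [/(X1 _ xN) xe [nx _]]]]]]|[[_ []]|[]]]]]]]]]]] //; last by rewrite ltnn.
  by case: nx; rewrite xe e0.
move=> ->; split; first exact: prime_gt0.
by left; do 2!split=> //; split=> //; apply/X1; rewrite ?e0.
Qed.

(** * The invariant of a run *)

Lemma diff_seq_size n (G G' : digraph n) (S : {set 'I_n}) :
  (forall u w, ((u, w) \in G) != ((u, w) \in G') -> u \in S /\ w \in S) -> size (diff_seq G G') <= #|S|.
Proof.
move=> h; rewrite size_map cardE; apply: uniq_leq_size.
  by apply: filter_uniq; exact: enum_uniq.
by move=> u; rewrite mem_filter !mem_enum => /andP[/existsP[w /orP[/h[]|/h[]]]].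
Qed.

Section PolyCopy.
Variables (C n : nat).
Let N := n ^ C.

(* The determinants of all graphs of the history since the last reset are accumulated in the
   polynomial E, so that E / det (1 - X A) is still a polynomial R with constant term 1. *)
Definition poly_copy_ok (p : nat) (G : digraph n) (h : nat) (X : nat -> nat -> nat -> nat -> Prop) : Prop :=
  exists R : {poly 'F_p}, [/\ (R.[0] = 1)%R, size (R * \det (lap_poly G 'F_p))%R <= h * n + 1 &
    forall a, 0 < a -> a < p -> copy_ok N G (a%:R)%R (X a) (R * \det (lap_poly G 'F_p)).[a%:R]%R].

Lemma copy_ok_ext p (G : digraph n) (a : 'F_p) X Y e : n < N ->
  (forall i j v, i <= n -> j <= n -> v < N -> (X i j v <-> Y i j v)) -> 0 < n ->
  copy_ok N G a X e -> copy_ok N G a Y e.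
Proof.
move=> nN h n0 [X1 Xr]; split=> [v vN|/Xr[u X0 XE]]; first by rewrite -h // X1.
split=> // [v vN|i j v vN]; first by rewrite -h // X0.
by rewrite -h ?XE // ltnW.
Qed.

Lemma poly_copy_ok_ext p (G : digraph n) h X Y : n < N -> 0 < n -> p <= N ->
  (forall a i j v, a < N -> i <= n -> j <= n -> v < N -> (X a i j v <-> Y a i j v)) ->
  poly_copy_ok p G h X -> poly_copy_ok p G h Y.
Proof.
move=> nN n0 pN e [R [R0 sR cR]]; exists R; split=> // a a0 ap.
apply: copy_ok_ext (cR a a0 ap) => // i j v *; apply: e => //; exact: leq_trans ap pN.
Qed.

Lemma poly_copy_ok_init p X : prime p -> n < N -> 1 < N ->
  (forall a i j v, 0 < a -> a < p -> v < N -> i <= n -> j <= n ->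
     (X a i j v <-> (i < n /\ j < n /\ delta_rel i j v) \/ (i = n /\ v = 1))) ->
  0 < n -> poly_copy_ok p set0 0 X.
Proof.
move=> pp nN N1 h n0; exists 1%R.
have adj0 (F : comNzRingType) : adj_mx (set0 : digraph n) F = 0%R by apply/matrixP => i j; rewrite !mxE inE.
have l1 : lap_poly (set0 : digraph n) 'F_p = (1%:M)%R by rewrite /lap_poly adj0 scaler0 subr0.
rewrite l1 det1 mul1r; split; rewrite ?hornerC ?size_poly1 //.
move=> a a0 ap; rewrite hornerC.
have l2 : lap_mx (set0 : digraph n) (a%:R : 'F_p) = (1%:M)%R by rewrite /lap_mx adj0 scaler0 subr0.
have v1 : val (1 : 'F_p)%R = 1.
  exact: etrans (val_Fp_nat pp 1) (modn_small (prime_gt1 pp)).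
split=> [v vN|_].
  by rewrite v1 h //; split=> [[[]|[]]|->] //; [rewrite ltnn|right].
rewrite l2 det1 invmx1; split; first exact: unitmx1.
  by move=> v vN; rewrite v1 h //; split=> [[[]|[]]|->] //; [rewrite ltnn|right].
move=> i j v vN; rewrite h ?(ltnW (ltn_ord _)) // mxE (delta_relP _ _ _ pp).
split=> [[[_ [_ ->]]|[iE]]|->]; [by []|by have := ltn_ord i; rewrite iE ltnn|by left].
Qed.

(** The new cofactor is R times the determinant of the old graph, so that the accumulated polynomial
    is multiplied by the determinant of the new one and its degree grows by at most n. *)
Lemma poly_copy_ok_step d c1 F XP PW (G G' : digraph n) H H' p h X :
  large C d c1 F n -> tables_ok N XP PW n ->
  (forall u w, u < N -> w < N -> (H u w <-> edge_of G u w)) ->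
  (forall u w, u < N -> w < N -> (H' u w <-> edge_of G' u w)) ->
  size (diff_seq G G') <= F -> prime p -> p <= n ^ 8 ->
  poly_copy_ok p G h X ->
  poly_copy_ok p G' h.+1 (fun a => copy_update N d n XP PW H H' c1 (X a) p a).
Proof.
move=> L tok HE HE' szF pp pn [R [R0 sR cR]].
exists (R * \det (lap_poly G 'F_p))%R; split.
- by rewrite hornerM R0 det_lap0 mulr1.
- apply: leq_trans (size_polyMleq _ _) _.
  apply: leq_trans (_ : (h * n + 1 + n.+1).-1 <= _); last by rewrite mulSn; lia.
  by rewrite -!subn1; apply: leq_sub2r; apply: leq_add => //; exact: size_det_lap.
move=> a a0 ap; rewrite hornerM (det_lap_eval G'); exact: (copy_update_ok L tok HE HE' szF pp pn a0 ap (cR a a0 ap)).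
Qed.
End PolyCopy.

Definition lex_code n (e : 'I_n * 'I_n) : nat := e.1 * n + e.2.

Lemma lex_code_inj n : injective (@lex_code n).
Proof.
by move=> [a b] [c e] h; case: (divmod_inj (ltn_ord b) (ltn_ord e) h) => /= /val_inj -> /val_inj ->.
Qed.

Lemma lex_code_le n (e e' : 'I_n * 'I_n) : lex_code e <= lex_code e' <-> (e.1 < e'.1 \/ (val e.1 = val e'.1 /\ e.2 <= e'.2)).
Proof.
rewrite /lex_code; have := ltn_ord e.2; have := ltn_ord e'.2; case: e e' => [[a ?] [b ?]] [[a' ?] [b' ?]] /= h1 h2.
split; last by nia.
by case: (ltngtP a a') => [||->]; [left|nia|rewrite leq_add2l; right].
Qed.

(** * The subgraph of the second copy and its progress *)

Section Catchup.
Variables (n : nat) (G G' GB : digraph n).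
Hypothesis GBG : GB \subset G.

Definition kept_set : digraph n := (GB :|: ~: G) :&: G'.
Definition missing_set : digraph n := G' :\: kept_set.

Definition next_graph : digraph n :=
  if [pick e in missing_set] is Some e0
  then [arg min_(e < e0 in missing_set) lex_code e] |: kept_set else kept_set.

Lemma next_graphP e : e \in next_graph <-> e \in kept_set \/
  (e \in missing_set /\ forall e', e' \in missing_set -> lex_code e <= lex_code e').
Proof.
rewrite /next_graph; case: pickP => [e0 e0m|no].
  case: arg_minnP => // m mm mle; rewrite in_setU1; split.
    by move=> /orP[/eqP ->|->]; [right|left].
  move=> [->|[em ele]]; first by rewrite orbT.
  apply/orP; left; apply/eqP; apply: lex_code_inj; apply/eqP; rewrite eqn_leq mle // andbT.
  exact: ele.
by split=> [|[]//]; [left|move=> [em _]; rewrite -[e \in _]/(e \in missing_set) no in em].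
Qed.

Lemma missing_sub : missing_set \subset G :\: GB.
Proof.
apply/subsetP => e; rewrite !inE => /andP[].
by case: (e \in G'); case: (e \in GB); case: (e \in G).
Qed.

Lemma next_graph_sub : next_graph \subset G'.
Proof.
apply/subsetP => e /next_graphP[|[]]; first by rewrite inE => /andP[].
by rewrite inE => /andP[].
Qed.

(** An edge that is inserted now enters the second graph at once, so only old edges can be missing
    and no change enlarges the missing set. Adding one missing edge makes it strictly smaller. *)
Lemma next_graph_progress : ~~ (G' \subset next_graph) -> #|G' :\: next_graph| < #|G :\: GB|.
Proof.
move=> nf; apply: leq_trans (subset_leq_card missing_sub).
case: (pickP (mem missing_set)) => [e0 e0m|no]; last first.
  case/negP: nf; apply/subsetP => e eG; apply/next_graphP; left.
  by have := no e; rewrite inE /= in_setD eG andbT => /negbFE.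
apply: proper_card; rewrite properE; apply/andP; split.
  apply/subsetP => e; rewrite !in_setD => /andP[en eG]; rewrite eG andbT; apply/negP => ek.
  by case/negP: en; apply/next_graphP; left.
case: (@arg_minnP _ e0 (mem missing_set) (@lex_code n) e0m) => m mm mle.
apply/subsetPn; exists m => //; rewrite inE negb_and negbK; apply/orP; left.
by apply/next_graphP; right; split=> // e' /mle.
Qed.

(* The two additional nodes are the ends of the edge that is caught up. *)
Lemma next_graph_diff (S : {set 'I_n}) :
  (forall u w, ((u, w) \in G) != ((u, w) \in G') -> u \in S /\ w \in S) ->
  exists S' : {set 'I_n}, #|S'| <= #|S| + 2 /\
    (forall u w, ((u, w) \in GB) != ((u, w) \in next_graph) -> u \in S' /\ w \in S').
Proof.
move=> hS.
have key (T : digraph n) : (forall e, e \in T -> e \in missing_set) -> next_graph = T :|: kept_set ->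
    forall u w, ((u, w) \in GB) != ((u, w) \in next_graph) -> (u \in S /\ w \in S) \/ (u, w) \in T.
  move=> Tm -> u w; rewrite !inE.
  case: (boolP ((u, w) \in T)) => [|nT] /=; first by right.
  move=> h; left; apply: hS; move: h.
  have /subsetP/(_ (u, w)) := GBG.
  by case: (_ \in GB); case: (_ \in G); case: (_ \in G') => // ->.
have := key; rewrite /next_graph; case: pickP => [e0 e0m|no] K.
  set m := [arg min_(e < e0 in missing_set) lex_code e] in K *.
  have mm : m \in missing_set by rewrite /m; case: arg_minnP.
  exists (S :|: [set m.1; m.2]); split.
    by apply: leq_trans (leq_card_setU _ _) _; rewrite leq_add2l cards2; case: (_ != _).
  move=> u w /(K [set m])[|//||].
  - by move=> e /set1P ->.
  - by move=> [uS wS]; rewrite !inE uS wS.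
  by move=> /set1P E; rewrite -E !inE !eqxx !orbT.
exists S; split; first by rewrite leq_addr.
move=> u w /(K set0)[|||] //; rewrite ?set0U //.
by move=> e; rewrite inE.
by rewrite inE.
Qed.
End Catchup.

Section Run.
Variables (C d c1 f n : nat).
Hypothesis L : large C d c1 (f + 2) n.
Notation A := (6 * C).
Let N := n ^ C.
Let l := log2 n.
Implicit Types st : state (one_schema A) n.

Definition with_graph st (G : digraph n) : structure A := Structure (State G (aux st)).

Definition next_state st st' : Prop := forall tag x1 x2 x3 x4 x5,
  aux6 (Structure st') tag x1 x2 x3 x4 x5 <->
  all (gtn N) [:: tag; x1; x2; x3; x4; x5] /\
  new_aux d c1 (with_graph st (graph st')) tag x1 x2 x3 x4 x5.

(** After l + 3 changes the tables are complete and at most f(l+3) nodes have been touched; from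
    then on, every change removes one of at most (f(l+3))^2 missing edges. *)
Definition early_bound : nat := l + 3 + (f * (l + 3)) ^ 2.

(** [hA] and [hB] bound the number of updates accumulated in the copies. Each update of B reduces
    the missing edges, so B is ready after at most n^2 + 2 updates; copy A inherits this history and
    is replaced after at most n^2 further changes, whence the bound in [inv_hA]. At time tau the
    tables cover the exponents up to 2^(tau-1). *)
Record run_invariant (tau : nat) st (GB : digraph n) (hA hB : nat) : Prop := Invariant {
  inv_old : forall u v, u < N -> v < N -> old_edge (Structure st) u v <-> edge_of (graph st) u v;
  inv_xs : forall a j v, xpow (Structure st) a j v -> v = a ^ j;
  inv_xc : forall a j, 0 < tau -> a < N -> j < N -> j <= 2 ^ tau.-1 -> a ^ j < N ->
    xpow (Structure st) a j (a ^ j);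
  inv_ps : forall p a j v, ppow (Structure st) p a j v -> [/\ v = a ^ j %% p, 0 < tau & j <= 2 ^ tau.-1];
  inv_pc : forall p a j, 0 < tau -> 0 < p -> p < N -> a < N -> j < N -> j <= 2 ^ tau.-1 ->
    ppow (Structure st) p a j (a ^ j %% p);
  inv_nodes : exists W : {set 'I_n}, #|W| <= tau * f /\
    forall u v, (u, v) \in graph st -> u \in W /\ v \in W;
  inv_GB : GB \subset graph st;
  inv_graphB : forall u v, u < N -> v < N -> graphB (Structure st) u v <-> edge_of GB u v;
  inv_hB : hB + #|graph st :\: GB| <= n ^ 2 + 1;
  inv_B : 0 < tau -> forall p, prime p -> p <= n ^ 8 -> poly_copy_ok C p GB hB (cellB (Structure st) p);
  inv_early : ~ valid (Structure st) -> tau <= l + 3 \/ tau + #|graph st :\: GB| <= early_bound;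
  inv_hA : valid (Structure st) -> hA + #|graph st :\: GB| <= 2 * n ^ 2 + 2;
  inv_A : valid (Structure st) -> forall p, prime p -> p <= n ^ 8 ->
    poly_copy_ok C p (graph st) hA (cellA (Structure st) p);
  inv_valid : valid (Structure st) -> 0 < tau /\ n <= (2 ^ tau.-1).+1 }.

Lemma run_invariant_init : run_invariant 0 (init_state (one_schema A) n) set0 0 0.
Proof.
have no tag x1 x2 x3 x4 x5 : ~ aux6 (Structure (init_state (one_schema A) n)) tag x1 x2 x3 x4 x5.
  by move=> [_ [t]]; rewrite inE.
split=> //.
- by move=> u v _ _; split=> [/no//|[a [b [_ _]]]]; rewrite inE.
- by move=> a j v /no.
- by move=> p a j v /no.
- by exists set0; split=> [|u v]; rewrite ?cards0 // inE.
- by move=> u v _ _; split=> [/no//|[a [b [_ _]]]]; rewrite inE.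
- by rewrite set0D cards0.
- by left.
- by move=> /no.
- by move=> /no.
- by move=> /no.
Qed.

Section Step.
Variables (tau : nat) (st st' : state (one_schema A) n) (GB : digraph n) (hA hB : nat) (S : {set 'I_n}).
Hypothesis I : run_invariant tau st GB hA hB.
Hypothesis nx : next_state st st'.
Hypothesis Sf : #|S| <= f.
Hypothesis Sdiff : forall u w, ((u, w) \in graph st) != ((u, w) \in graph st') -> u \in S /\ w \in S.
Let M := with_graph st (graph st').
Let M' : structure A := Structure st'.
Let nltN : n < N := nN L.
Let n0 : 0 < n. Proof. by have := large_n2 L; case: (n). Qed.

Let numM : num C M = N. Proof. by []. Qed.
Let N10 : 10 < N.
Proof.
apply: ltn_trans nltN; apply: leq_ltn_trans (large_dom L); apply: leq_trans (_ : log2 n ^ 1 <= _).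
  by rewrite expn1; apply: leq_trans (large_log L).
by apply: (log_pow_le L).
Qed.

Let oldE u v : u < N -> v < N -> old_edge M u v <-> edge_of (graph st) u v.
Proof. exact: (inv_old I). Qed.
Let graphBE u v : u < N -> v < N -> graphB M u v <-> edge_of GB u v.
Proof. exact: (inv_graphB I). Qed.

Let lt_all tag x1 x2 x3 x4 x5 : tag <= 10 -> x1 < N -> x2 < N -> x3 < N -> x4 < N -> x5 < N ->
  all (gtn N) [:: tag; x1; x2; x3; x4; x5].
Proof. by move=> t h1 h2 h3 h4 h5; rewrite /= (leq_ltn_trans t N10) h1 h2 h3 h4 h5. Qed.

Let N0 : 0 < N. Proof. exact: ltn_trans N10. Qed.

Let GB' := next_graph (graph st) (graph st') GB.

Let ordN (u : 'I_n) : u < N. Proof. exact: ltn_trans (ltn_ord u) nltN. Qed.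

Lemma keptE (u v : 'I_n) : keptB M u v <-> (u, v) \in kept_set (graph st) (graph st') GB.
Proof.
have uN : u < N by exact: ltn_trans nltN.
have vN : v < N by exact: ltn_trans nltN.
rewrite /keptB graphBE // oldE // -[edge M u v]/(edge_of (graph st') u v) !edge_ofE !inE.
by case: (_ \in GB); case: (_ \in graph st); case: (_ \in graph st'); split=> //; intuition.
Qed.

Lemma missingE (u v : 'I_n) : missing M u v <-> (u, v) \in missing_set (graph st) (graph st') GB.
Proof.
rewrite /missing -[edge M u v]/(edge_of (graph st') u v) edge_ofE in_setD andbC.
by split=> [[-> h]|/andP[-> /negP h]]; [apply/negP => /keptE | split=> // /keptE].
Qed.

Lemma new_graphBE u v : u < N -> v < N -> new_graphB M u v <-> edge_of GB' u v.
Proof.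
move=> uN vN; split.
  move=> h; have e : edge_of (graph st') u v by case: h => [[]|[[]]].
  have [a [b [aE bE ab]]] := e; rewrite -aE -bE in h *; apply/edge_ofE/next_graphP.
  case: h => [/keptE|[/missingE h le]]; [by left|right; split=> // -[a' b'] h'].
  by refine (proj2 (lex_code_le (a, b) (a', b')) _); exact: (le _ (ordN a') _ (ordN b') (proj2 (missingE a' b') h')).
move=> [a [b [<- <- /next_graphP[/keptE|[/missingE h le]]]]]; [by left|right; split=> //].
move=> u' u'N v' v'N h'; have [[a' [b' [aE bE ab]]] _] := h'; rewrite -aE -bE in h' *.
by apply/(lex_code_le (a, b) (a', b')); apply: le; apply/missingE.
Qed.

Lemma finishedE : finished M <-> graph st' \subset GB'.
Proof.
split=> [h|/subsetP h].
  apply/subsetP => -[a b] ab; apply/edge_ofE/new_graphBE; try exact: ordN.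
  by apply: h; [exact: ordN|exact: ordN|apply/edge_ofE].
by move=> u uN v vN [a [b [<- <- /h ab]]]; apply/new_graphBE; [exact: ordN|exact: ordN|apply/edge_ofE].
Qed.

Lemma complete_tables : tables_complete M -> n <= (2 ^ tau.-1).+1 /\ 0 < tau.
Proof.
move=> h; have [] := @h 1 _ isT 0 _ n.-1 _ _; rewrite ?numM //; try exact: ltn_trans N10.
- by apply: leq_ltn_trans nltN; exact: leq_pred.
- by rewrite -ltnS (prednK n0).
by move=> v _ /(inv_ps I)[_ t0]; rewrite -ltnS (prednK n0).
Qed.

Lemma tables_ok_of_complete : tables_complete M -> tables_ok N (xpow M) (ppow M) n.
Proof.
move=> /complete_tables[nt t0]; split; first exact: (inv_xs I).
split.
  move=> a j aN jn ajN; apply: (inv_xc I) => //; first exact: ltn_trans nltN.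
  by rewrite -ltnS; exact: leq_trans nt.
split; first by move=> p a j v /(inv_ps I)[].
move=> p a j p0 pN aN jn; apply: (inv_pc I) => //; first exact: ltn_trans nltN.
by rewrite -ltnS; exact: leq_trans nt.
Qed.

Lemma complete_late : l + 2 < tau.+1 -> tables_complete M.
Proof.
move=> lt p pN p0 a aN j jN jn; have pN' : p < N by []. 
exists (a ^ j %% p); first by apply: ltn_trans pN; rewrite ltn_pmod.
apply: (inv_pc I) => //; first by lia.
apply: leq_trans (ltnW jn) _; apply: leq_trans (ltnW (log2_lt n)) _.
by rewrite leq_exp2l //; rewrite -/l; lia.
Qed.

Let diffA : size (diff_seq (graph st) (graph st')) <= f + 2.
Proof. by apply: leq_trans (diff_seq_size Sdiff) _; apply: leq_trans Sf _; rewrite leq_addr. Qed.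

Let diffB : size (diff_seq GB GB') <= f + 2.
Proof.
have [S' [S'c S'd]] := next_graph_diff (inv_GB I) Sdiff.
by apply: leq_trans (diff_seq_size S'd) _; apply: leq_trans S'c _; rewrite leq_add2r.
Qed.

Lemma updB_ok p : tables_complete M -> prime p -> p <= n ^ 8 ->
  poly_copy_ok C p GB' hB.+1 (fun a => updB d c1 M p a).
Proof.
move=> tc pp pn; have [_ t0] := complete_tables tc.
exact: (poly_copy_ok_step L (tables_ok_of_complete tc) graphBE new_graphBE diffB pp pn (inv_B I t0 pp pn)).
Qed.

Lemma updA_ok p : tables_complete M -> valid M -> prime p -> p <= n ^ 8 ->
  poly_copy_ok C p (graph st') hA.+1 (fun a => updA d c1 M p a).
Proof.
move=> tc va pp pn; have [_ t0] := complete_tables tc.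
refine (poly_copy_ok_step L (tables_ok_of_complete tc) oldE _ diffA pp pn (inv_A I va pp pn)).
by [].
Qed.

Ltac new_tag := rewrite /new_aux; split; intuition discriminate.

Let new0 u v : new_aux d c1 M 0 u v 0 0 0 <-> edge M u v. Proof. by new_tag. Qed.
Let new1 a j v : new_aux d c1 M 1 a j v 0 0 <-> new_xpow M a j v. Proof. by new_tag. Qed.
Let new2 p a j v : new_aux d c1 M 2 p a j v 0 <-> new_ppow M p a j v. Proof. by new_tag. Qed.
Let new3 u v : new_aux d c1 M 3 u v 0 0 0 <->
  tables_complete M /\ ~ finished M /\ new_graphB M u v.
Proof. by new_tag. Qed.
Let new5 : new_aux d c1 M 5 0 0 0 0 0 <-> tables_complete M /\ (valid M \/ finished M).
Proof. by new_tag. Qed.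
Let new6 p a i j v : new_aux d c1 M 6 p a i j v <-> tables_complete M /\
  ((finished M /\ updB d c1 M p a i j v) \/ (~ finished M /\ updA d c1 M p a i j v)).
Proof. by new_tag. Qed.
Let new7 p a i j v : new_aux d c1 M 7 p a i j v <->
  (tables_complete M /\ ~ finished M /\ updB d c1 M p a i j v) \/
  ((~ tables_complete M \/ finished M) /\ init_cell M i j v).
Proof. by new_tag. Qed.

Let validE : valid M' <-> tables_complete M /\ (valid M \/ finished M).
Proof.
rewrite -new5; split=> [/nx[]//|h]; apply/nx; split=> //.
exact: lt_all.
Qed.

Let old' u v : u < N -> v < N -> old_edge M' u v <-> edge_of (graph st') u v.
Proof.
move=> uN vN; split=> [/nx[_ /new0]//|h].
by apply/nx; split; [exact: lt_all | apply/new0].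
Qed.

Let xs' a j v : xpow M' a j v -> v = a ^ j.
Proof.
move=> /nx[_ /new1[[-> ->]|[[-> ->]|]]] //.
by move=> [j1 _ [j2 _ [v1 _ [v2 _ [/(inv_xs I) -> [/(inv_xs I) -> [-> ->]]]]]]]; rewrite expnD.
Qed.

Let halves j : 1 < j -> j <= 2 ^ tau -> 0 < tau /\ exists j1 j2,
  [/\ j = j1 + j2, 0 < j1, 0 < j2, j1 <= 2 ^ tau.-1 & j2 <= 2 ^ tau.-1].
Proof.
case: (posnP tau) => [-> j1|t0 j1]; first by rewrite expn0; lia.
rewrite -{1}(prednK t0) expnS; move: (2 ^ tau.-1) => x jx; split=> //.
by exists j./2, (j - j./2); split; lia.
Qed.

Let xc' a j : a < N -> j < N -> j <= 2 ^ tau -> a ^ j < N -> xpow M' a j (a ^ j).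
Proof.
move=> aN jN jt ajN; apply/nx; split; first exact: lt_all.
apply/new1; rewrite /new_xpow; case: j jN jt ajN => [|[|j]] jN jt ajN; [by left|by right; left|].
have [//|t0 [j1 [j2 [jE j10 j20 h1 h2]]]] := halves _ jt.
have pw i : 0 < i -> i <= j.+2 -> a ^ i < N.
  move=> i0 ij; case: (posnP a) => [->|a0]; first by rewrite exp0n.
  by apply: leq_ltn_trans ajN; exact: leq_pexp2l.
have [b1 b2] : j1 <= j.+2 /\ j2 <= j.+2 by lia.
right; right; exists j1; first exact: leq_ltn_trans jN.
exists j2; first exact: leq_ltn_trans jN.
exists (a ^ j1); first exact: pw.
exists (a ^ j2); first exact: pw.
split; first by apply: (inv_xc I) => //; [exact: leq_ltn_trans jN|exact: pw].
split; first by apply: (inv_xc I) => //; [exact: leq_ltn_trans jN|exact: pw].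
by rewrite -expnD -jE.
Qed.

Let ps' p a j v : ppow M' p a j v -> v = a ^ j %% p /\ j <= 2 ^ tau.
Proof.
move=> /nx[_ /new2[p0 [[-> <-]|[[-> <-]|]]]].
- by rewrite expn0.
- by rewrite expn1 expn_gt0.
move=> [j1 _ [j2 _ [v1 _ [v2 _ [/(inv_ps I)[-> t0 h1] [/(inv_ps I)[-> _ h2] [-> <-]]]]]]].
rewrite modnMm -expnD; split=> //.
by rewrite -(prednK t0) expnS mul2n -addnn leq_add.
Qed.

Let pc' p a j : 0 < p -> p < N -> a < N -> j < N -> j <= 2 ^ tau -> ppow M' p a j (a ^ j %% p).
Proof.
move=> p0 pN aN jN jt.
have md x : x %% p < N by apply: ltn_trans pN; rewrite ltn_pmod.
apply/nx; split; first exact: lt_all.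
apply/new2; split=> //; case: j jN jt => [|[|j]] jN jt; [by left|by right; left|].
have [//|t0 [j1 [j2 [jE j10 j20 h1 h2]]]] := halves _ jt.
have [b1 b2] : j1 <= j.+2 /\ j2 <= j.+2 by lia.
right; right; exists j1; first exact: leq_ltn_trans jN.
exists j2; first exact: leq_ltn_trans jN.
exists (a ^ j1 %% p); first exact: md.
exists (a ^ j2 %% p); first exact: md.
split; first by apply: (inv_pc I) => //; exact: leq_ltn_trans jN.
split; first by apply: (inv_pc I) => //; exact: leq_ltn_trans jN.
by rewrite modnMm -expnD -jE.
Qed.

Let nodes' : exists W : {set 'I_n}, #|W| <= tau.+1 * f /\
    forall u v, (u, v) \in graph st' -> u \in W /\ v \in W.
Proof.
have [W [Wc We]] := inv_nodes I; exists (W :|: S); split.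
  by apply: leq_trans (leq_card_setU _ _) _; rewrite mulSn addnC leq_add.
move=> u v uv; rewrite !inE; case: (boolP ((u, v) \in graph st)) => [/We[-> ->]//|no].
by have [|-> ->] := @Sdiff u v; rewrite ?uv ?(negbTE no) // !orbT.
Qed.

Let pN p : p <= n ^ 8 -> p <= N.
Proof. by move=> h; apply: leq_trans h _; apply: (pow_n_le L); apply: leq_trans (large_C L). Qed.

Let cardG : #|graph st'| <= n ^ 2.
Proof. by apply: leq_trans (max_card _) _; rewrite card_prod card_ord mulnn. Qed.

Let valid_late : valid M' -> 0 < tau.+1 /\ n <= (2 ^ tau.+1.-1).+1.
Proof.
move=> /validE[/complete_tables[h t0] _]; split=> //; apply: leq_trans h _.
by rewrite ltnS leq_exp2l // leq_pred.
Qed.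

(** The second copy restarts both while the tables are incomplete and after it has caught up. What
    differs is the state of the first copy, left to the last two hypotheses. *)
Lemma run_invariant_reset (h : nat) : ~ tables_complete M \/ finished M ->
  (valid M' -> h + #|graph st'| <= 2 * n ^ 2 + 2) ->
  (valid M' -> forall p, prime p -> p <= n ^ 8 -> poly_copy_ok C p (graph st') h (cellA M' p)) ->
  run_invariant tau.+1 st' set0 h 0.
Proof.
move=> rst hh hA'; split; rewrite ?setD0 //.
- by move=> a j _; exact: xc'.
- by move=> p a j v /ps'[-> jt].
- by move=> p a j _; exact: pc'.
- exact: sub0set.
- move=> u v uN vN; split; last by move=> [a [b [_ _]]]; rewrite inE.
  by move=> /nx[_ /new3[tc [nf _]]]; case: rst.
- by rewrite add0n; apply: leq_trans cardG _; rewrite leq_addr.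
- move=> _ p pp pn; apply: poly_copy_ok_init => //; first exact: ltn_trans N10.
  move=> a i j v a0 ap vN i_n j_n.
  have iN : i < N by exact: leq_ltn_trans nltN.
  have jN : j < N by exact: leq_ltn_trans nltN.
  split; first by move=> /nx[_ /new7[[tc [nf _]]|[_ h']]] //; case: rst.
  move=> h'; apply/nx; split; last by apply/new7; right.
  apply: lt_all => //; last by apply: leq_trans ap (pN pn).
  have [//|pe] : p < N \/ p = N by have := pN pn; rewrite leq_eqVlt => /orP[/eqP|]; [right|left].
  move: pn; rewrite pe /N leq_exp2l; last exact: large_n2 L.
  by have := large_C L; lia.
- move=> nv; left.
  case: (leqP tau (l + 2)) => [|lt]; first by lia.
  case: nv; apply/validE.
  have tc : tables_complete M by apply: complete_late; lia.
  by split=> //; right; case: rst.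
Qed.

Lemma run_invariant_step : exists GB2 hA2 hB2, run_invariant tau.+1 st' GB2 hA2 hB2.
Proof.
case: (classic (tables_complete M)) => [tc|ntc]; last first.
  exists set0, 0, 0; apply: run_invariant_reset; first by left.
    by move=> /validE[].
  by move=> /validE[].
have ltp p : p <= n ^ 8 -> p < N.
  by move=> h; apply: leq_ltn_trans h _; rewrite ltn_exp2l; [have := large_C L; lia|exact: large_n2 L].
case: (classic (finished M)) => [fi|nf].
  exists set0, hB.+1, 0; apply: run_invariant_reset; first by right.
    move=> _; have := inv_hB I; have := cardG; move: (n ^ 2) => x.
    by move: #|graph st'| #|_ :\: _| => y z; lia.
  move=> _ p pp pn.
  have GE : GB' = graph st'.
    by apply/eqP; rewrite eqEsubset next_graph_sub; apply/finishedE.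
  have := updB_ok tc pp pn; rewrite GE; apply: poly_copy_ok_ext => //; first exact: ltnW (ltp _ pn).
  move=> a i j v aN i_n j_n vN; split; last by move=> /nx[_ /new6[_ [[]|[]]]].
  move=> h; apply/nx; split; last by apply/new6; split=> //; left.
  by apply: lt_all => //; [exact: ltp|exact: leq_ltn_trans nltN|exact: leq_ltn_trans nltN].
have prog : #|graph st' :\: GB'| < #|graph st :\: GB|.
  by apply: next_graph_progress; apply/negP => h; exact: nf (proj2 finishedE h).
exists GB', hA.+1, hB.+1; split => //.
- by move=> a j _; exact: xc'.
- by move=> p a j v /ps'[-> jt].
- by move=> p a j _; exact: pc'.
- exact: next_graph_sub.
- move=> u v uN vN; rewrite -new_graphBE //; split=> [/nx[_ /new3[_ []]]//|h].
  by apply/nx; split; [exact: lt_all|apply/new3].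
- by have := inv_hB I; move: prog; move: #|_ :\: _| #|graph st :\: _| (n ^ 2) => *; lia.
- move=> _ p pp pn.
  have := updB_ok tc pp pn; apply: poly_copy_ok_ext => //; first exact: ltnW (ltp _ pn).
  move=> a i j v aN i_n j_n vN; split; last by move=> /nx[_ /new7[[_ []]|[[]]]].
  move=> h; apply/nx; split; last by apply/new7; left.
  by apply: lt_all => //; [exact: ltp|exact: leq_ltn_trans nltN|exact: leq_ltn_trans nltN].
- move=> nv; have nv0 : ~ valid M by move=> v0; case: nv; apply/validE; split=> //; left.
  case: (inv_early I nv0) => [tl|h]; last first.
    by right; move: h prog; move: #|_ :\: _| #|graph st :\: _| early_bound => *; lia.
  (* At tau = l + 3 the invariant passes from its first to its second alternative: all present edges
     join the at most f * tau nodes affected so far. *)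
  case: (ltnP tau (l + 3)) => [|lt]; first by left.
  have te : tau = l + 3 by lia.
  right; rewrite /early_bound -te.
  have [W [Wc We]] := inv_nodes I.
  have cG : #|graph st :\: GB| <= (f * tau) ^ 2.
    apply: leq_trans (_ : #|setX W W| <= _).
      apply: subset_leq_card; apply/subsetP => -[u v]; rewrite !inE => /andP[_ /We[-> ->]].
      by [].
    by rewrite cardsX mulnn; apply: leq_expl; rewrite mulnC.
  by move: prog cG; move: #|_ :\: _| #|graph st :\: _| ((f * tau) ^ 2) => *; lia.
- move=> /validE[_ [v0|//]]; have := inv_hA I v0; move: prog.
  by move: #|_ :\: _| #|graph st :\: _| (n ^ 2) => *; lia.
- move=> /validE[_ [v0|//]] p pp pn.
  have := updA_ok tc v0 pp pn; apply: poly_copy_ok_ext => //; first exact: ltnW (ltp _ pn).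
  move=> a i j v aN i_n j_n vN; split; last by move=> /nx[_ /new6[_ [[]|[]]]].
  move=> h; apply/nx; split; last by apply/new6; split=> //; right.
  by apply: lt_all => //; [exact: ltp|exact: leq_ltn_trans nltN|exact: leq_ltn_trans nltN].
Qed.
End Step.
End Run.

(** * Distances before the first copy is complete *)

Section EarlyQuery.
Variables (N d : nat) (E : nat -> nat -> Prop).

Definition incident (u : nat) : Prop := exists2 w, w < N & E u w \/ E w u.

Definition hop (q a b : nat) : Prop :=
  exists2 i, i < N & exists2 u, u < N & exists2 w, w < N & exists2 x, x < N & exists2 y, y < N &
    E u w /\ u %% q = x /\ w %% q = y /\ a = x + i * q /\ b = y + (i + 1) * q.

Definition hashed_walk (s t D : nat) : Prop :=
  exists2 q, q < N & is_hash N incident q /\ exists2 x, x < N & exists2 y, y < N &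
    s %% q = x /\ t %% q = y /\ nchain N d (hop q) x (y + D * q).

(** The modulus separates only nodes that have edges. A distance between different nodes involves
    only such nodes; the case s = t is treated apart. *)
Definition early_dist (s t D : nat) : Prop :=
  (s = t /\ D = 0) \/
  (~ s = t /\ incident s /\ incident t /\ hashed_walk s t D /\
   forall D', D' < N -> D' < D -> ~ hashed_walk s t D').
End EarlyQuery.

Lemma dfn_early C d mj k s t D : 0 < C -> 0 < d -> s < k -> t < k -> D < k ->
  dfn C mj k (fun (M : structure (6 * C)) e => early_dist (num C M) d (edge M) (nth 0 e s) (nth 0 e t) (nth 0 e D)).
Proof.
move=> C0 d0 sk tk Dk.
have walk k' s' t' D' : s' < k' -> t' < k' -> D' < k' ->
    dfn C mj k' (fun (M : structure (6 * C)) e => hashed_walk (num C M) d (edge M) (nth 0 e s') (nth 0 e t') (nth 0 e D')).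
  move=> h1 h2 h3; rewrite /hashed_walk /is_hash /incident.
  apply: dfn_ex; apply: dfn_and; first by df.
  apply: dfn_ex; apply: dfn_ex; do 2!(apply: dfn_and; first by df).
  apply: (@dfn_nchain C (6 * C) C0 mj d k'.+3 (fun M e => hop (num C M) (edge M) (nth 0 e 2)) (fun M e => nth 0 e 1) (fun M e => nth 0 e 0 + nth 0 (behead (behead (behead e))) D' * nth 0 e 2)); try by solve_term.
    by rewrite /hop; df.
  by move=> M e _ _ dE; move: d0; rewrite dE.
rewrite /early_dist /incident; apply: dfn_or; first by df.
do 3!(apply: dfn_and; first by df).
apply: dfn_and; first exact: walk.
apply: dfn_all; apply: dfn_imp; first by df.
apply: dfn_not; apply: dfn_ext (walk k.+1 s.+1 t.+1 0 _ _ _) => // M e _ _.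
by rewrite -!nth_behead.
Qed.

Section Paths.
Variables (n : nat) (G : digraph n).

Lemma exists_distance (s t : 'I_n) p : path_from_to G s t p -> exists2 D, is_distance G s t D & D <= size p.
Proof.
move=> pp; have ex : exists m, 0 < walks G m s t by exists (size p); apply/walks_path; exists p.
case: (ex_minnP ex) => m /walks_path mp mn; exists m; last by apply: mn; apply/walks_path; exists p.
by split=> // p' pp'; apply: mn; apply/walks_path; exists p'.
Qed.

(** A shortest path can be taken without repeated nodes, and every node after the source lies in
    W. *)
Lemma distance_le (W : {set 'I_n}) (s t : 'I_n) D :
  (forall u v, (u, v) \in G -> u \in W /\ v \in W) -> is_distance G s t D -> D <= #|W|.
Proof.
move=> hW [[p /andP[pp /eqP lp] sp] mn].
case: (shortenP pp) lp => p' pp' up' _ lp'.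
apply: leq_trans (mn p' _) _; first by rewrite /path_from_to pp' lp' eqxx.
rewrite cardE; apply: uniq_leq_size; first by case/andP: up'.
move=> x; rewrite mem_enum.
elim: p' s pp' {up' lp' mn pp sp} => //= y p' IH s /andP[/hW[_ yW] pp']; rewrite in_cons => /orP[/eqP ->//|].
exact: IH pp'.
Qed.
End Paths.

Section EarlySpec.
Variables (C d c1 f n : nat).
Hypothesis L : large C d c1 (f + 2) n.
Let N := n ^ C.
Let l := log2 n.
Variables (G : digraph n) (W : {set 'I_n}).
Hypothesis GW : forall u v, (u, v) \in G -> u \in W /\ v \in W.
Hypothesis Wl : #|W| <= l ^ 6.
Notation E := (edge_of G).
Let nltN : n < N := nN L.
Let ordN (u : 'I_n) : u < N. Proof. exact: ltn_trans (ltn_ord u) nltN. Qed.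

Lemma incident_ord u : incident N E u -> exists2 x : 'I_n, val x = u & x \in W.
Proof. by move=> [w _ [[a [b [<- _ /GW[]]]]|[a [b [_ <- /GW[]]]]]]; [exists a|exists b]. Qed.

(** The invariant says that a state is the residue of a node reached by a path of the recorded
    length. Injectivity on incident nodes identifies this node with the tail of the next edge. *)
Lemma hashed_walk_sound (s t : 'I_n) D : incident N E s -> incident N E t ->
  hashed_walk N d E s t D -> exists2 p, path_from_to G s t p & size p = D.
Proof.
move=> si ti [q qN [[q0 inj] [x xN [y yN [xE [yE ch]]]]]].
pose Inv z := exists (u : 'I_n) p, [/\ incident N E u, path_from_to G s u p & z = u %% q + size p * q].
have : Inv (y + D * q).
  apply: (nchain_inv _ ch); last by exists s, [::]; split; rewrite ?xE ?mul0n ?addn0 // /path_from_to /= eqxx.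
  move=> a b [i iN [u uN [w wN [x1 _ [y1 _ [uw [ux [wy [-> ->]]]]]]]]] [v [p [vi vp]]].
  rewrite -ux addnC [X in _ = X -> _]addnC.
  move=> h; have [iE uv] := divmod_inj (ltn_pmod _ q0) (ltn_pmod _ q0) h.
  have uE : u = v by apply: inj => //; exists w => //; left.
  have [a' [b' [aE bE ab]]] := uw; have av : a' = v by apply: val_inj; rewrite /= aE.
  exists b', (rcons p b'); split.
  - by exists u => //; right; rewrite bE.
  - move: vp; rewrite /path_from_to rcons_path last_rcons eqxx andbT => /andP[-> /eqP ->].
    by rewrite -av ab.
  by rewrite size_rcons bE wy iE addn1.
move=> [u [p [ui pp]]]; rewrite -yE addnC [X in _ = X -> _]addnC.
move=> h; have [DE tu] := divmod_inj (ltn_pmod _ q0) (ltn_pmod _ q0) h.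
have /val_inj -> : val t = val u by exact: (inj _ (ordN t) _ (ordN u) ti ui tu).
by exists p.
Qed.

Lemma small_hash : exists2 q, 0 < q & q <= l ^ 28 /\ is_hash N (incident N E) q.
Proof.
have l64 : 64 <= l := large_log L.
have lp i : 0 < l ^ i by rewrite expn_gt0; apply/orP; left; apply: leq_trans l64.
have al : all (gtn n) (map val (enum W)) by apply/allP => x /mapP[u _ ->] /=.
have [||q [pq qy inj]] := @exists_hash_prime (map val (enum W)) n (l ^ 14) al.
- by apply: leq_trans (log_pow_le L (ltac:(lia) : 1 <= 14)); rewrite expn1; apply: leq_trans l64.
- rewrite size_map -cardE.
  apply: leq_ltn_trans (_ : n ^ (l ^ 12) < _).
    rewrite leq_exp2l; last exact: large_n2 L.
    by rewrite -[12]/(6 * 2) expnM; apply: leq_expl.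
  apply: leq_ltn_trans (_ : (2 ^ l.+1) ^ (l ^ 12) < _); first by apply: leq_expl; apply: ltnW; exact: log2_lt.
  rewrite -expnM ltn_exp2l // -[l ^ 14]/(l ^ (2 + 12)) expnD ltn_mul2r lp -mulnn /=.
  by move: l64; clear; nia.
have q0 := prime_gt0 pq.
exists q => //; split; first by apply: leq_trans qy _; rewrite -expnM.
split=> // u uN v vN /incident_ord[x <- xW] /incident_ord[y <- yW]; apply: inj; rewrite mem_map ?mem_enum //; exact: val_inj.
Qed.

Lemma hashed_walk_complete (s t : 'I_n) p : path_from_to G s t p -> size p <= l ^ 6 ->
  hashed_walk N d E s t (size p).
Proof.
move=> /andP[pp /eqP lp] sp; have [q q0 [ql hq]] := small_hash.
have l64 : 64 <= l := large_log L.
have BN := chain_params_le (large_chain L).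
have qN : q < N by apply: leq_ltn_trans BN; apply: leq_trans ql _; apply: (log_pow_le L).
exists q => //; split=> //; exists (s %% q); first by apply: ltn_trans qN; rewrite ltn_pmod.
exists (t %% q); first by apply: ltn_trans qN; rewrite ltn_pmod.
do 2!split=> //.
pose g i := nth s (s :: p) i %% q + i * q.
have -> : s %% q = g 0 by rewrite /g /= addn0.
have -> : t %% q + size p * q = g (size p).
  by rewrite /g -lp -nth_last; case: (p) => //= x p'; rewrite (set_nth_default x).
have lB : l ^ 35 <= l ^ 60 by apply: (log_pow_le L).
have gB i : i <= size p -> g i < l ^ 60.
  move=> ip; apply: leq_trans lB; apply: leq_trans (_ : i.+1 * q <= _).
    by rewrite /g mulSn ltn_add2r ltn_pmod.
  apply: leq_trans (_ : l ^ 7 * l ^ 28 <= _); last by rewrite -expnD.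
  apply: leq_mul => //; apply: leq_trans (_ : (l ^ 6).+1 <= _); first by rewrite ltnS (leq_trans ip).
  rewrite [l ^ 7]expnS ltn_Pmull //; first by apply: leq_trans l64.
  by rewrite expn_gt0; apply/orP; left; apply: leq_trans l64.
apply: (@nchain_complete N d (l ^ 60) (size p) _ g) => //; first exact: large_chain L.
  by apply: leq_trans sp _; apply: (log_pow_le L).
move=> i ip; exists i.
  by apply: ltn_trans (_ : size p < N) => //; apply: leq_ltn_trans BN; apply: leq_trans sp _; apply: (log_pow_le L).
exists (nth s (s :: p) i); first exact: ordN.
exists (nth s (s :: p) i.+1); first exact: ordN.
exists (nth s (s :: p) i %% q); first by apply: ltn_trans qN; rewrite ltn_pmod.
exists (nth s (s :: p) i.+1 %% q); first by apply: ltn_trans qN; rewrite ltn_pmod.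
split; last by rewrite addn1.
by apply/edge_ofE; apply: (pathP s pp).
Qed.

Lemma path_incident (s t : 'I_n) p : path_from_to G s t p -> s <> t -> incident N E s /\ incident N E t.
Proof.
move=> /andP[pp /eqP lp] st; split.
  case: p pp lp => [_ /=|x p /= /andP[sx _] _]; first by move=> /st.
  by exists x; [exact: ordN|left; apply/edge_ofE].
case/lastP: p pp lp => [_ /= /st//|p x]; rewrite rcons_path last_rcons => /andP[_ xt] <-.
by exists (last s p); [exact: ordN|right; apply/edge_ofE].
Qed.

Lemma early_distP (s t : 'I_n) D : D < N -> early_dist N d E s t D <-> is_distance G s t D.
Proof.
move=> DN; split.
  move=> [[/val_inj -> ->]|[st [si [ti [wk mn]]]]].
    by split=> //; exists [::] => //; rewrite /path_from_to /= eqxx.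
  have [p pp sp] := hashed_walk_sound si ti wk.
  have [D0 dD0 le] := exists_distance pp; rewrite sp in le.
  case: (ltngtP D0 D) => [lt|lt|<-//]; last by lia.
  case: (mn D0) => //; first exact: ltn_trans DN.
  have le6 := leq_trans (distance_le GW dD0) Wl.
  have [[p0 pp0 sp0] _] := dD0; rewrite -sp0 in le6 *; exact: hashed_walk_complete.
move=> dD; have [[p pp sp] mn] := dD.
case: (eqVneq s t) => [st|/eqP st].
  left; rewrite st; split=> //; apply/eqP; rewrite -leqn0.
  by apply: (mn [::]); rewrite /path_from_to /= st eqxx.
right; split; first by move=> /val_inj.
have [si ti] := path_incident pp st; do 2!split=> //; split.
  have le6 := leq_trans (distance_le GW dD) Wl; rewrite -sp in le6 *; exact: hashed_walk_complete.
move=> D' _ lt /(hashed_walk_sound si ti)[p' pp' sp'].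
by have := mn p' pp'; rewrite sp' leqNgt lt.
Qed.
End EarlySpec.

(** Without a usable first copy, tau is at most [early_bound] <= l^5, and each change touches at
    most f <= l nodes. *)
Lemma early_nodes C d c1 f n tau (st : state (one_schema (6 * C)) n) GB hA hB :
  large C d c1 (f + 2) n -> run_invariant f tau st GB hA hB -> ~ valid (Structure st) ->
  exists2 W : {set 'I_n}, #|W| <= log2 n ^ 6 & forall u v, (u, v) \in graph st -> u \in W /\ v \in W.
Proof.
move=> L I nv; have [W [Wc We]] := inv_nodes I; exists W => //.
have l64 := large_log L; have lF := large_F L.
apply: leq_trans Wc _; rewrite [_ ^ 6]expnSr; apply: leq_mul; last by lia.
have te : tau <= early_bound f n.
  case: (inv_early I nv) => h; first by apply: leq_trans h _; rewrite /early_bound leq_addr.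
  by apply: leq_trans h; rewrite leq_addr.
apply: leq_trans te _; rewrite /early_bound.
have h1 : f * (log2 n + 3) <= log2 n ^ 2 by rewrite -mulnn; nia.
apply: leq_trans (_ : log2 n + 3 + log2 n ^ 4 <= _).
  by rewrite leq_add2l -[4]/(2 * 2) expnM; apply: leq_expl.
rewrite [_ ^ 5]expnS; apply: leq_trans (_ : 2 * log2 n ^ 4 <= _); last by rewrite leq_mul2r; apply/orP; right; lia.
rewrite mul2n -addnn leq_add2r.
apply: leq_trans (_ : log2 n ^ 2 <= _); first by rewrite -mulnn; nia.
exact: (log_pow_le L).
Qed.

(** * Counting and summation by majority *)

Lemma majorityE n (P : nat -> Prop) (p : pred nat) : (forall x, x < n -> (P x <-> p x)) ->
  majority n P <-> n < 2 * count p (iota 0 n).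
Proof.
move=> h; split=> [[s [us sE ns]]|lt].
  suff -> : count p (iota 0 n) = size s by [].
  rewrite -size_filter; apply: perm_size; apply: uniq_perm => //; first by rewrite filter_uniq ?iota_uniq.
  move=> x; rewrite mem_filter mem_iota /= add0n.
  by apply/andP/idP => [[px xn]|/sE[xn Px]]; [apply/sE; split=> //; apply/h | split=> //; apply/h].
exists (filter p (iota 0 n)); rewrite size_filter; split=> //; first by rewrite filter_uniq ?iota_uniq.
move=> x; rewrite mem_filter mem_iota /= add0n.
by split=> [/andP[px xn]|[xn Px]]; [split=> //; apply/h | rewrite xn andbT; apply/h].
Qed.

Lemma count_interval m k (p : pred nat) : count p (iota m k) = \sum_(i < k) p (m + i).
Proof.
elim: k m => [|k IH] m; first by rewrite big_ord0.
rewrite /= IH big_ord_recl /= addn0; congr (_ + _).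
by apply: eq_bigr => i _; rewrite /bump /= add1n addSnnS.
Qed.

Section Counting.
Variables (N n : nat).

(* The majority quantifier compares the number of x < h with P x, for h = n / 2, against the
   length of an interval inside [h, n). *)
Definition count_low (h : nat) (P : nat -> Prop) (c : nat) : Prop :=
  c <= h /\ forall k, k < N -> h + k <= n ->
    (majority n (fun x => (x < h /\ P x) \/ (h <= x /\ x < h + k)) <-> h < c + k).

(** [count_low] uses the upper half of the domain as padding and counts only in the lower half. The
    upper half is shifted down and counted in the same way; an odd domain leaves one more
    element. *)
Definition count_rel (P : nat -> Prop) (c : nat) : Prop :=
  exists2 h, h < N & (n = h + h \/ n = h + h + 1) /\
  exists2 u, u < N & count_low h P u /\
  exists2 v, v < N & count_low h (fun x => exists2 y, y < N & y = h + x /\ P y) v /\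
  exists2 b, b < N & ((b = 1 /\ n = h + h + 1 /\ exists2 y, y < N & y = h + h /\ P y) \/
                      (b = 0 /\ ~ (n = h + h + 1 /\ exists2 y, y < N & y = h + h /\ P y))) /\
    c = u + v + b.

Lemma count_lowP h P (p : pred nat) c : n < N -> h + h <= n -> n <= h + h + 1 ->
  (forall x, x < h -> (P x <-> p x)) -> count_low h P c <-> c = count p (iota 0 h).
Proof.
move=> nN hn nh hp.
have cle : count p (iota 0 h) <= h by rewrite -{2}(size_iota 0 h) count_size.
have key k : h + k <= n -> majority n (fun x => (x < h /\ P x) \/ (h <= x /\ x < h + k)) <->
    h < count p (iota 0 h) + k.
  move=> hk; rewrite (@majorityE n _ (fun x => if x < h then p x else x < h + k)); last first.
    move=> x xn; case: (ltnP x h) => xh; last by split=> [[[]|[]]|]; [|done|right].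
    by split=> [[[_ Px]|[]]|px] //; [exact/hp|left; split=> //; exact/hp].
  have -> : iota 0 n = iota 0 h ++ iota h k ++ iota (h + k) (n - (h + k)).
    by rewrite -iotaD -{1}[h]add0n -iotaD; congr (iota _ _); lia.
  rewrite !count_cat.
  have -> : count (fun x => if x < h then p x else x < h + k) (iota 0 h) = count p (iota 0 h).
    by apply: eq_in_count => x; rewrite mem_iota /= => ->.
  have -> : count (fun x => if x < h then p x else x < h + k) (iota h k) = k.
    rewrite -[RHS](size_iota h k); apply/eqP; rewrite -all_count; apply/allP => x.
    by rewrite mem_iota => /andP[h1 h2]; rewrite ltnNge h1.
  have -> : count (fun x => if x < h then p x else x < h + k) (iota (h + k) (n - (h + k))) = 0.
    apply/eqP; rewrite -leqn0 leqNgt -has_count; apply/hasP => -[x]; rewrite mem_iota => /andP[h1 _].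
    by rewrite ltnNge (leq_trans _ h1) ?leq_addr //= ltnNge h1.
  by lia.
split=> [[ch h1]|->]; last by split=> // k _; exact: key.
case: (ltngtP c (count p (iota 0 h))) => // lt.
  (* The least padding for which the true count gives a majority; it separates the true count from
     the smaller c. *)
  pose k0 := h + 1 - count p (iota 0 h).
  have b1 : h + k0 <= n by rewrite /k0; lia.
  have b2 : k0 < N by lia.
  have b3 : h < count p (iota 0 h) + k0 by rewrite /k0; lia.
  by have := proj1 (h1 k0 b2 b1) (proj2 (key k0 b1) b3); rewrite /k0; lia.
pose k0 := h + 1 - c.
have b1 : h + k0 <= n by rewrite /k0; lia.
have b2 : k0 < N by lia.
have b3 : h < c + k0 by rewrite /k0; lia.
by have := proj1 (key k0 b1) (proj2 (h1 k0 b2 b1) b3); rewrite /k0; lia.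
Qed.

Lemma count_relP P (p : pred nat) c : n < N -> (forall x, x < n -> (P x <-> p x)) ->
  count_rel P c <-> c = count p (iota 0 n).
Proof.
move=> nN hp.
have low h u : h + h <= n -> n <= h + h + 1 -> count_low h P u <-> u = count p (iota 0 h).
  by move=> h1 h2; apply: count_lowP => // x xh; apply: hp; lia.
have high h u : h + h <= n -> n <= h + h + 1 ->
    count_low h (fun x => exists2 y, y < N & y = h + x /\ P y) u <-> u = count p (iota h h).
  move=> h1 h2; have -> : iota h h = map (addn h) (iota 0 h) by rewrite -iotaDl addn0.
  rewrite count_map; apply: count_lowP => // x xh /=.
  split=> [[y _ [-> /hp]]|px]; first by apply; lia.
  by exists (h + x); [lia|split=> //; apply/hp; [lia|]].
have last h b : h + h <= n -> n <= h + h + 1 -> ((b = 1 /\ n = h + h + 1 /\ exists2 y, y < N & y = h + h /\ P y) \/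
    (b = 0 /\ ~ (n = h + h + 1 /\ exists2 y, y < N & y = h + h /\ P y))) <->
    b = count p (iota (h + h) (n - (h + h))).
  move=> h1 h2; have [e|e] : n = h + h \/ n = h + h + 1 by lia.
    rewrite {3}e subnn /=; split=> [[[_ [e' _]]|[-> _]]|->] //; first by lia.
    by right; split=> // -[]; lia.
  have -> : n - (h + h) = 1 by lia.
  rewrite /= addn0; split.
    move=> [[-> [_ [y _ [-> /hp]]]]|[-> np]]; first by rewrite e => -> //; lia.
    case: (boolP (p (h + h))) => // pp; case: np; split=> //; exists (h + h); first lia.
    by split=> //; apply/hp => //; lia.
  case: (boolP (p (h + h))) => pp ->; [left|right]; split=> //; first split=> //.
    by exists (h + h); [lia|split=> //; apply/hp => //; lia].
  by move=> [_ [y _ [-> /hp]]]; rewrite e (negbTE pp) => h3; have: false by apply: h3; lia.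
have tot h : h + h <= n -> n <= h + h + 1 ->
    count p (iota 0 n) = count p (iota 0 h) + count p (iota h h) + count p (iota (h + h) (n - (h + h))).
  move=> h1 h2; rewrite -!count_cat -catA; congr (count p _).
  by rewrite -iotaD -{2}[h]add0n -iotaD; congr (iota _ _); lia.
split.
  move=> [h hN [hE [u uN [hu [v vN [hv [b bN [hb ->]]]]]]]].
  have [h1 h2] : h + h <= n /\ n <= h + h + 1 by lia.
  rewrite (tot h) //.
  by move/(low h u h1 h2): hu => ->; move/(high h v h1 h2): hv => ->; move/(last h b h1 h2): hb => ->.
move=> ->; pose h := n./2.
have [h1 h2] : h + h <= n /\ n <= h + h + 1 by rewrite /h; lia.
have ct m k : k <= n -> count p (iota m k) < N.
  by move=> kn; apply: leq_ltn_trans (_ : k < N); [rewrite -{2}(size_iota m k) count_size|lia].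
exists h; first by lia.
split; first by lia.
exists (count p (iota 0 h)); first by apply: ct; lia.
split; first exact/low.
exists (count p (iota h h)); first by apply: ct; lia.
split; first exact/high.
exists (count p (iota (h + h) (n - (h + h)))); first by apply: ct; lia.
by split; [exact/last | exact: tot].
Qed.
End Counting.

Section Sums.
Variables (N d n : nat) (XP : nat -> nat -> nat -> Prop).

Definition one_bit (R : nat -> nat -> Prop) (w x : nat) : Prop :=
  exists2 y, y < N & exists2 z, z < N & R x y /\ y %/ w = z /\ z %% 2 = 1.

(** Exchange of summation: the sum is obtained by counting, for each bit position b, the x whose
    value has bit b set, and adding the counts with weights 2^b. The outer sum has polylogarithmic
    length. *)
Definition dom_sum (R : nat -> nat -> Prop) (X : nat) : Prop :=
  exists2 nb, nb < N & bits_rel N XP nb /\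
    big_sum N d (fun b v => exists2 w, w < N & exists2 c, c < N &
       XP 2 b w /\ count_rel N n (one_bit R w) c /\ v = w * c) nb X.

(** Sums over n^i indices are nested sums over the domain; [a] collects the leading digits of the
    index. *)
Fixpoint multi_sum (i : nat) (R : nat -> nat -> Prop) (a X : nat) : Prop :=
  if i is i'.+1 then dom_sum (fun x v => exists2 y, y < N & y = a * n + x /\ multi_sum i' R y v) X
  else R a X.
End Sums.

Section SumDefinability.
Variables (C d : nat).
Notation A := (6 * C).
Hypothesis C0 : 0 < C.
Hypothesis d0 : 0 < d.

Ltac df_more ::= first [ df_sums | (apply: dfn_maj => //; df) | (apply: dfn_xpow => //; df) | (apply: dfn_ppow => //; df) | (apply: dfn_aux6 => //; df) ].

Lemma dfn_count_low k (P : structure A -> seq nat -> nat -> Prop) h c :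
  dfn C true k.+1 (fun M e => P M (behead e) (nth 0 e 0)) -> term C k h -> term C k c ->
  dfn C true k (fun M e => count_low (num C M) (dom M) (h M e) (P M e) (c M e)).
Proof.
move=> hP hh hc; rewrite /count_low; apply: dfn_and; first by df.
apply: dfn_all; apply: dfn_imp; first by df.
apply: dfn_iff; last by df.
apply: (@dfn_maj C A C0 k.+1 (fun M e x => x < h M (behead e) /\ P M (behead e) x \/
   h M (behead e) <= x /\ x < h M (behead e) + nth 0 e 0)).
by df.
Qed.

Lemma dfn_count_rel k (P : structure A -> seq nat -> nat -> Prop) c :
  dfn C true k.+1 (fun M e => P M (behead e) (nth 0 e 0)) -> term C k c ->
  dfn C true k (fun M e => count_rel (num C M) (dom M) (P M e) (c M e)).
Proof.
move=> hP hc; rewrite /count_rel; apply: dfn_ex; apply: dfn_and; first by df.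
apply: dfn_ex; apply: dfn_and.
  by apply: (@dfn_count_low k.+2 (fun M e => P M (behead (behead e)))); df.
apply: dfn_ex; apply: dfn_and; last by df.
by apply: (@dfn_count_low k.+3 (fun M e x => exists2 y, y < num C M & y = nth 0 (behead (behead e)) 0 + x /\ P M (behead (behead (behead e))) y)); df.
Qed.

Lemma dfn_dom_sum k (R : structure A -> seq nat -> nat -> nat -> Prop) X :
  dfn C true k.+2 (fun M e => R M (behead (behead e)) (nth 0 e 0) (nth 0 e 1)) -> term C k X ->
  dfn C true k (fun M e => dom_sum (num C M) d (dom M) (xpow M) (R M e) (X M e)).
Proof.
move=> hR hX; rewrite /dom_sum /bits_rel; apply: dfn_ex; apply: dfn_and; first by df.
apply: (@dfn_big_sum C A C0 d d0 true k.+1 (fun M e b v => exists2 w, w < num C M & exists2 c, c < num C M &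
  xpow M 2 b w /\ count_rel (num C M) (dom M) (one_bit (num C M) (R M (behead e)) w) c /\ v = w * c)); try by solve_term.
apply: dfn_ex; apply: dfn_ex; apply: dfn_and; first by df.
apply: dfn_and; last by df.
apply: (@dfn_count_rel k.+4.+1 (fun M e x => one_bit (num C M) (R M (behead (behead (behead (behead (behead e)))))) (nth 0 (behead e) 0) x)); last by solve_term.
by rewrite /one_bit; df.
Qed.

Lemma dfn_multi_sum i k (R : structure A -> seq nat -> nat -> nat -> Prop) a X :
  dfn C true k.+2 (fun M e => R M (behead (behead e)) (nth 0 e 0) (nth 0 e 1)) ->
  a < k -> X < k ->
  dfn C true k (fun M e => multi_sum (num C M) d (dom M) (xpow M) i (R M e) (nth 0 e a) (nth 0 e X)).
Proof.
elim: i k R a X => [|i IH] k R a X hR ak Xk /=; first by df.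
apply: (@dfn_dom_sum k (fun M e x v => exists2 y, y < num C M & y = nth 0 e a * dom M + x /\
   multi_sum (num C M) d (dom M) (xpow M) i (R M e) y v)); last by solve_term.
apply: dfn_ex; apply: dfn_and; first by df.
refine (IH k.+3 (fun M e => R M (behead (behead (behead e)))) 0 2 _ _ _) => //.
by df.
Qed.
End SumDefinability.

Lemma sum_nested n m (F : nat -> nat) :
  \sum_(z < n * m) F z = \sum_(x < n) \sum_(y < m) F (x * m + y).
Proof.
elim: n F => [|n IH] F; first by rewrite mul0n !big_ord0.
rewrite mulSn big_split_ord big_ord_recl /=; congr (_ + _).
have := IH (fun z => F (m + z)) => /= ->.
by apply: eq_bigr => x _; apply: eq_bigr => y _; rewrite /bump /= mulSn addnA.
Qed.

Section SumSpec.
Variables (C d c1 F n : nat) (XP : nat -> nat -> nat -> Prop) (PW : nat -> nat -> nat -> nat -> Prop).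
Hypothesis L : large C d c1 F n.
Let N := n ^ C.
Let l := log2 n.
Hypothesis tok : tables_ok N XP PW n.
Let nltN : n < N := nN L.

Lemma dom_sumP R g X : (forall x v, x < n -> v < N -> (R x v <-> v = g x)) -> (forall x, x < n -> g x < N) ->
  \sum_(x < n) g x < N -> dom_sum N d n XP R X <-> X = \sum_(x < n) g x.
Proof.
move=> hR gN SN; have [X1 [X2 _]] := tok.
pose cnt b := count (fun x => bit (g x) b == 1) (iota 0 n).
have cntP b c : 2 ^ b < N -> c < N -> count_rel N n (one_bit N R (2 ^ b)) c <-> c = cnt b.
  move=> bN cN; apply: count_relP => // x xn; rewrite /one_bit /bit; split.
    by move=> [y yN [z zN [/(hR _ _ xn yN) -> [<- ->]]]].
  move=> /eqP h; exists (g x); first exact: gN.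
  exists (g x %/ 2 ^ b); first by apply: leq_ltn_trans (gN x xn); exact: leq_div.
  by split=> //; apply/hR => //; exact: gN.
have total nb : N <= 2 ^ nb -> \sum_(b < nb) 2 ^ b * cnt b = \sum_(x < n) g x.
  move=> Nb; transitivity (\sum_(b < nb) \sum_(x < n) bit (g x) b * 2 ^ b).
    apply: eq_bigr => b _; rewrite /cnt count_interval -big_distrl /= mulnC; congr (_ * _).
    apply: eq_bigr => x _; rewrite add0n /bit; have := ltn_pmod (g x %/ 2 ^ b) (ltn0Sn 1).
    by case: (_ %% 2) => [|[|]].
  rewrite exchange_big /=; apply: eq_bigr => x _; rewrite bit_sum //.
  by apply: leq_trans Nb; exact: gN.
have main nb : 2 ^ nb.-1 < N -> N <= 2 ^ nb ->
  big_sum N d (fun b v => exists2 w, w < N & exists2 c, c < N &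
       XP 2 b w /\ count_rel N n (one_bit N R w) c /\ v = w * c) nb X <-> X = \sum_(x < n) g x.
  move=> nb1 nb2; have nbl := bits_le L nb1; rewrite -/l in nbl.
  have bN b : b < nb -> 2 ^ b < N.
    by move=> bnb; apply: leq_ltn_trans nb1; rewrite leq_exp2l //; lia.
  have l64 : 64 <= l := large_log L.
  have nbn : nb < n by apply: leq_ltn_trans nbl _; apply: leq_ltn_trans (large_dom L); apply: (log_pow_le L).
  have cN b : cnt b < N by apply: leq_ltn_trans nltN; apply: leq_trans (count_size _ _) _; rewrite size_iota.
  have gle b : b < nb -> 2 ^ b * cnt b <= \sum_(x < n) g x.
    by move=> bnb; rewrite -(total nb nb2) (bigD1 (Ordinal bnb)) //= leq_addr.
  rewrite -(total nb nb2); refine (@big_sumP N d (l ^ 60) (l ^ 2) _ nb (fun b => 2 ^ b * cnt b) X (large_sum L) _ _ _ _).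
  - rewrite -/l -expnM; apply: leq_trans (_ : l ^ 3 * l ^ 4 <= _); last by rewrite -expnD; apply: (log_pow_le L).
    rewrite leq_mul2r; apply/orP; right; apply: leq_ltn_trans nbl _.
    rewrite [l ^ 3]expnS ltn_Pmull //; first by apply: leq_trans l64.
    by rewrite expn_gt0; apply/orP; left; apply: leq_trans l64.
  - move=> b v bnb vN; split.
      by move=> [w wN [c cN' [/X1 we [hc ->]]]]; move: hc; rewrite we => /(cntP b c (bN b bnb) cN') ->.
    move=> ->; exists (2 ^ b); first exact: bN.
    exists (cnt b); first exact: cN.
    split; first by apply: X2 => //; [apply: leq_ltn_trans nltN; exact: large_n2 L|exact: ltn_trans nbn|exact: bN].
    by split=> //; apply/cntP => //; exact: bN.
  - by move=> b bnb; apply: leq_ltn_trans SN; exact: gle.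
  by rewrite (total nb nb2).
split.
  by move=> [nb nbN [/(bits_relP L tok)[_ [b1 b2]] /(main nb b1 b2)]].
have [nb nb0 [b1 b2]] := exists_bits L.
move=> XE; exists nb.
  apply: leq_ltn_trans nltN; apply: ltnW; apply: leq_ltn_trans (large_dom L).
  by apply: leq_trans (bits_le L b1) _; apply: (log_pow_le L).
by split; [apply/(bits_relP L tok)|apply/main].
Qed.

Lemma multi_sumP m k R g i a X : i <= m -> m + k <= C -> a < n ^ (m - i) ->
  (forall x v, x < n ^ m -> v < N -> (R x v <-> v = g x)) -> (forall x, x < n ^ m -> g x < n ^ k) -> X < N ->
  multi_sum N d n XP i R a X <-> X = \sum_(x < n ^ i) g (a * n ^ i + x).
Proof.
move=> + mk + hR gk.
have n0 : 0 < n by have := large_n2 L; case: (n).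
have lt_code j b x : j <= m -> b < n ^ (m - j) -> x < n ^ j -> b * n ^ j + x < n ^ m.
  move=> jm hb hx; apply: leq_trans (_ : b.+1 * n ^ j <= _); first by rewrite mulSn addnC ltn_add2r.
  by rewrite -(subnK jm) expnD leq_mul2r hb orbT.
have sum_lt j b : j <= m -> b < n ^ (m - j) -> 0 < k -> \sum_(x < n ^ j) g (b * n ^ j + x) < N.
  move=> jm hb k0; apply: leq_trans (_ : n ^ (j + k) <= _); last by apply: (pow_n_le L); lia.
  have nj : 0 < n ^ j by rewrite expn_gt0 n0.
  apply: leq_ltn_trans (_ : \sum_(x < n ^ j) (n ^ k).-1 < _).
    apply: leq_sum => x _; have := gk _ (lt_code j b x jm hb (ltn_ord x)).
    by move: (n ^ k) => y; lia.
  rewrite sum_nat_const card_ord expnD ltn_mul2l nj /=.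
  by have : 0 < n ^ k by [rewrite expn_gt0 n0]; move: (n ^ k) => y; lia.
have sum_lt' j b : j <= m -> b < n ^ (m - j) -> \sum_(x < n ^ j) g (b * n ^ j + x) < N.
  case: (posnP k) => k0 jm hb; last exact: sum_lt.
  rewrite big1; first by rewrite expn_gt0 n0.
  by move=> x _; have := gk _ (lt_code j b x jm hb (ltn_ord x)); rewrite k0 expn0; lia.
elim: i a X => [|i IH] a X im ha XN /=.
  rewrite big_ord_recl big_ord0 /= expn0 muln1 !addn0; apply: hR => //.
  by move: ha; rewrite subn0.
have hax x : x < n -> a * n + x < n ^ (m - i).
  move=> xn; apply: leq_trans (_ : a.+1 * n <= _); first by rewrite mulSn addnC ltn_add2r.
  have -> : m - i = (m - i.+1).+1 by lia.
  by rewrite expnSr leq_mul2r ha orbT.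
have E : \sum_(x < n ^ i.+1) g (a * n ^ i.+1 + x) = \sum_(x < n) \sum_(y < n ^ i) g ((a * n + x) * n ^ i + y).
  rewrite expnS (sum_nested _ _ (fun z => g (a * (n * n ^ i) + z))); apply: eq_bigr => x _; apply: eq_bigr => y _.
  by congr g; rewrite mulnDl mulnA addnA.
rewrite E; refine (@dom_sumP _ (fun x => \sum_(y < n ^ i) g ((a * n + x) * n ^ i + y)) X _ _ _).
- move=> x v xn vN; split.
    by move=> [y _ [-> /(IH _ _ (ltnW im) (hax x xn) vN)]].
  move=> ve; exists (a * n + x); last by split=> //; apply/IH => //; [exact: ltnW|exact: hax].
  apply: leq_trans (hax x xn) _; apply: (pow_n_le L); lia.
- by move=> x xn; apply: sum_lt'; [exact: ltnW|exact: hax].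
by rewrite -E; exact: sum_lt'.
Qed.
End SumSpec.

(** * The query *)

Section Query.
Variables (C d : nat).
Notation A := (6 * C).
Implicit Types M : structure A.

(* E(a)^2 X_st(a) is a polynomial in a that vanishes wherever E(a) = 0, that is, wherever the
   cells of the copy are meaningless. *)
Definition query_val M (p s t a v : nat) : Prop :=
  (cellA M p a (dom M) 1 0 /\ v = 0) \/
  exists2 x, x < num C M & exists2 y, y < num C M &
    cellA M p a (dom M) 1 x /\ ~ x = 0 /\ cellA M p a s t y /\ (x * x * y) %% p = v.

(** The sum runs over all a < n^8, whatever p is; points outside 0 < a < p contribute 0. *)
Definition summand M (p s t j a w : nat) : Prop :=
  (0 < a /\ a < p /\ w < p /\ exists2 v, v < num C M & exists2 b, b < num C M &
     query_val M p s t a v /\ ppow M p a j b /\ (w * b) %% p = v) \/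
  (~ (0 < a /\ a < p) /\ w = 0).

(** The number z = 0 is the empty index prefix of [multi_sum], quantified because definability of
    [multi_sum] is available for variables only. The sum is minus the coefficient, which does not
    affect the test for zero. *)
Definition coef_zero M (p s t j : nat) : Prop :=
  exists2 z, z < num C M & z = 0 /\ exists2 X, X < num C M &
    multi_sum (num C M) d (dom M) (xpow M) 8 (summand M p s t j) z X /\ X %% p = 0.

(** Coefficient D is the walk count modulo p only if all smaller counts are exactly 0. This is why
    the earlier coefficients are tested modulo every prime, while one prime suffices to show that
    the count at D is nonzero. *)
Definition late_dist M (s t D : nat) : Prop :=
  (forall p, p < num C M -> prime p -> dom M ^ 4 < p -> p <= dom M ^ 8 ->
     forall j, j < num C M -> j < D -> coef_zero M p s t j) /\
  exists2 p, p < num C M & prime p /\ dom M ^ 4 < p /\ p <= dom M ^ 8 /\ ~ coef_zero M p s t D.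

Definition query M (s t D : nat) : Prop :=
  (valid M /\ late_dist M s t D) \/ (~ valid M /\ early_dist (num C M) d (edge M) s t D).

Hypothesis C0 : 0 < C.
Hypothesis d0 : 0 < d.

Ltac df_more ::= first [ df_sums | (apply: dfn_xpow => //; df) | (apply: dfn_ppow => //; df) | (apply: dfn_aux6 => //; df) ].

Lemma dfn_coef_zero k p s t j : p < k -> s < k -> t < k -> j < k ->
  dfn C true k (fun M e => coef_zero M (nth 0 e p) (nth 0 e s) (nth 0 e t) (nth 0 e j)).
Proof.
move=> pk sk tk jk; rewrite /coef_zero; apply: dfn_ex; apply: dfn_and; first by df.
apply: dfn_ex; apply: dfn_and; last by df.
have hS : dfn C true k.+4 (fun M e => summand M (nth 0 (behead (behead (behead (behead e)))) p)
    (nth 0 (behead (behead (behead (behead e)))) s) (nth 0 (behead (behead (behead (behead e)))) t)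
    (nth 0 (behead (behead (behead (behead e)))) j) (nth 0 e 0) (nth 0 e 1)).
  by rewrite /summand /query_val; df.
have := @dfn_multi_sum C d C0 d0 8 k.+2 (fun M e => summand M (nth 0 (behead (behead e)) p)
  (nth 0 (behead (behead e)) s) (nth 0 (behead (behead e)) t) (nth 0 (behead (behead e)) j)) 1 0 hS isT isT.
by apply: dfn_ext => M e _ _; rewrite [nth 0 (behead e) 0]nth_behead; exact: iff_refl.
Qed.

Lemma dfn_query : dfn C true 3 (fun M e => query M (nth 0 e 0) (nth 0 e 1) (nth 0 e 2)).
Proof.
rewrite /query; apply: dfn_or.
  apply: dfn_and; first by rewrite /valid; df.
  rewrite /late_dist; apply: dfn_and.
    apply: dfn_all; do 3!(apply: dfn_imp; first by df).
    apply: dfn_all; apply: dfn_imp; first by df.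
    by apply: dfn_ext (@dfn_coef_zero 5 1 2 3 0 isT isT isT isT) => M e _ _; rewrite !nth_behead; exact: iff_refl.
  apply: dfn_ex; do 3!(apply: dfn_and; first by df).
  apply: dfn_not.
  by apply: dfn_ext (@dfn_coef_zero 4 0 1 2 3 isT isT isT isT) => M e _ _; rewrite !nth_behead; exact: iff_refl.
apply: dfn_and; last exact: dfn_early.
by apply: dfn_not; rewrite /valid; df.
Qed.
End Query.

Section QuerySpec.
Variables (C d c1 F n : nat) (st : state (one_schema (6 * C)) n) (h : nat).
Hypothesis L : large C d c1 F n.
Let N := n ^ C.
Let M : structure (6 * C) := Structure st.
Hypothesis tok : tables_ok N (xpow M) (ppow M) n.
Hypothesis hn : h <= 2 * n ^ 2 + 2.
Let G := graph st.
Hypothesis cop : forall p, prime p -> p <= n ^ 8 -> poly_copy_ok C p G h (cellA M p).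
Let nltN : n < N := nN L.
Let numM : num C M = N. Proof. by []. Qed.

Lemma n64 : 64 <= n.
Proof.
apply: leq_trans (large_log L) _; apply: ltnW; apply: leq_ltn_trans (large_dom L).
by rewrite -{1}[log2 n]expn1; apply: (log_pow_le L).
Qed.

(** With h <= 2n^2 + 2 the left side is at most 4n^3 + 5n + 2, below n^4 for n >= 64. This is where
    the lower bound on the primes comes from. *)
Lemma size_bound p : n ^ 4 < p -> (h * n + 1) + (h * n + 1) + n <= p.-1.
Proof.
move=> np; apply: leq_trans (_ : n ^ 4 <= _); last by lia.
have e4 : n ^ 4 = n * n * n * n by rewrite !expnSr expn0 mul1n.
have h2 := n64; have h1 := hn; rewrite -mulnn in h1; rewrite e4 {e4 np}.
have : h * n <= (2 * (n * n) + 2) * n by rewrite leq_mul2r h1 orbT.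
have : 64 * (n * n * n) <= n * n * n * n by rewrite mulnC leq_mul2l h2 orbT.
have : 64 * (n * n) <= n * n * n by rewrite mulnC leq_mul2l h2 orbT.
have : 64 * n <= n * n by rewrite leq_mul2r h2 orbT.
have -> : (2 * (n * n) + 2) * n = 2 * (n * n * n) + 2 * n by rewrite mulnDl -!mulnA.
move: (n * n * n * n) (n * n * n) (n * n) (h * n) => x1 x2 x3 x4.
by lia.
Qed.

Section OnePrime.
Variables (p : nat) (s t : 'I_n).
Hypothesis pp : prime p.
Hypothesis p4 : n ^ 4 < p.
Hypothesis p8 : p <= n ^ 8.
Local Notation Fp := ('F_p).
Let pN : p < N.
Proof. by apply: leq_ltn_trans p8 _; rewrite ltn_exp2l; [have := large_C L; lia | exact: large_n2 L]. Qed.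
Let p1 : 1 < p := prime_gt1 pp.
Let valN (x : Fp) : val x < N. Proof. by apply: ltn_trans pN; exact: val_Fp_lt. Qed.
Let n0 : 0 < n. Proof. exact: leq_trans n64. Qed.

Variable (R : {poly Fp}).
Hypothesis R0 : (R.[0] = 1)%R.
Let E : {poly Fp} := (R * \det (lap_poly G Fp))%R.
Hypothesis sE : size E <= h * n + 1.
Hypothesis cE : forall a, 0 < a -> a < p -> copy_ok N G (a%:R)%R (cellA M p a) E.[a%:R]%R.
Let Q : {poly Fp} := (E * R * \adj (lap_poly G Fp) s t)%R.

(** If E(a) is nonzero, the inverse is the adjugate divided by the determinant, and E = R det gives
    E^2 X_st = E R adj_st, the polynomial [Q]. If E(a) = 0, then [Q] vanishes at a, in agreement
    with the first alternative of [query_val]. *)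
Lemma query_valP a v : 0 < a -> a < p -> v < N -> query_val M p s t a v <-> v = val (Q.[a%:R])%R.
Proof.
move=> a0 ap vN; have [X1 Xr] := cE a0 ap.
have QE : (Q.[a%:R] = E.[a%:R] * (R.[a%:R] * \adj (lap_mx G (a%:R : Fp)) s t))%R.
  by rewrite /Q !hornerM adj_lap_eval mulrA.
have N0 : 0 < N by exact: leq_ltn_trans (leq0n p) pN.
have [e0|en0] := eqVneq E.[a%:R]%R 0%R.
  have Q0 : (Q.[a%:R] = 0)%R by rewrite QE e0 mul0r.
  rewrite Q0; split.
    move=> [[_ ->]//|[x xN [y yN [/(X1 _ xN) xe [nx _]]]]].
    by case: nx; rewrite xe e0.
  by move=> ->; left; split=> //; apply/X1 => //; rewrite e0.
have [uG X0 XE] := Xr en0.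
have Eae : (E.[a%:R] = R.[a%:R] * \det (lap_mx G (a%:R : Fp)))%R by rewrite /E hornerM det_lap_eval.
have QE2 : (Q.[a%:R] = E.[a%:R] * E.[a%:R] * invmx (lap_mx G (a%:R : Fp)) s t)%R.
  rewrite QE -!mulrA; congr (_ * _)%R; rewrite Eae -mulrA; congr (_ * _)%R.
  have iE (B : 'M[Fp]_n) : B \in unitmx -> (invmx B s t = (\det B)^-1 * \adj B s t)%R.
    by move=> uB; rewrite /invmx uB [LHS]mxE.
  by rewrite (iE _ uG) mulrA mulfV ?mul1r // -unitfE -unitmxE.
have vE : val (Q.[a%:R])%R = (val E.[a%:R]%R * val E.[a%:R]%R * val (invmx (lap_mx G (a%:R : Fp)) s t)) %% p.
  by rewrite QE2 !val_FpM // modnMml.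
split.
  move=> [[/(X1 _ N0) e00]|[x xN [y yN [/(X1 _ xN) -> [_ [/(XE _ _ _ yN) -> <-]]]]]] //.
  by case/eqP: en0; apply: val_inj.
move=> ->; right; exists (val E.[a%:R]%R) => //; exists (val (invmx (lap_mx G (a%:R : Fp)) s t)) => //.
split; first exact/X1.
split; first by move=> e00; case/eqP: en0; apply: val_inj.
by split; [apply/XE|rewrite -vE].
Qed.

Definition term_val (j a : nat) : nat :=
  if (0 < a) && (a < p) then val (Q.[a%:R] / (a%:R) ^+ j)%R else 0.

Lemma term_val_lt j a : term_val j a < p.
Proof. by rewrite /term_val; case: ifP => _; [exact: val_Fp_lt|exact: prime_gt0]. Qed.

Lemma summandP j a w : j < n -> a < N -> w < N -> summand M p s t j a w <-> w = term_val j a.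
Proof.
move=> jn aN wN; have [_ [_ [P1 P2]]] := tok; rewrite /summand /term_val.
case: (boolP ((0 < a) && (a < p))) => [/andP[a0 ap]|na]; last first.
  split=> [[[a0 [ap _]]|[_ ->]]|->] //; first by rewrite a0 ap in na.
  by right; split=> // -[a0 ap]; rewrite a0 ap in na.
have an0 : ((a%:R : Fp) != 0)%R.
  apply/eqP => /(congr1 val) /=; rewrite val_Fp_nat // modn_small //; lia.
have key v : v < p -> (v * (a ^ j %% p)) %% p = val (Q.[a%:R])%R <-> v = val (Q.[a%:R] / (a%:R) ^+ j)%R.
  move=> vp; have vv : val ((v%:R : Fp)%R) = v by rewrite /= val_Fp_nat // modn_small.
  have -> : (v * (a ^ j %% p)) %% p = val ((v%:R : Fp) * (a%:R) ^+ j)%R.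
    by rewrite modnMmr -natrX -natrM /= val_Fp_nat.
  split=> [/val_inj e|ve].
    by rewrite -{1}vv; congr val; rewrite -e mulfK // expf_neq0.
  by congr val; rewrite ve natr_val_Fp mulfVK // expf_neq0.
have p0 : 0 < p by exact: prime_gt0.
split.
  move=> [[_ [_ [wp [v vN [b bN [/(query_valP a0 ap vN) vE [/P1 -> e]]]]]]]|[na _]]; last by case: na.
  by apply/key; rewrite // e vE.
move=> wE; left; do 2!split=> //; split; first by rewrite wE; exact: val_Fp_lt.
exists (val (Q.[a%:R])%R); first exact: valN.
exists (a ^ j %% p); first by apply: ltn_trans pN; rewrite ltn_pmod.
split; first by apply/query_valP.
split; first exact: P2.
by apply/key => //; rewrite wE; exact: val_Fp_lt.
Qed.

Lemma size_Q : size Q <= p.-1.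
Proof.
apply: leq_trans (size_bound p4).
have Rn0 : (R != 0)%R by apply/eqP => e; move: R0; rewrite e horner0 => /esym/eqP; rewrite oner_eq0.
have dn0 : (\det (lap_poly G Fp) != 0)%R.
  by apply/eqP => e; have := det_lap0 G Fp; rewrite e horner0 => /esym/eqP; rewrite oner_eq0.
have sR : size R <= size E.
  have s0 : 0 < size (\det (lap_poly G Fp))%R by rewrite size_poly_gt0.
  by rewrite /E size_mul // -subn1 -addnBA // leq_addr.
apply: leq_trans (size_polyMleq _ _) _.
have sER : size (E * R)%R <= (h * n + 1) + (h * n + 1).
  apply: leq_trans (size_polyMleq _ _) _; apply: leq_trans (leq_pred _) _.
  by apply: leq_add => //; exact: leq_trans sE.
apply: leq_trans (leq_pred _) _; apply: leq_add => //.
exact: size_adj_lap.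
Qed.

Lemma coef_zeroP j : j < n -> coef_zero d M p s t j <-> (Q`_j = 0)%R.
Proof.
move=> jn.
have sumE : ((\sum_(x < n ^ 8) term_val j x)%:R = - Q`_j :> Fp)%R.
  rewrite (@poly_coef_sum _ Q j) ?card_Fp //; last first.
  - by apply: leq_trans (_ : n <= _); [|have := size_bound p4; lia].
  - exact: size_Q.
  - exact: pchar_Fp_0.
  rewrite opprK (sum_Fp (fun a => Q.[a] / a ^+ j)%R) // natr_sum.
  rewrite -(big_mkord xpredT (fun x => (term_val j x)%:R : Fp)%R) (@big_cat_nat _ _ _ p) //=.
  rewrite [X in (_ + X)%R]big_nat_cond [X in (_ + X)%R]big1 ?addr0; last first.
    by move=> x /andP[/andP[px _] _]; rewrite /term_val [x < p]ltnNge px andbF.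
  rewrite big_ltn ?prime_gt0 // {1}/term_val /= add0r big_add1 big_mkord.
  apply: eq_bigr => i _; have ip : i.+1 < p by have := ltn_ord i; lia.
  by rewrite /term_val ip natr_val_Fp.
have rangeN x : x < n ^ 8 -> x < N.
  by move=> xn; apply: leq_trans xn _; apply: (pow_n_le L); apply: leq_trans (large_C L).
have ms X : X < N -> multi_sum N d n (xpow M) 8 (summand M p s t j) 0 X <-> X = \sum_(x < n ^ 8) term_val j x.
  move=> XN; have := @multi_sumP C d c1 F n (xpow M) (ppow M) L tok 8 8 (summand M p s t j) (term_val j) 8 0 X.
  rewrite mul0n; under [X in _ -> _ -> _ -> _ -> _ -> _ -> (_ <-> _ = X)]eq_bigr do rewrite add0n.
  apply=> //; first by apply: leq_trans (large_C L).
    by move=> x v xn vN; apply: summandP => //; exact: rangeN.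
  by move=> x _; apply: leq_trans (term_val_lt j x) p8.
have N0 : 0 < N by exact: leq_ltn_trans (leq0n p) pN.
have z0 X : (X %% p = 0) <-> (X%:R = 0 :> Fp)%R.
  by have := @natr_Fp_eq p X 0 pp; rewrite mod0n => ->.
split.
  move=> [z zN [-> [X XN [/(ms X XN) -> /z0]]]]; rewrite sumE => /eqP; rewrite oppr_eq0 => /eqP //.
move=> Q0; exists 0 => //; split=> //.
have SN : \sum_(x < n ^ 8) term_val j x < N.
  apply: leq_ltn_trans (_ : \sum_(x < n ^ 8) n ^ 8 < _).
    by apply: leq_sum => x _; apply: leq_trans p8; apply: ltnW; exact: term_val_lt.
  rewrite sum_nat_const card_ord -expnD ltn_exp2l; last exact: large_n2 L.
  by have := large_C L; lia.
exists (\sum_(x < n ^ 8) term_val j x) => //; split; first exact/ms.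
by apply/z0; rewrite sumE Q0 oppr0.
Qed.
End OnePrime.

Lemma coef_zero_walks p (s t : 'I_n) j : prime p -> n ^ 4 < p -> p <= n ^ 8 -> j < n ->
  (forall i, i < j -> walks G i s t = 0) ->
  coef_zero d M p s t j <-> p %| walks G j s t.
Proof.
move=> pp p4 p8 jn hw; have [R [R0 sE cE]] := cop pp p8.
rewrite (coef_zeroP s t pp p4 p8 R0 sE cE jn) (first_coef_walks _ hw); last first.
  by rewrite !hornerM R0 det_lap0 !mulr1.
by rewrite /dvdn; have := @natr_Fp_eq p (walks G j s t) 0 pp; rewrite mod0n => ->; split=> /eqP.
Qed.

Lemma late_distP (s t : 'I_n) D : D < n -> late_dist d M s t D <-> is_distance G s t D.
Proof.
move=> Dn.
have good j : j < n -> 0 < walks G j s t ->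
    exists2 p, p < N & [/\ prime p, n ^ 4 < p, p <= n ^ 8 & ~~ (p %| walks G j s t)].
  move=> jn w0; have [||||p] := @exists_nondividing_prime (primes_in (n ^ 4) (n ^ 8)) (walks G j s t).
  - exact: primes_in_uniq.
  - by apply/allP => p; rewrite mem_primes_in => /and3P[].
  - exact: w0.
  (* A count of walks of length j < n is below n^n < 2^(n^2), so it cannot be divisible by all of
     the at least n^4 primes of the interval. *)
  - have le4 : n ^ 4 <= size (primes_in (n ^ 4) (n ^ 8)).
      have := @many_primes (n ^ 4); rewrite -expnM; apply.
      by apply: leq_trans (_ : n ^ 1 <= _); [rewrite expn1; apply: leq_trans n64|apply: (pow_n_le L)].
    apply: leq_ltn_trans (walks_le _ _ _ _) _; apply: leq_ltn_trans (_ : n ^ n < _).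
      by apply: (pow_n_le L); exact: ltnW.
    apply: leq_ltn_trans (_ : (2 ^ n) ^ n < _); first by apply: leq_expl; apply: ltnW; exact: ltn_expl.
    rewrite -expnM ltn_exp2l // mulnn; apply: leq_trans le4.
    by rewrite ltn_exp2l //; exact: large_n2 L.
  rewrite mem_primes_in => /and3P[pp p4 p8] nd; exists p => //.
  by apply: leq_ltn_trans p8 _; rewrite ltn_exp2l; [have := large_C L; lia | exact: large_n2 L].
have zeros : (forall p, p < num C M -> prime p -> dom M ^ 4 < p -> p <= dom M ^ 8 ->
     forall j, j < num C M -> j < D -> coef_zero d M p s t j) <-> forall j, j < D -> walks G j s t = 0.
  split.
    move=> hz j; have [m] := ubnP j; elim: m j => // m IH j jm jD.
    have hw i : i < j -> walks G i s t = 0 by move=> ij; apply: IH; lia.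
    apply/eqP; rewrite -leqn0 leqNgt; apply/negP => w0.
    have [p pN [pp p4 p8 /negP[]]] := good j (ltn_trans jD Dn) w0.
    apply/(coef_zero_walks pp p4 p8 (ltn_trans jD Dn) hw); apply: hz => //.
    by apply: ltn_trans nltN; exact: ltn_trans Dn.
  move=> hw p pN pp p4 p8 j jN jD; apply/(coef_zero_walks pp p4 p8 (ltn_trans jD Dn)).
    by move=> i ij; apply: hw; exact: ltn_trans jD.
  by rewrite hw // dvdn0.
rewrite /late_dist zeros; split.
  move=> [hw [p pN [pp [p4 [p8 nz]]]]].
  have w0 : 0 < walks G D s t.
    rewrite lt0n; apply/eqP => e; apply: nz; apply/(coef_zero_walks pp p4 p8 Dn hw).
    by rewrite e dvdn0.
  split; first exact/walks_path.
  move=> q qp; rewrite leqNgt; apply/negP => lt; have := hw _ lt; have : 0 < walks G (size q) s t.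
    by apply/walks_path; exists q.
  by move=> + e; rewrite e.
move=> [ex mn].
have hw j : j < D -> walks G j s t = 0.
  move=> jD; apply/eqP; rewrite -leqn0 leqNgt; apply/negP => /walks_path[q qp sq].
  by have := mn q qp; rewrite sq leqNgt jD.
split=> //; have [p pN [pp p4 p8 nd]] := good D Dn (proj2 (walks_path _ _ _ _) ex).
exists p => //; do 3!split=> //; move=> /(coef_zero_walks pp p4 p8 Dn hw).
by rewrite (negbTE nd).
Qed.
End QuerySpec.

Lemma queryP C d c1 f n tau (st : state (one_schema (6 * C)) n) GB hA hB (s t D : 'I_n) :
  large C d c1 (f + 2) n -> run_invariant f tau st GB hA hB ->
  query d (Structure st) s t D <-> is_distance (graph st) s t D.
Proof.
move=> L I; have nltN := nN L; rewrite /query.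
have late : valid (Structure st) -> late_dist d (Structure st) s t D <-> is_distance (graph st) s t D.
  move=> va; have [t0 nt] := inv_valid I va.
  have tok : tables_ok (n ^ C) (xpow (Structure st)) (ppow (Structure st)) n.
    split; first exact: (inv_xs I).
    split.
      move=> a j aN jn ajN; apply: (inv_xc I) => //; first exact: ltn_trans nltN.
      by rewrite -ltnS; exact: leq_trans nt.
    split; first by move=> p a j v /(inv_ps I)[].
    move=> p a j p0 pN aN jn; apply: (inv_pc I) => //; first exact: ltn_trans nltN.
    by rewrite -ltnS; exact: leq_trans nt.
  apply: (@late_distP C d c1 (f + 2) n st hA L tok) => //; last exact: (inv_A I va).
  by apply: leq_trans (inv_hA I va); rewrite leq_addr.
have early : ~ valid (Structure st) -> early_dist (num C (Structure st)) d (edge (Structure st)) s t D <-> is_distance (graph st) s t D.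
  move=> nv; have [W Wl GW] := early_nodes L I nv.
  by apply: (early_distP L GW Wl); exact: ltn_trans (ltn_ord D) nltN.
split=> [[[va /(late va)]|[nv /(early nv)]]//|dD].
case: (Classical_Prop.classic (valid (Structure st))) => [va|nv]; [left|right]; split=> //.
  exact/late.
exact/early.
Qed.

(** * Formulas for small domains and the program *)

Section SmallDomains.
Variable S : schema.

Fixpoint ge_formula (j : nat) : forall k, 'I_k -> formula S k :=
  if j is j'.+1 then fun k i =>
    Fexists (Fand (Fand (Fle S ord0 (lift ord0 i)) (Fnot (Feq S ord0 (lift ord0 i)))) (ge_formula j' ord0))
  else fun k i => Feq S i i.

Fixpoint walk_formula (j : nat) : forall k, 'I_k -> 'I_k -> formula S k :=
  if j is j'.+1 then fun k s t => Fexists (Fand (Fedge S (lift ord0 s) ord0) (walk_formula j' ord0 (lift ord0 t)))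
  else fun k s t => Feq S s t.

Fixpoint no_walk_formula (j k : nat) (s t : 'I_k) : formula S k :=
  if j is j'.+1 then Fand (no_walk_formula j' s t) (Fnot (walk_formula j' s t)) else Feq S s s.

(** The definability lemmas hold only above thresholds. Distances below the constant m are spelled
    out by walks of each length, using no arithmetic, so the formula is correct on every domain. *)
Fixpoint small_formula (m k : nat) (s t d : 'I_k) : formula S k :=
  if m is m'.+1 then For (small_formula m' s t d)
    (Fand (Fand (ge_formula m' d) (Fnot (ge_formula m'.+1 d)))
          (Fand (walk_formula m' s t) (no_walk_formula m' s t)))
  else Fnot (Feq S s s).

Variables (n : nat) (st : state S n).

Lemma sat_ge j k (i : 'I_k) (v : k.-tuple 'I_n) : sat st (ge_formula j i) v = (j <= tnth v i).
Proof.
elim: j k i v => [|j IH] k i v /=; first by rewrite eqxx.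
apply/existsP/idP => [[a]|lt].
  rewrite tnth0 tnthS IH tnth0 => /andP[/andP[le ne] ja]; apply: leq_ltn_trans ja _.
  by rewrite ltn_neqAle le andbT.
have jn : j < n by exact: ltn_trans lt (ltn_ord _).
exists (Ordinal jn); rewrite tnth0 tnthS IH tnth0 /= leqnn andbT (ltnW lt) /=.
by apply/eqP => e; rewrite -e /= ltnn in lt.
Qed.

Lemma sat_walk j k (s t : 'I_k) (v : k.-tuple 'I_n) :
  sat st (walk_formula j s t) v <-> exists2 p, path_from_to (graph st) (tnth v s) (tnth v t) p & size p = j.
Proof.
elim: j k s t v => [|j IH] k s t v /=.
  split=> [/eqP ->|[[|//] /andP[_ /eqP /= ->]]//].
  by exists [::] => //; rewrite /path_from_to /= eqxx.
split=> [/existsP[a]|[[//|a p] /andP[/= /andP[sa pp] lp] [sp]]].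
  rewrite tnth0 tnthS => /andP[sa /IH[p]]; rewrite tnth0 tnthS => /andP[pp lp] sp.
  by exists (a :: p); [rewrite /path_from_to /= sa pp | rewrite /= sp].
apply/existsP; exists a; rewrite tnth0 tnthS sa; apply/IH; exists p => //.
by rewrite tnth0 tnthS /path_from_to pp.
Qed.

Lemma sat_no_walk j k (s t : 'I_k) (v : k.-tuple 'I_n) :
  sat st (no_walk_formula j s t) v <->
  forall p, path_from_to (graph st) (tnth v s) (tnth v t) p -> j <= size p.
Proof.
elim: j => [|j IH] /=; first by rewrite eqxx.
split=> [/andP[/IH h /negP nw] p pp|h].
  rewrite ltn_neqAle h // andbT; apply/negP => /eqP e; apply: nw; apply/sat_walk.
  by exists p.
apply/andP; split; first by apply/IH => p /h; exact: ltnW.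
by apply/negP => /sat_walk[p /h + e]; rewrite e ltnn.
Qed.

Lemma sat_small m k (s t d : 'I_k) (v : k.-tuple 'I_n) :
  sat st (small_formula m s t d) v <->
  tnth v d < m /\ is_distance (graph st) (tnth v s) (tnth v t) (tnth v d).
Proof.
elim: m => [|m IH]; first by rewrite /= eqxx; split=> // -[].
rewrite [small_formula _ _ _ _]/= [sat _ _ _]/=; split.
  move=> /orP[/IH[lt dd]|]; first by split=> //; exact: ltnW.
  rewrite -[~~ _]/(~~ sat st (ge_formula m.+1 d) v) !sat_ge => /andP[/andP[h1 h2] /andP[/sat_walk w /sat_no_walk nw]].
  have -> : nat_of_ord (tnth v d) = m by lia.
  by split.
move=> [lt dd]; apply/orP; case: (ltnP (tnth v d) m) => h; first by left; apply/IH.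
have e : nat_of_ord (tnth v d) = m by lia.
right; rewrite -[~~ _]/(~~ sat st (ge_formula m.+1 d) v) !sat_ge e leqnn ltnn /=; rewrite e in dd.
by case: dd => w nw; apply/andP; split; [apply/sat_walk|apply/sat_no_walk].
Qed.
End SmallDomains.

(** The query has three nodes as free variables, whereas [dfn] works with numbers. Each node is
    replaced by the block of digits with the same value. *)
Lemma bdef_of_dfn C A mj F : 0 < C -> @dfn C A mj 3 F -> bdef mj 3 F.
Proof.
move=> C0 hF.
have al i : i < 3 -> all (gtn (3 * C + 3)) (iota (i * C) C).
  by move=> i3; apply/allP => x; rewrite mem_iota /=; nia.
have eqd i : i < 3 -> @bdef A mj (3 * C + 3) (fun M e =>
    digits_val (dom M) [seq nth 0 e j | j <- iota (i * C) C] = nth 0 e (3 * C + i)).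
  by move=> i3; apply: bdef_digits_eq; try (by apply: al); try (by rewrite size_iota); try by []; exists (3 * C + i) => //; lia.
have hS : @bdef A mj (3 * C + 3) (fun M e => F M (decode (dom M) C 3 [seq nth 0 e j | j <- iota 0 (3 * C)])).
  have := @bdef_subst A mj (3 * C) (3 * C + 3) _ (iota 0 (3 * C)) _ _ hF.
  by apply; [rewrite size_iota|apply/allP => x; rewrite mem_iota /=; lia].
have h := bdef_and (eqd 0 isT) (bdef_and (eqd 1 isT) (bdef_and (eqd 2 isT) hS)).
apply: (bdef_ext (N1 := 1)) (bdef_exs h) => M e M1 se ae; cbv beta.
have blk (dd : seq nat) i : size dd = 3 * C -> i < 3 ->
    digits_val (dom M) [seq nth 0 (dd ++ e) j | j <- iota (i * C) C] = nth 0 (decode (dom M) C 3 dd) i.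
  move=> sd i3; rewrite nth_decode //; congr digits_val; apply/eq_in_map => j; rewrite mem_iota => /andP[_ jl].
  by rewrite nth_cat sd ifT //; nia.
have full (dd : seq nat) : size dd = 3 * C -> [seq nth 0 (dd ++ e) j | j <- iota 0 (3 * C)] = dd.
  move=> sd; apply: (@eq_from_nth _ 0); rewrite size_map size_iota // => i i3.
  by rewrite (nth_map 0) ?size_iota // nth_iota // add0n nth_cat sd i3.
have lastv (dd : seq nat) i : size dd = 3 * C -> nth 0 (dd ++ e) (3 * C + i) = nth 0 e i.
  by move=> sd; rewrite nth_cat sd ltnNge leq_addr /= addKn.
split.
  move=> [dd [sd ad] [e0 [e1 [e2]]]]; rewrite full //.
  suff -> : decode (dom M) C 3 dd = e by [].
  apply: (@eq_from_nth _ 0); first by rewrite size_decode se.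
  rewrite size_decode => i i3; rewrite -blk //.
  by case: i i3 => [|[|[|//]]] _; rewrite ?e0 ?e1 ?e2 lastv.
move=> Fe; pose dd := flatten [seq digits (dom M) C x | x <- e].
have lt x : x \in e -> x < dom M ^ C.
  by move=> /(allP ae) /= xM; apply: leq_trans xM _; rewrite -{1}[dom M]expn1 leq_pexp2l.
have sd : size dd = 3 * C.
  rewrite /dd size_flatten /shape -map_comp (eq_map (g := fun=> C)); last by move=> x /=; rewrite size_digits.
  by rewrite -se; elim: (e) => //= x s ->; rewrite mulSn.
have dE : decode (dom M) C 3 dd = e.
  rewrite /dd -se {se ae Fe dd sd blk full lastv}; elim: e lt => //= x s IH lt.
  rewrite take_size_cat ?drop_size_cat ?size_digits // digitsK ?lt ?mem_head // IH // => y ys.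
  by apply: lt; rewrite in_cons ys orbT.
exists dd.
  split=> //; apply/allP => x /flattenP[s /mapP[y _ ->]]; move: x; apply/allP; exact: digits_lt.
do 3!(split; first by rewrite blk // dE lastv).
by rewrite full // dE.
Qed.

Section Program.
Variables (C d c1 : nat) (phi0 : formula (one_schema (6 * C)) (6 * C)) (N0 : nat).
Hypothesis FO0 : is_FO phi0.
Hypothesis sat0 : forall (M : structure (6 * C)) (v : (6 * C).-tuple 'I_(dom M)), N0 <= dom M ->
  (sat (dom_state M) phi0 v <-> (fun M e => new_aux d c1 M (nth 0 e 0) (nth 0 e 1) (nth 0 e 2) (nth 0 e 3)
     (nth 0 e 4) (nth 0 e 5)) M (decode (dom M) C 6 (map val v))).

Definition distance_program : dynprog := @DynProg (one_schema (6 * C)) (fun _ => phi0) (fun _ => FO0).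

Lemma step_next n (st : state (one_schema (6 * C)) n) (c : change n) : N0 <= n -> 0 < n ->
  next_state d c1 st (@step distance_program n st c).
Proof.
move=> hn n0 tag x1 x2 x3 x4 x5; rewrite /aux6 /auxn.
set st' := step _ _; set xs := [:: tag; x1; x2; x3; x4; x5].
rewrite -[num C (Structure st')]/(n ^ C).
suff key : all (gtn (n ^ C)) xs -> auxrel (Structure st') (flatten [seq digits n C x | x <- xs]) <->
    new_aux d c1 (with_graph st (graph st')) tag x1 x2 x3 x4 x5.
  by split=> -[al h]; split=> //; apply/(key al).
move=> al.
have dE : decode n C 6 (flatten [seq digits n C x | x <- xs]) = xs.
  rewrite -[6]/(size xs); elim: (xs) al => //= x s IH /andP[xn al].
  by rewrite take_size_cat ?drop_size_cat ?size_digits // digitsK // IH.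
have stE (v : (6 * C).-tuple 'I_n) : (v \in aux st' tt) <-> new_aux d c1 (with_graph st (graph st'))
     (nth 0 (decode n C 6 (map val v)) 0) (nth 0 (decode n C 6 (map val v)) 1) (nth 0 (decode n C 6 (map val v)) 2)
     (nth 0 (decode n C 6 (map val v)) 3) (nth 0 (decode n C 6 (map val v)) 4) (nth 0 (decode n C 6 (map val v)) 5).
  by rewrite inE; exact: (@sat0 (with_graph st (graph st')) v hn).
split.
  by move=> [v vin vE]; move/stE: vin; rewrite vE dE.
move=> h; pose x0 : 'I_n := Ordinal n0.
have sz : size [seq insubd x0 y | y <- flatten [seq digits n C x | x <- xs]] == 6 * C.
  rewrite size_map size_flatten /shape -map_comp (eq_map (g := fun=> C)); last by move=> x /=; rewrite size_digits.
  by apply/eqP => /=; lia.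
have vals (ds : seq nat) : all (gtn n) ds -> map val (map (insubd x0) ds) = ds.
  by move=> ad; rewrite -map_comp; apply: map_id_in => y ys; rewrite /= val_insubd ifT //; exact: (allP ad).
have vE : map val (Tuple sz) = flatten [seq digits n C x | x <- xs].
  apply: vals; apply/allP => y /flattenP[ds /mapP[z _ ->]].
  by apply/allP; exact: digits_lt.
by exists (Tuple sz) => //; apply/stE; rewrite vE dE.
Qed.

Lemma run_satisfies_invariant n f (cs : seq (change n)) : N0 <= n -> large C d c1 (f + 2) n ->
  all (fun c => #|affected c| <= f) cs ->
  exists tau GB hA hB, run_invariant f tau (run distance_program cs) GB hA hB.
Proof.
move=> hn L; have n0 : 0 < n by have := large_n2 L; case: (n).
elim/last_ind: cs => [_|cs c IH]; first by exists 0, set0, 0, 0; exact: run_invariant_init.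
rewrite all_rcons => /andP[cf /IH[tau [GB [hA [hB I]]]]].
have rE : run distance_program (rcons cs c) = step (run distance_program cs) c.
  by rewrite /run -cats1 foldl_cat.
rewrite rE.
have [|GB2 [hA2 [hB2 I2]]] := @run_invariant_step C d c1 f n L tau (run distance_program cs)
  (@step distance_program n (run distance_program cs) c) GB hA hB (affected c) I (step_next _ c hn n0) cf.
  move=> u w; rewrite [graph (step _ _)]/= /apply_change => ne.
  have ch : (u, w) \in changed_edges c.
    by move: ne; rewrite !inE; case: (_ \in insertions c); case: (_ \in deletions c); rewrite ?orbT ?orbF //= eqxx.
  by rewrite !inE; split; apply/orP; [left|right]; apply/imsetP; exists (u, w).
by exists tau.+1, GB2, hA2, hB2.
Qed.
End Program.

(** * Growth of the parameters *)

Lemma square_root n : exists2 r, r * r <= n & n < r.+1 * r.+1.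
Proof.
elim: n => [|n [r h1 h2]]; first by exists 0.
case: (ltnP n.+1 (r.+1 * r.+1)) => h; first by exists r => //; exact: leq_trans h1 _.
by exists r.+1 => //; nia.
Qed.

Lemma fact_le_exp m : m`! <= m ^ m.
Proof.
elim: m => // m IH; rewrite factS expnS leq_mul2l /=; apply: leq_trans IH _.
exact: leq_expl.
Qed.

(** Let r be the integer square root of l. Then l <= r^4, so l^60 <= r^240, which is the origin of
    the depth 240, and (l^120)^(r+2) <= r^(480(r+2)) <= (r^960)^r <= 2^(r^2) <= 2^l <= n. *)
Lemma chain_params_log Y C l n : (forall y, Y <= y -> y ^ 960 <= 2 ^ y) -> 0 < C -> 2 ^ l <= n ->
  (Y + 3) * (Y + 3) <= l -> chain_params (n ^ C) 240 (l ^ 60).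
Proof.
move=> hY C0 ln Yl; have [r r1 r2] := square_root l.
have rY : Y + 3 <= r by nia.
have l9 : 9 <= l by nia.
have n0 : 0 < n by apply: leq_trans ln; rewrite expn_gt0.
have lr : l <= r ^ 4.
  apply: ltnW; apply: leq_trans r2 _; rewrite -[4]/(2 * 2) expnM -mulnn.
  by apply: leq_mul; rewrite -mulnn; nia.
have lpow i : 0 < i -> l <= l ^ i.
  by move=> i0; rewrite -{1}[l]expn1; apply: leq_pexp2l => //; lia.
exists r; split.
- by lia.
- apply: leq_ltn_trans (_ : r * r < _); first by nia.
  apply: leq_ltn_trans r1 _; rewrite -{1}[l]expn1 ltn_exp2l //; lia.
- apply: leq_trans (_ : l ^ 2 <= _); first by rewrite -mulnn; nia.
  by rewrite leq_exp2l //; lia.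
- apply: leq_trans (_ : 2 ^ l <= _); last first.
    by apply: leq_trans ln _; rewrite -{1}[n]expn1; apply: leq_pexp2l.
  apply: leq_trans (_ : 2 ^ (r * r) <= _); last by rewrite leq_exp2l.
  rewrite -!expnM; apply: leq_trans (_ : (r ^ 4) ^ (60 * (2 * r.+2)) <= _); first exact: leq_expl.
  apply: leq_trans (_ : (r ^ 960) ^ r <= _).
    by rewrite -!expnM; apply: leq_pexp2l; lia.
  by rewrite [2 ^ (r * r)]expnM; apply: leq_expl; apply: hY; lia.
apply: leq_trans (_ : (r ^ 4) ^ 60 <= _); first exact: leq_expl.
by rewrite -expnM.
Qed.

Section LargeEventually.
Variables (c Y1 Y2 F n : nat).
Let l := log2 n.
Let C := 20 * c + 20.
Hypothesis c0 : 0 < c.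
Hypothesis hY1 : forall y, Y1 <= y -> y ^ 70 <= 2 ^ y.
Hypothesis hY2 : forall y, Y2 <= y -> y ^ 960 <= 2 ^ y.
Hypothesis hF : l ^ F <= n ^ c.
Hypothesis l64 : 64 <= l.
Hypothesis lc : 2 ^ (8 * c) <= l.
Hypothesis lC : 2 * C + 2 <= l.
Hypothesis lY1 : Y1 <= l.
Hypothesis lY2 : (Y2 + 3) * (Y2 + 3) <= l.

Let n0 : 0 < n. Proof. by rewrite lt0n; apply/eqP => e; move: l64; rewrite /l e. Qed.
Let ln : 2 ^ l <= n. Proof. exact: trunc_logP. Qed.
Let nl : n < 2 ^ l.+1. Proof. exact: trunc_log_ltn. Qed.
Let l1 : 0 < l. Proof. exact: leq_trans l64. Qed.
Let l70 : l ^ 70 <= n. Proof. by apply: leq_trans ln; exact: hY1. Qed.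
Let n1 : 1 < n. Proof. by apply: leq_trans ln; rewrite -{1}[2]expn1 leq_exp2l. Qed.

Let lpow i j : i <= j -> l ^ i <= l ^ j. Proof. exact: leq_pexp2l. Qed.
Let npow i j : i <= j -> n ^ i <= n ^ j. Proof. exact: leq_pexp2l. Qed.

Lemma pow_affine a b : b <= 70 -> l ^ (F * a + b) <= n ^ (c * a + 1).
Proof.
move=> b70; rewrite !expnD !expnM expn1; apply: leq_mul; first exact: leq_expl.
by apply: leq_trans l70; exact: lpow.
Qed.

(** From l >= 2^(8c) one gets 2^(8cF) <= l^F <= n^c < 2^((l+1)c), hence 8F <= l. *)
Lemma few_changes : 2 * (F + 2) + 8 <= l.
Proof.
have h1 : (2 ^ (8 * c)) ^ F < 2 ^ (l.+1 * c).
  apply: leq_ltn_trans (leq_expl F lc) _; apply: leq_ltn_trans hF _.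
  by rewrite expnM ltn_exp2r.
have h2 : 8 * c * F < l.+1 * c by move: h1; rewrite -expnM ltn_exp2l.
have h3 : 8 * F < l.+1 by move: h2 c0; clear; nia.
by move: h3 l64; clear; lia.
Qed.

(** With F + 2 changed nodes [large_code] asks for l^(20F+70), which is at most n^(20c+1), hence C =
    20c + 20. The offset must exceed l^(6F+15) <= n^(6c+1), hence 6c + 2. *)
Lemma large_params : large C 240 (6 * c + 2) (F + 2) n.
Proof.
split.
- by apply: (chain_params_log hY2) => //; rewrite /C addn_gt0 orbT.
- exact: l64.
- by rewrite /C leq_addl.
- apply: leq_trans (_ : (2 ^ l.+1) ^ C <= _); first by apply: leq_expl; exact: ltnW.
  rewrite -expnM leq_exp2l // -mulnn -/l; move: lC l1; clear; move: C => C'; nia.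
- exact: few_changes.
- rewrite -/l -expnM; apply: leq_trans (_ : l ^ (F * 20 + 70) <= _); first by apply: lpow; lia.
  apply: leq_trans (pow_affine _ _) _ => //; apply: npow; rewrite /C; lia.
- have fc := few_changes; set m := 2 * (F + 2) + 1.
  apply: leq_ltn_trans (_ : l ^ (F * 6 + 15) < _).
    apply: leq_trans (_ : l ^ m * (l ^ 2) ^ m <= _).
      rewrite leq_mul2r; apply/orP; right; apply: leq_trans (fact_le_exp m) _.
      by apply: leq_expl; rewrite /m; move: fc; clear; lia.
    by rewrite -expnM -expnD /m; apply: lpow; lia.
  apply: leq_ltn_trans (pow_affine _ _) _ => //.
  by rewrite ltn_exp2l //; lia.
- apply: leq_ltn_trans (_ : n * n ^ (6 * c + 2) < _); first by rewrite leq_mul2r n1 orbT.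
  by rewrite -expnS ltn_exp2l // /C; lia.
by apply: leq_trans l70; rewrite -/l ltn_exp2l // ; apply: leq_trans l64.
Qed.
End LargeEventually.

Lemma large_eventually (f : nat -> nat) c0 N1 :
  (forall n, N1 <= n -> log2 n ^ f n <= n ^ c0) ->
  exists C c1 N2, 0 < C /\ forall n, N2 <= n -> large C 240 c1 (f n + 2) n.
Proof.
move=> hf; have [Y1 hY1] := pow_le_exp2 70; have [Y2 hY2] := pow_le_exp2 960.
pose c := c0.+1; pose C := 20 * c + 20.
pose T := 64 + 2 ^ (8 * c) + (2 * C + 2) + Y1 + (Y2 + 3) * (Y2 + 3).
exists C, (6 * c + 2), (N1 + 2 ^ T + 1); split; first by rewrite /C addn_gt0 orbT.
move=> n nT.
have Tl : T <= log2 n.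
  by apply: trunc_log_max => //; apply: leq_trans nT; rewrite addnAC leq_addl.
have nN1 : N1 <= n by apply: leq_trans nT; rewrite -addnA leq_addr.
apply: (@large_params c Y1 Y2) => //.
- apply: leq_trans (hf n nN1) _; apply: leq_pexp2l => //.
  by apply: leq_trans nT; rewrite addn1.
- by apply: leq_trans Tl; rewrite /T -!addnA leq_addr.
- by apply: leq_trans Tl; rewrite /T addnAC [X in _ <= X]addnC addnC; move: (2 ^ _) => x; lia.
- by apply: leq_trans Tl; rewrite /T; move: (2 ^ _) => x; lia.
- by apply: leq_trans Tl; rewrite /T; move: (2 ^ _) => x; lia.
by apply: leq_trans Tl; rewrite /T; move: (2 ^ _) => x; lia.
Qed.

(** * The theorem *)

From mathcomp Require Import lra.
From mathcomp Require Import reals topology normedtype landau sequences exp.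
Import numFieldNormedType.Exports Order.TTheory.
Local Open Scope classical_set_scope.
Local Open Scope ring_scope.

Lemma ln2_ge_half (R : realType) : 2^-1 <= ln 2 :> R.
Proof.
have h : expR (2^-1 : R) <= 2.
  have : 1 + - 2^-1 <= expR (- 2^-1 : R) by exact: expR_ge1Dx.
  have -> : 1 + - 2^-1 = 2^-1 :> R by lra.
  by rewrite expRN lef_pV2 // posrE ?expR_gt0.
by rewrite -[X in X <= _](@expRK R) ler_ln // posrE ?expR_gt0.
Qed.

(** This is the only form in which the growth of f is used. The hypothesis gives f(n) ln ln n <= k
    ln n, and ln(log2 n) is at most 2 ln ln n, so the exponent c only has to exceed 2k. *)
Lemma log_pow_le_of_bigO (R : realType) (f : nat -> nat) :
  (fun n : nat => (f n)%:R : R) =O_\oo (fun n : nat => ln n%:R / ln (ln n%:R) : R) ->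
  exists c N1, forall n, (N1 <= n)%N -> (log2 n ^ f n <= n ^ c)%N.
Proof.
move=> /eqOP/pinfty_ex_gt0[k k0 [N0 _ hN0]].
have k2 : 0 <= 2 * k by lra.
exists (Num.Def.archi_bound (2 * k)), (N0 + 16)%N => n nN.
set c := Num.Def.archi_bound _.
have kc : 2 * k <= c%:R by apply: ltW; exact: archi_boundP.
have n16 : (16 <= n)%N by lia.
have n0 : (0 < n)%N by lia.
have /hN0 hn : (N0 <= n)%N by lia.
have l4 : (4 <= log2 n)%N by apply: trunc_log_max.
have ln_ : (2 ^ log2 n <= n)%N by exact: trunc_logP.
set l := log2 n in l4 ln_ *.
set L : R := ln n%:R in hn.
have lL : l%:R <= 2 * L.
  have h1 : ln (2 ^+ l) <= L :> R by rewrite ler_ln ?posrE ?exprn_gt0 ?ltr0n // -natrX ler_nat.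
  rewrite lnXn // in h1; have := @ln2_ge_half R; rewrite -[ln 2 *+ l]mulr_natl in h1 => h2.
  have l0 : 0 <= l%:R :> R by rewrite ler0n.
  by nra.
have l4R : 4 <= l%:R :> R by rewrite (ler_nat R 4).
have L2 : 2 <= L by lra.
have LL0 : 0 < ln L by apply: ln_gt0; lra.
(* Because l <= 2L and L >= 2, the number l is at most L^2. *)
have lLL : ln l%:R <= 2 * ln L.
  have -> : 2 * ln L = ln (L ^+ 2) by rewrite lnXn ?mulr_natl //; lra.
  rewrite ler_ln ?posrE ?exprn_gt0 //; try lra.
  by rewrite expr2; nra.
have fL : (f n)%:R * ln L <= k * L.
  move: hn; rewrite /= ger0_norm ?ler0n // ger0_norm; last by apply: divr_ge0; lra.
  by rewrite mulrA ler_pdivlMr.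
have l0 : 0 < l%:R :> R by lra.
suff : ln (l%:R ^+ f n) <= ln (n%:R ^+ c) :> R.
  have lf0 : 0 < l%:R ^+ f n :> R by rewrite exprn_gt0.
  have nc0 : 0 < n%:R ^+ c :> R by rewrite exprn_gt0 // ltr0n.
  by rewrite ler_ln ?posrE // -!natrX ler_nat.
have nR0 : 0 < n%:R :> R by rewrite ltr0n.
rewrite (lnXn _ l0) (lnXn _ nR0) -[ln (l%:R : R) *+ _]mulr_natl -[ln (n%:R : R) *+ _]mulr_natl.
have f0 : 0 <= (f n)%:R :> R by rewrite ler0n.
have h1 : (f n)%:R * ln l%:R <= (f n)%:R * (2 * ln L) by rewrite ler_wpM2l.
have h2 : 2 * k * L <= c%:R * L by rewrite ler_wpM2r //; lra.
rewrite -/L; move: h1 h2 fL; rewrite mulrCA.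
by move: ((f n)%:R * ln L) => x; lra.
Qed.

Theorem theorem18 (R : realType) (f : nat -> nat)
    (hf : (fun n : nat => (f n)%:R : R) =O_\oo
          (fun n : nat => ln n%:R / ln (ln n%:R) : R)) :
  exists (P : dynprog) (phi : formula (aux_schema P) 3),
    forall (n : nat) (cs : seq (change n)),
      all (fun c => (#|affected c| <= f n)%N) cs ->
      forall s t d : 'I_n,
        sat (run P cs) phi [tuple s; t; d] <->
        is_distance (graph (run P cs)) s t d.
Proof.
have [c [N1 hc]] := log_pow_le_of_bigO hf.
have [C [c1 [N2 [C0 hL]]]] := large_eventually hc.
have [phi0 [N0 [FO0 sat0]]] := @dfn_new_aux C 240 c1 C0 isT.
have [psi [N3 [_ sat3]]] := bdef_of_dfn C0 (@dfn_query C 240 C0 isT).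
pose P := distance_program FO0.
pose T := (N0 + N2 + N3)%N.
exists P.
(* An element that is at least T exists exactly when n > T, so [psi] is consulted only above all
   thresholds. The second disjunct is sound on every domain and complete for d < T, which covers all
   remaining domains. *)
exists (For (Fand (Fexists (ge_formula (one_schema (6 * C)) T ord0)) psi)
            (small_formula (one_schema (6 * C)) T ord0 (lift ord0 ord0) (lift ord0 (lift ord0 ord0)))).
move=> n cs acs s t d.
have -> : sat (run P cs) (For (Fand (Fexists (ge_formula (one_schema (6 * C)) T ord0)) psi)
    (small_formula (one_schema (6 * C)) T ord0 (lift ord0 ord0) (lift ord0 (lift ord0 ord0)))) [tuple s; t; d] =
  ([exists a : 'I_n, (T <= a)%N] && sat (run P cs) psi [tuple s; t; d]) ||
  sat (run P cs) (small_formula (one_schema (6 * C)) T ord0 (lift ord0 ord0) (lift ord0 (lift ord0 ord0))) [tuple s; t; d].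
  by congr (_ && _ || _); apply: eq_existsb => a; exact: (sat_ge (run P cs) T ord0 [tuple of a :: [tuple s; t; d]]).
have smallE : sat (run P cs) (small_formula (one_schema (6 * C)) T ord0 (lift ord0 ord0) (lift ord0 (lift ord0 ord0)))
     [tuple s; t; d] <-> (d < T)%N /\ is_distance (graph (run P cs)) s t d.
  exact: sat_small.
have big : [exists a : 'I_n, (T <= a)%N] -> sat (run P cs) psi [tuple s; t; d] <-> is_distance (graph (run P cs)) s t d.
  move=> /existsP[a Ta]; have Tn : (T < n)%N by exact: leq_ltn_trans Ta (ltn_ord a).
  have L : large C 240 c1 (f n + 2) n by apply: hL; rewrite /T in Tn; lia.
  have n0 : (N0 <= n)%N by rewrite /T in Tn; lia.
  have [tau [GB [hA [hB I]]]] := @run_satisfies_invariant C 240 c1 phi0 N0 FO0 sat0 n (f n) cs n0 L acs.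
  have := sat3 (Structure (run P cs)) [tuple s; t; d]; rewrite /= => ->; last by rewrite /T in Tn; lia.
  exact: (queryP s t d L I).
split.
  by move=> /orP[/andP[/big h /h]//|/smallE[]].
move=> dd; case: (boolP [exists a : 'I_n, (T <= a)%N]) => [ex|nex]; apply/orP.
  by left; apply/big.
right; apply/smallE; split=> //; rewrite ltnNge; apply/negP => Td.
by case/negP: nex; apply/existsP; exists d.
Qed.
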